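(* Let $u_0\in L^1(\mathbb{R}^N)\cap L^\infty(\mathbb{R}^N)$ and let $f$ be measurable on $Q_T$ with $\int_0^T\big(\|f(\cdot,t)\|_{L^1(\mathbb{R}^N)}+\|f(\cdot,t)\|_{L^\infty(\mathbb{R}^N)}\big)dt<\infty$. Let (S) be a family of schemes indexed by $h>0$ with $\Delta t=o_h(1)$ (i.e. $\Delta t\to0$ as $h\to0^+$) which is consistent, admissible for every $h>0$, and satisfies the uniform Lévy condition (all as defined in the context). Let $\{U_h^j\}_{h>0}$ be the a.e.-solutions of (S) in $L^1(\mathbb{R}^N)\cap L^\infty(\mathbb{R}^N)$ and $\{\widetilde{U}_h\}_{h>0}$ their piecewise linear time interpolants. Then there exist a subsequence $\{\widetilde{U}_{h_n}\}_{n\in\mathbb{N}}$ (with $h_n\to0^+$) and a $u\in C([0,T];L^1_{\mathrm{loc}}(\mathbb{R}^N))$ such that $$\widetilde{U}_{h_n}\to u\quad\text{in}\quad C([0,T];L^1_{\mathrm{loc}}(\mathbb{R}^N))\quad\text{and a.e.}\quad\text{as}\quad n\to\infty.$$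
   Context: Let $N\in\mathbb{N}$, $T>0$, $Q_T=\mathbb{R}^N\times(0,T)$, $a\wedge b=\min\{a,b\}$. Convergence in $C([0,T];L^1_{\mathrm{loc}}(\mathbb{R}^N))$ means $\sup_{t\in[0,T]}\|\cdot\|_{L^1(K)}\to0$ for every compact $K\subset\mathbb{R}^N$. Limit operators: for $\sigma\in\mathbb{R}^{N\times P}$ and a nonnegative symmetric Radon measure $\mu$ on $\mathbb{R}^N\setminus\{0\}$ with $\int_{|z|\le1}|z|^2d\mu+\int_{|z|>1}d\mu<\infty$ (a Lévy measure), put $\mathfrak{L}^{\sigma,\mu}[\psi](x)=\mathrm{tr}(\sigma\sigma^TD^2\psi(x))+\int_{\mathbb{R}^N\setminus\{0\}}\big(\psi(x+z)-\psi(x)-z\cdot D\psi(x)\mathbf{1}_{|z|\le1}\big)d\mu(z)$. Let $\varphi:\mathbb{R}\to\mathbb{R}$ be nondecreasing and continuous; $\varphi,\sigma,\mu$ are the data of the limit equation $\partial_tu-\mathfrak{L}^{\sigma,\mu}[\varphi(u)]=f$, $u(\cdot,0)=u_0$. Discrete operators: for a nonnegative symmetric Radon measure $\nu$ on $\mathbb{R}^N\setminus\{0\}$ of finite total mass $\nu(\mathbb{R}^N)$, $\mathcal{L}^\nu[\psi](x)=\int(\psi(x+z)-\psi(x))d\nu(z)$ (for a.e.-defined $\psi$, a Borel representative is used). Time grid (may depend on $h$): $0=t_0<\dots<t_J=T$, $\Delta t_j=t_j-t_{j-1}$, $\Delta t=\max_j\Delta t_j$, $F^j(x)=\frac1{\Delta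 t_j}\int_{t_{j-1}}^{t_j}f(x,t)dt$. Scheme (S): $U_h^0=u_0$ and, for $j=1,\dots,J$ and a.e. $x$, $$U_h^j(x)=U_h^{j-1}(x)+\Delta t_j\Big(\mathcal{L}_1^h[\varphi_1^h(U_h^j)](x)+\mathcal{L}_2^h[\varphi_2^h(U_h^{j-1})](x)+F^j(x)\Big),\qquad \mathcal{L}_i^h=\mathcal{L}^{\nu_i^h}.$$ Time interpolant: $\widetilde{U}_h(x,0)=U_h^0(x)$ and $\widetilde{U}_h(x,t)=U_h^{j-1}(x)+\frac{t-t_{j-1}}{t_j-t_{j-1}}(U_h^j(x)-U_h^{j-1}(x))$ for $t\in(t_{j-1},t_j]$. Admissible: $\nu_1^h,\nu_2^h$ are nonnegative symmetric finite Radon measures on $\mathbb{R}^N\setminus\{0\}$; $\varphi_1^h$ is nondecreasing and continuous; $\varphi_2^h$ is nondecreasing and locally Lipschitz; and $\Delta t\,L_{\varphi_2^h}\,\nu_2^h(\mathbb{R}^N)\le1$, where $L_{\varphi_2^h}$ is the Lipschitz constant of $\varphi_2^h$ on $[-M,M]$, $M=\|u_0\|_{L^\infty}+\int_0^T\|f(\cdot,\tau)\|_{L^\infty}d\tau$. Consistent: there are nondecreasing continuous $\varphi_1,\varphi_2:\mathbb{R}\to\mathbb{R}$ and operators $\mathfrak{L}_1=\mathfrak{L}^{\sigma_1,\mu_1}$, $\mathfrak{L}_2=\mathfrak{L}^{\sigma_2,\mu_2}$, where for $i=1,2$, $\sigma_i\in\mathbb{R}^{N\times P_i}$ for some $P_i\in\mathbb{N}$,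 $\mu_i$ is a nonnegative symmetric Radon measure on $\mathbb{R}^N\setminus\{0\}$ with $\int_{|z|\le1}|z|^2d\mu_i+\int_{|z|>1}d\mu_i<\infty$, and $\mathfrak{L}^{\sigma_i,\mu_i}[\psi](x)=\mathrm{tr}(\sigma_i\sigma_i^TD^2\psi(x))+\int_{\mathbb{R}^N\setminus\{0\}}\big(\psi(x+z)-\psi(x)-z\cdot D\psi(x)\mathbf{1}_{|z|\le1}\big)d\mu_i(z)$, such that (i) for all $\phi\in L^1(\mathbb{R}^N)\cap L^\infty(\mathbb{R}^N)$, $\mathfrak{L}_1[\varphi_1(\phi)]+\mathfrak{L}_2[\varphi_2(\phi)]=\mathfrak{L}^{\sigma,\mu}[\varphi(\phi)]$ in the sense of distributions, i.e. $\int\big(\varphi_1(\phi)\mathfrak{L}_1[\psi]+\varphi_2(\phi)\mathfrak{L}_2[\psi]-\varphi(\phi)\mathfrak{L}^{\sigma,\mu}[\psi]\big)dx=0$ for all $\psi\in C_c^\infty(\mathbb{R}^N)$; (ii) for some $k_1,k_2\ge0$ and all $\psi\in C_c^\infty(\mathbb{R}^N)$, $\|\mathcal{L}_i^h[\psi]-\mathfrak{L}_i[\psi]\|_{L^1(\mathbb{R}^N)}\le\|\psi\|_{W^{k_i,1}(\mathbb{R}^N)}\,o_h(1)$, $i=1,2$, where $o_h(1)\to0$ as $h\to0^+$ independently of $\psi$; (iii) $\varphi_i^h\to\varphi_i$ locally uniformly as $h\to0^+$, $i=1,2$. Uniform Lévy condition: $\sup_{h<1,\,i=1,2}\int_{|z|>0}|z|^2\wedge1\,d\nu_i^h(z)<\infty$.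 *)

(* Defs.v *)
From HB Require Import structures.
From mathcomp Require Import all_boot all_order all_algebra.
From mathcomp Require Import all_classical all_reals all_analysis.
From mathcomp Require Import measurable_realfun.
Import Order.TTheory GRing.Theory Num.Theory.
Import numFieldNormedType.Exports.

Set Implicit Arguments.
Unset Strict Implicit.
Unset Printing Implicit Defensive.

Local Open Scope classical_set_scope.
Local Open Scope ring_scope.

(* 'rV[R]_n carries the Borel sigma-algebra. *)
Definition borel_rV_display : measure_display. Proof. exact. Qed.

Section borel_rV.
Context {R : realType} {n : nat}.
Let borel : set (set 'rV[R]_n) := <<s @open 'rV[R]_n >>.
Let borel0 : borel set0. Proof. exact: sigma_algebra0. Qed.
Let borelC A : borel A -> borel (~` A). Proof. exact: sigma_algebraC. Qed.
Let borel_bigcup (F : (set 'rV[R]_n)^nat) :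
  (forall i, borel (F i)) -> borel (\bigcup_i F i).
Proof. exact: sigma_algebra_bigcup. Qed.
HB.instance Definition _ := @isMeasurable.Build borel_rV_display
  'rV[R]_n borel borel0 borelC borel_bigcup.
End borel_rV.

Lemma rV_open_measurable {R : realType} {n : nat} (A : set 'rV[R]_n) :
  open A -> measurable A.
Proof. exact: sub_sigma_algebra. Qed.

Lemma measurable_coord {R : realType} {n : nat} (i : 'I_n) :
  measurable_fun setT (fun v : 'rV[R]_n => v 0 i).
Proof.
apply: (measurability _ (RGenOpens.measurableE R)).
move=> _ [_ [a [b ->]] <-]; rewrite setTI.
apply: rV_open_measurable; apply: open_comp; last exact: interval_open.
by move=> v _; exact: coord_continuous.
Qed.

Lemma measurable_fun_rV {d} {T : measurableType d} {R : realType} {n : nat}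
    (f : T -> 'rV[R]_n) :
  (forall i, measurable_fun setT (fun t => f t 0 i)) -> measurable_fun setT f.
Proof.
move=> mf; apply: (@measurability _ _ _ _ _ _ (@open 'rV[R]_n) erefl) => _ [A oA <-].
rewrite setTI.
pose B (p : 'rV[rat]_n * nat) : set 'rV[R]_n :=
  ball (map_mx ratr p.1 : 'rV[R]_n) p.2.+1%:R^-1.
have -> : f @^-1` A = \bigcup_p (if `[< B p `<=` A >] then f @^-1` B p else set0).
  apply/seteqP; split => [t At|t [p _]]; last first.
    by case: asboolP => // + ft; exact.
  have /nbhs_ballP[e /= e0 eA] : nbhs (f t) A by exact: open_nbhs_nbhs.
  have [k ke] : exists k : nat, k.+1%:R^-1 < e / 2.
    have := @near_infty_natSinv_lt R (PosNum (divr_gt0 e0 (ltr0n R 2))).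
    by case=> k _ /(_ k (leqnn k)) /=; exists k.
  have k0 : (0 : R) < k.+1%:R^-1 by rewrite invr_gt0.
  have /choice[q qP] : forall i, exists q : rat, `|ratr q - f t 0 i| < k.+1%:R^-1.
    move=> i; have : f t 0 i - k.+1%:R^-1 < f t 0 i + k.+1%:R^-1.
      by rewrite ltrBlDr -addrA ltrDl addr_gt0.
    by case/rat_in_itvoo => q; rewrite in_itv/= => qi; exists q; rewrite ltr_distl.
  have Bt : B (\row_i q i, k) (f t).
    by split=> // i j; rewrite ord1 !mxE; exact: qP.
  exists (\row_i q i, k) => //; case: asboolP => // -[] v Bv; apply: eA.
  apply: (@le_ball _ _ _ (k.+1%:R^-1 + k.+1%:R^-1)).
    by rewrite (splitr e) lerD// ltW.
  by apply: (ball_triangle _ Bv); exact: ball_sym.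
apply: countable_bigcupT_measurable => // p; case: asboolP => // _.
have -> : f @^-1` B p =
    \bigcap_(i in [set: 'I_n]) (fun t => f t 0 i) @^-1` ball (ratr (p.1 0 i) : R) p.2.+1%:R^-1.
  apply/seteqP; split => [t [_ Bt] i _|t Bt]; first by have := Bt 0 i; rewrite mxE.
  by split=> [|i j]; rewrite ?invr_gt0// ord1 mxE; exact: Bt.
apply: fin_bigcap_measurable => // i _.
by rewrite -[X in measurable X]setTI; apply: mf => //; exact: measurable_ball.
Qed.

(* Lebesgue measure on R^n, as an iterated product of the one on R. *)
Definition cons_rV {R : realType} {n : nat} (p : measurableTypeR R * 'rV[R]_n) :
  'rV[R]_n.+1 := row_mx (const_mx p.1 : 'rV[R]_1) p.2.

Section leb_step.
Context {R : realType} {n : nat}.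

Lemma cons_rV0 (p : measurableTypeR R * 'rV[R]_n) : cons_rV p 0 0 = p.1.
Proof.
by rewrite /cons_rV mxE; case: splitP => [j _|//]; rewrite mxE.
Qed.

Lemma cons_rVS (p : measurableTypeR R * 'rV[R]_n) i :
  cons_rV p 0 (lift ord0 i) = p.2 0 i.
Proof.
rewrite /cons_rV mxE; case: splitP => [j|k].
  by rewrite lift0 ord1.
by rewrite lift0 => -[ik]; congr (p.2 0 _); exact/val_inj.
Qed.

Lemma measurable_cons_rV :
  measurable_fun setT (@cons_rV R n).
Proof.
apply: measurable_fun_rV => i; case: (unliftP ord0 i) => [j ->|->].
  rewrite (_ : (fun _ => _) = (fun v : 'rV[R]_n => v 0 j) \o snd).
    by apply: measurableT_comp => //; exact: measurable_coord.
  by apply/funext => p /=; rewrite cons_rVS.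
rewrite (_ : (fun _ => _) = fst) //.
by apply/funext => p /=; rewrite cons_rV0.
Qed.

Definition uncons_rV (v : 'rV[R]_n.+1) : measurableTypeR R * 'rV[R]_n :=
  (v 0 0, \row_i v 0 (lift ord0 i)).

Lemma cons_rVK : cancel (@cons_rV R n) uncons_rV.
Proof.
case=> x v; rewrite /uncons_rV cons_rV0; congr pair.
by apply/rowP => i; rewrite mxE cons_rVS.
Qed.

Lemma measurable_uncons_rV : measurable_fun setT uncons_rV.
Proof.
apply/measurable_fun_pairP; split; first exact: measurable_coord.
apply: measurable_fun_rV => i.
rewrite (_ : (fun _ => _) = (fun v : 'rV[R]_n.+1 => v 0 (lift ord0 i))).
  exact: measurable_coord.
by apply/funext => v /=; rewrite mxE.
Qed.

Variable mu : {sigma_finite_measure set 'rV[R]_n -> \bar R}.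

Definition leb_step (A : set 'rV[R]_n.+1) : \bar R :=
  (@lebesgue_measure R \x mu)%E (cons_rV @^-1` A).

Let leb_step_measure : {measure set 'rV[R]_n.+1 -> \bar R} :=
  measure_function_pushforward__canonical__measure_function_Measure
    (@lebesgue_measure R \x mu)%E measurable_cons_rV.

Let leb_step0 : leb_step set0 = 0.
Proof. exact: (measure0 leb_step_measure). Qed.

Let leb_step_ge0 A : (0 <= leb_step A)%E.
Proof. exact: (measure_ge0 leb_step_measure). Qed.

Let leb_step_sigma_additive : semi_sigma_additive leb_step.
Proof. exact: (@measure_semi_sigma_additive _ _ _ leb_step_measure). Qed.

HB.instance Definition _ := isMeasure.Build _ _ _ leb_step
  leb_step0 leb_step_ge0 leb_step_sigma_additive.

Let leb_step_sigma_finite : sigma_finite setT leb_step.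
Proof.
have /sigma_finiteP[F [TF ndF Foo]] := sigma_finiteT (@lebesgue_measure R).
have /sigma_finiteP[G [TG ndG Goo]] := sigma_finiteT mu.
exists (fun k => uncons_rV @^-1` (F k `*` G k)).
  apply/esym; rewrite -subTset => v _.
  have [i _ Fi] : (\bigcup_k F k) (uncons_rV v).1 by rewrite -TF.
  have [j _ Gj] : (\bigcup_k G k) (uncons_rV v).2 by rewrite -TG.
  exists (maxn i j) => //; split.
    by move: Fi; exact/subsetPset/ndF/leq_maxl.
  by move: Gj; exact/subsetPset/ndG/leq_maxr.
move=> k; have [mFk Fkoo] := Foo k; have [mGk Gkoo] := Goo k; split.
  rewrite -[X in measurable X]setTI; apply: measurable_uncons_rV => //.
  exact: measurableX.
rewrite /leb_step -comp_preimage (_ : uncons_rV \o cons_rV = idfun); last first.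
  by apply/funext => p; exact: cons_rVK.
rewrite preimage_id product_measure1E//.
by rewrite lte_mul_pinfty// ge0_fin_numE.
Qed.

HB.instance Definition _ := Measure_isSigmaFinite.Build _ _ _ leb_step
  leb_step_sigma_finite.

End leb_step.

Fixpoint leb {R : realType} (n : nat) :
    {sigma_finite_measure set 'rV[R]_n -> \bar R} :=
  match n with
  | 0%N => \d_(0 : 'rV[R]_0)
  | m.+1 => leb_step (leb m)
  end.

Lemma leb_box {R : realType} (n : nat) (A : 'I_n -> set (measurableTypeR R)) :
  (forall i, measurable (A i)) ->
  leb n [set v : 'rV[R]_n | forall i, A i (v 0 i)] =
  (\prod_(i < n) lebesgue_measure (A i))%E.
Proof.
elim: n A => [|n IHn] A mA.
  by rewrite big_ord0 /= diracE mem_set// => -[].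
have mB : measurable [set v : 'rV[R]_n | forall i, A (lift ord0 i) (v 0 i)].
  rewrite (_ : mkset _ = \bigcap_(i in [set: 'I_n])
    (fun v : 'rV[R]_n => v 0 i) @^-1` A (lift ord0 i)).
    apply: fin_bigcap_measurable => // i _.
    by rewrite -[X in measurable X]setTI; exact: (measurable_coord _ _ (mA _)).
  by apply/seteqP; split => [v Av i _|v Av i]; [exact: Av|exact: (Av i)].
rewrite big_ord_recl -IHn// -(product_measure1E _ _ (mA ord0) mB)/=.
rewrite /leb_step; congr ((_ \x _)%E _); apply/seteqP; split => p /=.
  move=> Ap; split => [|i]; first by rewrite -cons_rV0; exact: Ap.
  by rewrite -cons_rVS; exact: Ap.
move=> [Ap0 ApS] i; case: (unliftP ord0 i) => [j ->|->].
  by rewrite cons_rVS; exact: ApS.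
by rewrite cons_rV0.
Qed.

(* The norm carried by 'rV[R]_N in the library is the sup norm; the operators
   below use the Euclidean one. *)
Definition enorm {R : realType} {N : nat} (z : 'rV[R]_N) : R :=
  Num.sqrt (\sum_i z 0 i ^+ 2).

Section calculus.
Context {R : realType} {N : nat}.
Implicit Types psi : 'rV[R]_N -> R.

Definition partial (i : 'I_N) psi : 'rV[R]_N -> R :=
  fun x => 'D_(delta_mx 0 i) psi x.

Definition partials (s : seq 'I_N) psi : 'rV[R]_N -> R := foldr partial psi s.

Definition hessian psi (x : 'rV[R]_N) : 'M[R]_N :=
  \matrix_(i, j) partials [:: i; j] psi x.

Definition smooth psi : Prop := forall s : seq 'I_N,
  continuous (partials s psi) /\
  forall x i, derivable (partials s psi) x (delta_mx 0 i).

Definition test_function psi : Prop :=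
  smooth psi /\ exists2 K : set 'rV[R]_N,
    compact K & forall x, ~ K x -> psi x = 0.

Definition multi_partial (a : 'I_N -> nat) psi : 'rV[R]_N -> R :=
  partials (flatten [seq nseq (a i) i | i <- enum 'I_N]) psi.

(* The multi-indices of length at most k have all entries at most k. *)
Definition sobolev1_norm (k : nat) psi : \bar R :=
  (\sum_(a : {ffun 'I_N -> 'I_k.+1} | (\sum_i a i <= k)%N)
     'N[leb N]_1 [EFin \o multi_partial (fun i => a i) psi])%E.

Definition L1_Loo psi : Prop := psi \in Lfun (leb N) 1 /\ psi \in Lfun (leb N) +oo.

End calculus.

Section operators.
Context {R : realType} {N : nat}.
Implicit Types (mu nu : {measure set 'rV[R]_N -> \bar R}) (psi : 'rV[R]_N -> R).

(* A measure on R^N \ {0} is a measure on R^N that does not charge {0}.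
   Borel measures on R^N \ {0} that are finite on compact sets are regular. *)
Definition symmetric_radon mu : Prop :=
  [/\ mu [set 0] = 0%E,
      forall K : set 'rV[R]_N, compact K -> ~ K 0 -> (mu K < +oo)%E &
      forall A : set 'rV[R]_N, measurable A -> mu (-%R @^-1` A) = mu A].

Definition levy_measure mu : Prop :=
  symmetric_radon mu /\
  (\int[mu]_(z in [set z | (enorm z <= 1)%R]) (enorm z ^+ 2)%:E +
   \int[mu]_(z in [set z | (1 < enorm z)%R]) 1 < +oo)%E.

Definition levy_op (P : nat) (sigma : 'M[R]_(N, P)) mu psi (x : 'rV[R]_N) : R :=
  \tr (sigma *m sigma^T *m hessian psi x) +
  \int[mu]_(z in [set~ 0])
    (psi (x + z) - psi x -
     (\sum_i z 0 i * partial i psi x) * (if enorm z <= 1 then 1 else 0)).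

Definition finite_symmetric nu : Prop :=
  symmetric_radon nu /\ (nu setT < +oo)%E.

Definition discrete_op nu psi (x : 'rV[R]_N) : R :=
  \int[nu]_z (psi (x + z) - psi x).

End operators.

Record scheme (R : realType) (N : nat) := Scheme {
  steps : nat;
  node : nat -> R;
  nu1 : {measure set 'rV[R]_N -> \bar R};
  nu2 : {measure set 'rV[R]_N -> \bar R};
  phi1 : R -> R;
  phi2 : R -> R }.

Section scheme_theory.
Context {R : realType} {N : nat}.
Implicit Types (S : scheme R N) (T : R) (u : 'rV[R]_N -> R)
  (f : 'rV[R]_N -> R -> R).

Definition time_grid S T : Prop :=
  [/\ node S 0 = 0, node S (steps S) = T &
      forall j, (j < steps S)%N -> node S j < node S j.+1].

(* [dt S j], [average f S j] are the time step and the averaged source on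
   ]node S j, node S j.+1[, hence carry index j.+1 in the usual numbering. *)
Definition dt S (j : nat) : R := node S j.+1 - node S j.

Definition mesh S : R := \big[Num.max/0]_(j < steps S) dt S j.

Definition average f S (j : nat) (x : 'rV[R]_N) : R :=
  (dt S j)^-1 *
  \int[lebesgue_measure]_(t in `]node S j, node S j.+1[) f x t.

(* Values of f outside R^N x ]0, T[ are irrelevant. *)
Definition source_term T f : Prop :=
  measurable_fun ([set: 'rV[R]_N] `*` `]0, T[)
    (fun p : ('rV[R]_N * measurableTypeR R)%type => f p.1 p.2) /\
  (\int[lebesgue_measure]_(t in `]0%R, T[)
     ('N[leb N]_1 [EFin \o f^~ t] + 'N[leb N]_+oo [EFin \o f^~ t]) < +oo)%E.

Definition sup_bound u0 f T : R :=
  fine ('N[leb N]_+oo [EFin \o u0] +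
        \int[lebesgue_measure]_(t in `]0%R, T[) 'N[leb N]_+oo [EFin \o f^~ t])%E.

Definition locally_lipschitz (g : R -> R) : Prop :=
  forall r, exists2 e, 0 < e & [lipschitz (g s) | s in ball r e].

Definition lipschitz_constant (A : set R) (g : R -> R) : R :=
  inf [set k : R | 0 <= k /\ k.-lipschitz_A g].

Definition admissible u0 f T S : Prop :=
  [/\ finite_symmetric (nu1 S) /\ finite_symmetric (nu2 S),
      {homo phi1 S : r s / r <= s} /\ continuous (phi1 S),
      {homo phi2 S : r s / r <= s} /\
        locally_lipschitz (phi2 S) &
      let M := sup_bound u0 f T in
      ((mesh S * lipschitz_constant `[- M, M] (phi2 S))%:E * nu2 S setT <= 1)%E].

Definition scheme_solution u0 f S (U : nat -> 'rV[R]_N -> R) : Prop :=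
  [/\ forall j, (j <= steps S)%N -> L1_Loo (U j),
      {ae leb N, forall x, U 0%N x = u0 x} &
      forall j, (j < steps S)%N -> {ae leb N, forall x,
        U j.+1 x = U j x + dt S j *
          (discrete_op (nu1 S) (phi1 S \o U j.+1) x +
           discrete_op (nu2 S) (phi2 S \o U j) x + average f S j x)}].

(* For t in ]0, T] exactly one term of the sum is present. *)
Definition interpolant S (U : nat -> 'rV[R]_N -> R) (t : R) (x : 'rV[R]_N) : R :=
  if t == 0 then U 0%N x else
  \sum_(j < steps S | node S j < t <= node S j.+1)
    (U j x + (t - node S j) / (node S j.+1 - node S j) * (U j.+1 x - U j x)).

Definition consistent (P : nat) (sigma : 'M[R]_(N, P))
    (mu : {measure set 'rV[R]_N -> \bar R}) (phi : R -> R)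
    (S : R -> scheme R N) : Prop :=
  exists (g1 g2 : R -> R) (P1 P2 : nat)
    (sigma1 : 'M[R]_(N, P1)) (sigma2 : 'M[R]_(N, P2))
    (mu1 mu2 : {measure set 'rV[R]_N -> \bar R}),
  [/\ [/\ {homo g1 : r s / r <= s}, continuous g1,
          {homo g2 : r s / r <= s} & continuous g2],
      levy_measure mu1 /\ levy_measure mu2,
      forall w psi, L1_Loo w -> test_function psi ->
        \int[leb N]_x (g1 (w x) * levy_op sigma1 mu1 psi x +
                       g2 (w x) * levy_op sigma2 mu2 psi x -
                       phi (w x) * levy_op sigma mu psi x) = 0,
      exists (k1 k2 : nat) (o1 o2 : R -> R),
        [/\ o1 h @[h --> 0^'+] --> 0, o2 h @[h --> 0^'+] --> 0 &
          \forall h \near 0^'+, forall psi, test_function psi ->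
          ('N[leb N]_1 [EFin \o (discrete_op (nu1 (S h)) psi \-
             levy_op sigma1 mu1 psi)%R] <= sobolev1_norm k1 psi * (o1 h)%:E)%E /\
          ('N[leb N]_1 [EFin \o (discrete_op (nu2 (S h)) psi \-
             levy_op sigma2 mu2 psi)%R] <= sobolev1_norm k2 psi * (o2 h)%:E)%E] &
      {family compact, (fun h => phi1 (S h)) @ 0^'+ --> g1} /\
      {family compact, (fun h => phi2 (S h)) @ 0^'+ --> g2}].

Definition uniform_levy (S : R -> scheme R N) : Prop :=
  let I (nu : {measure set 'rV[R]_N -> \bar R}) := (\int[nu]_(z in [set z | (0 < enorm z)%R])
                 (Num.min (enorm z ^+ 2) 1)%:E)%E in
  (ereal_sup ([set I (nu1 (S h)) | h in `]0%R, 1%R[] `|`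
              [set I (nu2 (S h)) | h in `]0%R, 1%R[]) < +oo)%E.

Definition L1_dist (K : set 'rV[R]_N) (v w : 'rV[R]_N -> R) : \bar R :=
  (\int[leb N]_(x in K) `|v x - w x|%:E)%E.

Definition C_L1loc T (u : R -> 'rV[R]_N -> R) : Prop :=
  forall K : set 'rV[R]_N, compact K ->
    (forall t, t \in `[0, T] -> (leb N).-integrable K (EFin \o u t)) /\
    (forall s, s \in `[0, T] ->
       L1_dist K (u t) (u s) @[t --> within `[0, T] (nbhs s)] --> 0%E).

Definition cvg_C_L1loc T (v : nat -> R -> 'rV[R]_N -> R) (u : R -> 'rV[R]_N -> R) :
    Prop :=
  forall K : set 'rV[R]_N, compact K ->
    ereal_sup [set L1_dist K (v n t) (u t) | t in `[0, T]] @[n --> \oo] --> 0%E.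

Definition cvg_ae_QT T (v : nat -> R -> 'rV[R]_N -> R) (u : R -> 'rV[R]_N -> R) :
    Prop :=
  {ae (leb N \x @lebesgue_measure R)%E, forall p, p.2 \in `]0, T[ ->
    v n p.2 p.1 @[n --> \oo] --> u p.2 p.1}.

End scheme_theory.

(* Main.v *)
(* The estimates are uniform in h and use only admissibility, the uniform Levy
   condition and the local uniform convergence of the nonlinearities.  Each step of
   (S) is an explicit step, order preserving under the CFL condition, followed by an
   implicit one; both are contractions in L^1 and increase the sup norm by at most
   that of the source.  Since (S) is translation invariant, the L^1 modulus of
   continuity in space is controlled by those of u_0 and f.  Let A be the average over
   a small ball.  It commutes with the discrete operators, and by symmetry of the jump
   measures these are bounded on the twice averaged A A g by sup |g| times
   \int |z|^2 /\ 1 d nu; hence A A U is equicontinuous in time, up to the mesh, and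
   in space.  An ultrafilter finer than h -> 0+ makes A A U converge pointwise, hence
   uniformly on compact sets; A being close to the identity in L^1, U is then Cauchy
   in C([0,T]; L^1_loc) along the ultrafilter, and a sequence h_n with summable L^1
   distances yields the limit and the convergence almost everywhere. *)

Require Import Defs.
From mathcomp Require Import all_boot all_order all_algebra.
From mathcomp Require Import all_classical all_reals all_analysis.
From mathcomp Require Import measurable_realfun ess_sup_inf ring lra.
Import Order.TTheory GRing.Theory Num.Theory.
Import numFieldNormedType.Exports.

Set Implicit Arguments.
Unset Strict Implicit.
Unset Printing Implicit Defensive.

Local Open Scope classical_set_scope.
Local Open Scope ring_scope.

(** * Translations and Lebesgue measure *)

(** One average of a bounded function has increments of order |z| /\ 1 only, whereas the Levy
    integral calls for |z|^2 /\ 1. A second average supplies the missing factor once symmetry has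
    turned first differences into second ones, so indicators of balls do the work of smooth kernels.
    The total masses of the jump measures may blow up as h -> 0+; they must not survive in any
    uniform estimate.

    The scheme holds almost everywhere, whereas jump measures may charge Lebesgue null sets.
    Solutions are therefore replaced by truncations bounded at every point, after checking that the
    discrete operators respect equality almost everywhere.

    For the L^1 contraction of the implicit step, the natural test function, the sign of a
    difference, need not be integrable on R^N. A truncated sign is, at the price of an error that
    vanishes with the truncation.

    Equicontinuity in time is only asymptotic as h -> 0+, which compactness along an ultrafilter
    tolerates: limits exist at once at all points of space-time, with no diagonal extraction.
    Sequences reappear only at the end. *)

Section translation.
Context {R : realType}.

(** The pushforward under the translation agrees with Lebesgue measure on half-open intervals, and
    this determines it. *)
Lemma lebesgue_measure_shift (a : R) (A : set (measurableTypeR R)) :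
  measurable A ->
  lebesgue_measure ((fun x : measurableTypeR R => x + a) @^-1` A) =
  lebesgue_measure A.
Proof.
have mphi : measurable_fun setT (fun x : measurableTypeR R => x + a : measurableTypeR R).
  exact: measurable_funD.
move=> mA; apply/esym.
pose m := measure_function_pushforward__canonical__measure_function_Measure
    (@lebesgue_measure R) mphi.
apply: (@lebesgue_measure_unique R m) => //= _ [[b c]] _ <-.
rewrite /pushforward (_ : _ @^-1` _ = `](b - a), (c - a)]%classic); last first.
  by apply/seteqP; split => x /=; rewrite !in_itv/= ltrBlDr lerBrDr.
rewrite !lebesgue_measure_itv/= !lte_fin ltrD2r.
by case: ifPn => // _; congr (_%:E); ring.
Qed.

Lemma measurable_shift n (y : 'rV[R]_n) :
  measurable_fun setT (fun x : 'rV[R]_n => x + y).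
Proof.
apply: measurable_fun_rV => i.
rewrite (_ : (fun _ => _) = (fun x : 'rV[R]_n => x 0 i + y 0 i)).
  by apply: measurable_funD => //; exact: measurable_coord.
by apply/funext => x; rewrite mxE.
Qed.

Lemma measurable_oppV n : measurable_fun setT (fun x : 'rV[R]_n => - x).
Proof.
apply: measurable_fun_rV => i.
rewrite (_ : (fun _ => _) = (fun x : 'rV[R]_n => - (x 0 i))).
  by apply: measurableT_comp => //; exact: measurable_coord.
by apply/funext => x; rewrite mxE.
Qed.

Lemma measurable_addV n : measurable_fun setT (fun p : 'rV[R]_n * 'rV[R]_n => p.1 + p.2).
Proof.
apply: measurable_fun_rV => i.
rewrite (_ : (fun _ => _) = (fun p : 'rV[R]_n * 'rV[R]_n => p.1 0 i + p.2 0 i)).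
  apply: measurable_funD.
    by apply: (measurableT_comp (measurable_coord i)).
  by apply: (measurableT_comp (measurable_coord i)).
by apply/funext => x; rewrite mxE.
Qed.

(** Induction on the dimension: sections of the shifted set are shifted sections of [A], so the
    induction hypothesis removes the shift in the last coordinates and the one-dimensional case that
    in the first. *)
Lemma leb_shift n (y : 'rV[R]_n) (A : set 'rV[R]_n) : measurable A ->
  leb n ((fun x => x + y) @^-1` A) = leb n A.
Proof.
elim: n y A => [|n IH] y A mA.
  by congr (leb 0 _); apply/seteqP; split => x /=; rewrite !thinmx0.
have mA' : measurable ((fun x => x + y) @^-1` A).
  by rewrite -[X in measurable X]setTI; exact: measurable_shift.
have mB := measurable_cons_rV measurableT mA; rewrite setTI in mB.
rewrite /= /leb_step /product_measure1 /=.
pose y' := \row_i y 0 (lift ord0 i) : 'rV[R]_n.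
pose g (x : measurableTypeR R) := leb n (xsection (cons_rV @^-1` A) x).
have mg : measurable_fun setT g by exact: measurable_fun_xsection.
transitivity (\int[lebesgue_measure]_(x in [set: measurableTypeR R]) g ((x : R) + y 0 0)%R)%E.
  apply: eq_integral => x _; rewrite /= /g -[RHS](IH y'); last exact: measurable_xsection.
  congr (leb n _); apply/seteqP; split => v /=; rewrite /xsection /= !inE /=;
    move=> + ; rewrite (_ : cons_rV (x, v) + y = cons_rV ((x : R) + y 0 0 : measurableTypeR R, v + y')) //;
    apply/rowP => i; rewrite [LHS]mxE; case: (unliftP ord0 i) => [j ->|->];
    by rewrite ?cons_rV0 ?cons_rVS ?mxE.
have mphi : measurable_fun setT (fun x : measurableTypeR R => x + y 0 0 : measurableTypeR R).
  exact: measurable_funD.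
rewrite -(@ge0_integral_pushforward _ _ _ _ _ _ mphi (@lebesgue_measure R) setT g)//.
by apply: eq_measure_integral => B mB' _; exact: lebesgue_measure_shift.
Qed.

Context {N : nat}.
Notation X := 'rV[R]_N.

Lemma ge0_integral_shift (y : X) (f : X -> \bar R) : measurable_fun setT f ->
  (forall x, 0 <= f x)%E ->
  (\int[leb N]_x f (x + y)%R = \int[leb N]_x f x)%E.
Proof.
move=> mf f0.
rewrite -(@ge0_integral_pushforward _ _ _ _ _ _ (measurable_shift y) (leb N) setT f)//.
by apply: eq_measure_integral => [|mp B mB _]; [exact: measurable_shift|exact: leb_shift].
Qed.

Lemma integral_shift (y : X) (f : X -> \bar R) : measurable_fun setT f ->
  (\int[leb N]_x f (x + y)%R = \int[leb N]_x f x)%E.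
Proof.
move=> mf; rewrite integralE [RHS]integralE.
rewrite -(ge0_integral_shift y (measurable_funepos mf))//.
rewrite -(ge0_integral_shift y (measurable_funeneg mf))//.
by congr (_ - _)%E; apply: eq_integral => x _; rewrite ?funeposE ?funenegE.
Qed.

Lemma integrable_shift (y : X) (f : X -> \bar R) :
  (leb N).-integrable setT f -> (leb N).-integrable setT (fun x => f (x + y)).
Proof.
move=> /integrableP[mf foo]; apply/integrableP; split.
  exact: (measurableT_comp mf (measurable_shift y)).
rewrite (ge0_integral_shift y (f := fun x => `|f x|%E))//.
exact: measurableT_comp.
Qed.

Lemma ae_shift (y : X) (P : X -> Prop) :
  {ae leb N, forall x, P x} -> {ae leb N, forall x, P (x + y)}.
Proof.
move=> [A [mA A0 PA]]; exists ((fun x => x + y) @^-1` A); split.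
- by rewrite -[X in measurable X]setTI; exact: measurable_shift.
- by rewrite leb_shift.
- by move=> x /= Px; apply: PA.
Qed.

(** The norm ['N[leb N]_+oo] reduces to an essential supremum when the whole space has positive
    measure; this settles that case distinction. *)
Lemma leb_setT_gt0 : (0 < leb N [set: X])%E.
Proof.
have := @leb_box R N (fun=> setT) (fun=> measurableT).
rewrite (_ : mkset _ = setT); last by apply/seteqP; split.
move=> ->; elim/big_ind : _ => // [|i _]; first by move=> a b a0 b0; rewrite mule_gt0.
have e : (@lebesgue_measure R) `[0%R, 1%R]%classic = 1%E.
  by rewrite lebesgue_measure_itv/= lte_fin ltr01 oppr0 adde0.
apply: (@lt_le_trans _ _ 1%E) => //; rewrite -e.
by apply: le_measure; rewrite ?inE.
Qed.

Lemma ler_coord_norm (x : X) i : `|x 0 i| <= `|x|.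
Proof.
by rewrite [leRHS]/Num.norm/= mx_normrE; apply/bigmax_geP; right; exists (0, i).
Qed.

Lemma leb_bounded (m : R) (A : set X) : measurable A ->
  (forall x, A x -> `|x| <= m) -> (leb N A < +oo)%E.
Proof.
move=> mA Am.
have mI i : measurable ((fun _ : 'I_N => `[- m, m]%classic : set (measurableTypeR R)) i).
  exact: measurable_itv.
have := @leb_box R N (fun=> `[-m, m]%classic) mI.
set B := mkset _ => leB.
have mB : measurable B.
  rewrite (_ : B = \bigcap_(i in [set: 'I_N]) (fun v : X => v 0 i) @^-1` `[-m, m]%classic).
    apply: fin_bigcap_measurable => // i _; rewrite -[X in measurable X]setTI.
    exact: measurable_coord.
  by apply/seteqP; split => [v Av i _|v Av i]; [exact: Av|exact: (Av i)].
apply: (@le_lt_trans _ _ (leb N B)).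
  apply: le_measure; rewrite ?inE// => x /Am xm i.
  rewrite /= in_itv/= -ler_norml; apply: le_trans xm.
  by exact: ler_coord_norm.
rewrite leB ltey_eq prode_fin_num// => i _.
rewrite lebesgue_measure_itv/=; case: ifPn => // _.
Qed.

Lemma measurable_rV_norm : measurable_fun setT (fun x : X => `|x|).
Proof.
apply: (measurability _ (RGenOpens.measurableE R)).
move=> _ [_ [a [b ->]] <-]; rewrite setTI.
apply: rV_open_measurable; apply: open_comp; last exact: interval_open.
by move=> v _; exact: norm_continuous.
Qed.

Lemma measurable_norm_le (m : R) : measurable [set x : X | `|x| <= m].
Proof.
rewrite -[X in measurable X]setTI.
have := measurable_rV_norm measurableT (measurable_itv `]-oo, m]); congr (measurable _).
Qed.

Lemma leb_norm_le (m : R) : (leb N [set x : X | (`|x| <= m)%R] < +oo)%E.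
Proof. by apply: (@leb_bounded m) => //; exact: measurable_norm_le. Qed.

Lemma compact_norm_le (m : R) : compact [set x : X | `|x| <= m].
Proof.
apply: bounded_closed_compact.
  exists m; split; first exact: num_real.
  by move=> y my x /= xm; exact: (le_trans xm (ltW my)).
exact: (closed_comp (fun x _ => @norm_continuous _ _ x) (@closed_le _ m)).
Qed.

(** Integer radii, so that countably many balls suffice to test local convergence. *)
Lemma compact_sub_norm_le (K : set X) : compact K ->
  exists m : nat, K `<=` [set x : X | `|x| <= m%:R].
Proof.
move=> /compact_bounded[M [Mr MK]].
exists (Num.truncn `|M|).+2 => x Kx /=; apply: MK Kx.
by rewrite (le_lt_trans (ler_norm _))// (lt_le_trans (truncnS_gt _))// ler_nat.
Qed.

End translation.

(** * The L^1 norm *)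

(** With values in the extended reals, comparison and triangle inequalities ask for measurability
    only. *)
Definition l1norm {d} {T : measurableType d} {R : realType}
  (mu : {measure set T -> \bar R}) (w : T -> R) : \bar R :=
  (\int[mu]_x `|w x|%:E)%E.

Lemma ae_imply {d} {T : measurableType d} {R : realType}
  (mu : {measure set T -> \bar R}) (P Q : T -> Prop) :
  (forall x, P x -> Q x) -> {ae mu, forall x, P x} -> {ae mu, forall x, Q x}.
Proof. by move=> PQ; apply: filterS. Qed.

Lemma ae_imply2 {d} {T : measurableType d} {R : realType}
  (mu : {measure set T -> \bar R}) (P P' Q : T -> Prop) :
  (forall x, P x -> P' x -> Q x) ->
  {ae mu, forall x, P x} -> {ae mu, forall x, P' x} -> {ae mu, forall x, Q x}.
Proof. by move=> PQ; apply: filterS2. Qed.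

Section l1norm.
Context {d} {T : measurableType d} {R : realType}.
Variable mu : {measure set T -> \bar R}.
Implicit Types u v w : T -> R.

Lemma l1norm_ge0 w : (0 <= l1norm mu w)%E.
Proof. by apply: integral_ge0 => x _; rewrite lee_fin. Qed.

Lemma measurable_abs_EFin u : measurable_fun setT u ->
  measurable_fun setT (fun x => `|u x|%:E).
Proof. by move=> mu'; apply/measurable_EFinP; exact: measurableT_comp. Qed.

Lemma ae_le_l1norm u v : measurable_fun setT u -> measurable_fun setT v ->
  {ae mu, forall x, `|u x| <= `|v x|} -> (l1norm mu u <= l1norm mu v)%E.
Proof.
move=> mu' mv uv; apply: ae_ge0_le_integral => //; try exact: measurable_abs_EFin.
by apply: (ae_imply _ uv) => x + _; rewrite lee_fin.
Qed.

Lemma le_l1norm u v : measurable_fun setT u -> measurable_fun setT v ->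
  (forall x, `|u x| <= `|v x|) -> (l1norm mu u <= l1norm mu v)%E.
Proof. by move=> mu' mv uv; apply: ae_le_l1norm => //; exact: aeW. Qed.

Lemma ae_eq_l1norm u v : measurable_fun setT u -> measurable_fun setT v ->
  {ae mu, forall x, u x = v x} -> (l1norm mu u = l1norm mu v)%E.
Proof.
by move=> mu' mv uv; apply/eqP; rewrite eq_le !ae_le_l1norm//;
  apply: (ae_imply _ uv) => x ->.
Qed.

Lemma l1norm_triangle u v : measurable_fun setT u -> measurable_fun setT v ->
  (l1norm mu (u \+ v)%R <= l1norm mu u + l1norm mu v)%E.
Proof.
move=> mu' mv; rewrite /l1norm -ge0_integralD//; try exact: measurable_abs_EFin.
- apply: ge0_le_integral => //.
  + by apply: measurable_abs_EFin; exact: measurable_funD.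
  + by apply: emeasurable_funD; exact: measurable_abs_EFin.
  + by move=> x _; rewrite -EFinD lee_fin ler_normD.
Qed.

Lemma l1norm_triangle3 u v w : measurable_fun setT u -> measurable_fun setT v ->
  measurable_fun setT w ->
  (l1norm mu (fun x => u x - w x)%R <= l1norm mu (fun x => u x - v x)%R +
     l1norm mu (fun x => v x - w x)%R)%E.
Proof.
move=> mu' mv mw; rewrite (_ : (fun x => u x - w x) =
  (fun x => u x - v x) \+ (fun x => v x - w x)); last first.
  by apply/funext => x /=; ring.
by apply: l1norm_triangle; exact: measurable_funB.
Qed.

Lemma l1normB_sym u v : l1norm mu (fun x => u x - v x)%R = l1norm mu (fun x => v x - u x)%R.
Proof. by apply: eq_integral => x _; rewrite distrC. Qed.

Lemma l1normZ a u : measurable_fun setT u ->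
  l1norm mu (fun x => a * u x)%R = (`|a|%:E * l1norm mu u)%E.
Proof.
move=> mu'; rewrite /l1norm -ge0_integralZl_EFin//.
- by apply: eq_integral => x _; rewrite normrM EFinM.
- exact: measurable_abs_EFin.
Qed.

Lemma integrable_l1norm u :
  mu.-integrable setT (EFin \o u) <-> measurable_fun setT u /\ (l1norm mu u < +oo)%E.
Proof.
split=> [/integrableP[/measurable_EFinP mu' uoo]|[mu' uoo]]; first by split.
by apply/integrableP; split => //; exact/measurable_EFinP.
Qed.

Lemma l1norm_indic A : measurable A -> l1norm mu \1_A = mu A.
Proof.
move=> mA; transitivity (\int[mu]_x (\1_A x)%:E)%E.
  by apply: eq_integral => x _; rewrite ger0_norm.
by rewrite integral_indic// setIT.
Qed.

Lemma integrable_indic_fin A : measurable A -> (mu A < +oo)%E ->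
  mu.-integrable setT (EFin \o (\1_A : T -> R)).
Proof. by move=> mA A0; apply/integrable_l1norm; rewrite l1norm_indic. Qed.

Definition Rintegrable u := mu.-integrable setT (EFin \o u).

Lemma Rintegrable_measurable u : Rintegrable u -> measurable_fun setT u.
Proof. by move=> /integrable_l1norm[]. Qed.

Lemma RintegrableD u v : Rintegrable u -> Rintegrable v -> Rintegrable (fun x => u x + v x).
Proof. by move=> iu iv; exact: (integrableD measurableT iu iv). Qed.

Lemma RintegrableB u v : Rintegrable u -> Rintegrable v -> Rintegrable (fun x => u x - v x).
Proof. by move=> iu iv; exact: (integrableB measurableT iu iv). Qed.

Lemma RintegrableZ a u : Rintegrable u -> Rintegrable (fun x => a * u x).
Proof. by move=> iu; exact: (integrableZl measurableT a iu). Qed.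

Lemma ae_le_Rintegrable u v : measurable_fun setT u -> Rintegrable v ->
  {ae mu, forall x, `|u x| <= `|v x|} -> Rintegrable u.
Proof.
move=> mu' /integrable_l1norm[mv voo] uv; apply/integrable_l1norm; split => //.
by apply: le_lt_trans voo; exact: ae_le_l1norm.
Qed.

Lemma le_Rintegrable u v : measurable_fun setT u -> Rintegrable v ->
  (forall x, `|u x| <= `|v x|) -> Rintegrable u.
Proof. by move=> mu' iv uv; apply: ae_le_Rintegrable iv _ => //; exact: aeW. Qed.

Lemma Rintegrable_norm u : Rintegrable u -> Rintegrable (fun x => `|u x|).
Proof. exact: integrable_norm. Qed.

Lemma Rintegral_l1norm u : Rintegrable u ->
  ((\int[mu]_x `|u x|)%R%:E = l1norm mu u)%E.
Proof.
by move=> iu; rewrite /Rintegral fineK//; exact: (integrable_fin_num _ (Rintegrable_norm iu)).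
Qed.

Lemma l1norm_ge_Rintegral u : mu.-integrable setT (EFin \o u) ->
  ((\int[mu]_x u x)%R%:E <= l1norm mu u)%E.
Proof.
move=> iu; rewrite /Rintegral fineK; last exact: integrable_fin_num.
apply: le_integral => //.
  exact: (integrable_norm iu).
by move=> x _; rewrite lee_fin ler_norm.
Qed.

Lemma dct_l1norm (f_ : nat -> T -> R) (f g : T -> R) : (forall n, measurable_fun setT (f_ n)) ->
  measurable_fun setT f ->
  {ae mu, forall x, f_ ^~ x @ \oo --> f x} ->
  mu.-integrable setT (EFin \o g) ->
  {ae mu, forall x n, `|f_ n x| <= g x} ->
  (fun n => l1norm mu (fun x => f_ n x - f x)%R) @ \oo --> 0%E.
Proof.
move=> mf_ mf f_f ig f_g.
have [] := @dominated_convergence _ _ _ mu setT measurableT (fun n => EFin \o f_ n)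
   (EFin \o f) (EFin \o g) _ _ _ ig _.
- by move=> n; exact/measurable_EFinP.
- exact/measurable_EFinP.
- by apply: (ae_imply _ f_f) => x h _; apply/fine_cvgP; split => //; exact: nearW.
- by apply: (ae_imply _ f_g) => x h n _; rewrite /= lee_fin.
move=> _ + _; apply: cvg_trans; apply: near_eq_cvg; apply: nearW => n /=.
by apply: eq_integral.
Qed.

Lemma dct_l1norm_near (f_ : nat -> T -> R) (f g : T -> R) : (forall n, measurable_fun setT (f_ n)) ->
  measurable_fun setT f ->
  {ae mu, forall x, f_ ^~ x @ \oo --> f x} ->
  mu.-integrable setT (EFin \o g) ->
  {ae mu, forall x n, `|f_ n x| <= g x} -> forall e, 0 < e ->
  \forall n \near \oo, (l1norm mu (fun x => f_ n x - f x)%R <= e%:E)%E.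
Proof.
move=> mf_ mf f_f ig f_g e e0.
have /fine_cvgP[nfin] := dct_l1norm mf_ mf f_f ig f_g.
move=> /cvgr_dist_le/(_ e e0) ne; near=> n.
have fn : l1norm mu (fun x => f_ n x - f x)%R \is a fin_num by near: n.
rewrite -(fineK fn) lee_fin.
have : `|0 - (fine \o (fun n => l1norm mu (fun x => f_ n x - f x)%R)) n| <= e by near: n.
by rewrite sub0r normrN /= ger0_norm// fine_ge0// l1norm_ge0.
Unshelve. all: by end_near. Qed.

End l1norm.

Lemma l1norm_shift {R : realType} {N} (y : 'rV[R]_N) w : measurable_fun setT w ->
  l1norm (leb N) (fun x => w (x + y))%R = l1norm (leb N) w.
Proof.
move=> mw; rewrite /l1norm.
by rewrite (ge0_integral_shift y (f := fun x => (`|w x|%:E)))//; exact: measurable_abs_EFin.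
Qed.

(** * Continuity of translations in L^1 *)

Section translation_continuity.
Context {R : realType} {N : nat}.
Notation X := 'rV[R]_N.
Notation mu := (@leb R N).
Notation "'L1' w" := (l1norm mu w) (at level 10, w at level 8).

Definition l1_translation_continuous (w : X -> R) : Prop :=
  forall e, 0 < e -> exists2 d, 0 < d & forall y : X, `|y| < d ->
    (l1norm mu (fun x => w (x + y) - w x)%R <= e%:E)%E.
Notation TC := l1_translation_continuous.

Lemma measurable_fun_shift (w : X -> R) (y : X) : measurable_fun setT w ->
  measurable_fun setT (fun x : X => w (x + y)).
Proof. by move=> mw; exact: (measurableT_comp mw (measurable_shift y)). Qed.

(** The property is closed under L^1 limits: the error [w - v] and its translate have the same norm,
    hence the three thirds of [e]. *)
Lemma l1_translation_continuous_approx (w : X -> R) : measurable_fun setT w ->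
  (forall e, 0 < e -> exists v, [/\ measurable_fun setT v, TC v &
     (l1norm mu (fun x => w x - v x)%R <= e%:E)%E]) -> TC w.
Proof.
move=> mw h e e0; have e3 : 0 < e / 3 by lra.
have [v [mv tv wv]] := h _ e3.
have [r r0 rv] := tv _ e3; exists r => // y yr.
have my := measurable_fun_shift y mw; have mvy := measurable_fun_shift y mv.
apply: le_trans (l1norm_triangle3 _ my mvy mw) _.
rewrite (_ : e = e / 3 + (e / 3 + e / 3)); last by lra.
rewrite !EFinD; apply: leeD.
  by have := l1norm_shift y (measurable_funB mw mv); rewrite /= => ->.
apply: le_trans (l1norm_triangle3 _ mvy mv mw) _; apply: leeD; first exact: rv.
by rewrite l1normB_sym.
Qed.

Lemma l1_translation_continuousD (w v : X -> R) : measurable_fun setT w ->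
  measurable_fun setT v -> TC w -> TC v -> TC (w \+ v).
Proof.
move=> mw mv tw tv e e0; have e2 : 0 < e / 2 by lra.
have [r r0 rw] := tw _ e2; have [s s0 sv] := tv _ e2.
exists (Num.min r s); first by rewrite lt_min r0.
move=> y; rewrite lt_min => /andP[yr ys].
rewrite (_ : (fun _ => _) = (fun x => w (x + y) - w x) \+ (fun x => v (x + y) - v x)); last first.
  by apply/funext => x /=; ring.
apply: le_trans (l1norm_triangle _ _ _) _.
- by apply: measurable_funB => //; exact: measurable_fun_shift.
- by apply: measurable_funB => //; exact: measurable_fun_shift.
by rewrite [e]splitr EFinD; apply: leeD; [exact: rw|exact: sv].
Qed.

Lemma l1_translation_continuousZ (w : X -> R) a : measurable_fun setT w ->
  TC w -> TC (fun x => a * w x).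
Proof.
move=> mw tw e e0; have a0 : 0 < `|a| + 1 by rewrite ltr_wpDl.
have [|r r0 rw] := tw (e / (`|a| + 1)); first by rewrite divr_gt0.
exists r => // y yr.
rewrite (_ : (fun _ => _) = (fun x => a * (w (x + y) - w x))); last first.
  by apply/funext => x /=; ring.
rewrite (l1normZ mu a (u := fun x => w (x + y) - w x)); last first.
  by apply: measurable_funB => //; exact: measurable_fun_shift.
apply: (@le_trans _ _ ((`|a| + 1)%:E * (e / (`|a| + 1))%:E)%E).
  by apply: lee_pmul; rewrite ?lee_fin ?l1norm_ge0 ?rw// lerDl.
by rewrite -EFinM lee_fin mulrC divfK// gt_eqF.
Qed.

(* Indicators of open sets are lower semicontinuous, so by dominated convergence
   the negative part of the increment tends to zero in mean; the integral of the
   increment itself vanishes. *)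
Lemma l1_translation_continuous_open (G : set X) : open G -> (mu G < +oo)%E ->
  TC (\1_G).
Proof.
move=> oG Goo e e0; apply: contrapT => h.
have mG : measurable G by exact: rV_open_measurable.
have iG : mu.-integrable setT (EFin \o \1_G) by exact: integrable_indic_fin.
have mi : measurable_fun setT (\1_G : X -> R) by [].
(* If the property fails for [e], it fails along shifts tending to 0, and dominated convergence
   applies to this sequence. *)
have /choice[y yP] : forall n : nat, exists y : X, `|y| < n.+1%:R^-1 /\
   (e%:E < l1norm mu (fun x => \1_G (x + y)%R - \1_G x)%R)%E.
  move=> n; apply: contrapT => hn; apply: h; exists n.+1%:R^-1 => // z zn.
  by rewrite leNgt; apply/negP => ez; apply: hn; exists z.
pose f n (x : X) : R := Num.max 0 (\1_G x - \1_G (x + y n)).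
have mf n : measurable_fun setT (f n).
  apply: measurable_maxr => //; apply: measurable_funB => //.
  exact: (measurable_fun_shift (y n) mi).
have e4 : 0 < e / 4 by lra.
have fG x n : f n x = if (x \in G) && (x + y n \notin G) then 1 else 0.
  rewrite /f !indicE; case: (x \in G); case: (x + y n \in G) => /=.
  - by rewrite subrr maxxx.
  - by rewrite subr0 max_r.
  - by rewrite sub0r max_l// oppr_le0.
  - by rewrite subr0 maxxx.
have f_0 : {ae mu, forall x, f ^~ x @ \oo --> cst 0 x}.
  apply: aeW => x; have [Gx|nGx] := pselect (G x).
    have Gn : \forall n \near \oo, G (x + y n).
      have /nbhs_ballP[r /= r0 rG] : nbhs x G by exact: open_nbhs_nbhs.
      have : \forall n \near \oo, n.+1%:R^-1 < r by exact: (near_infty_natSinv_lt (PosNum r0)).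
      apply: filterS => n nr; apply: rG; rewrite -ball_normE /= opprD addrA subrr sub0r normrN.
      by case: (yP n) => /lt_trans/(_ nr).
    apply: cvg_near_cst; apply: filterS Gn => n Gn.
    by rewrite fG (mem_set Gn) andbF.
  apply: cvg_near_cst; apply: nearW => n.
  by rewrite fG (memNset nGx).
have f_b : {ae mu, forall x n, `|f n x| <= \1_G x}.
  apply: aeW => x n; rewrite fG indicE; case: (x \in G) => /=; last by rewrite normr0.
  by case: ifP; rewrite ?normr1 ?normr0.
have [n _ /(_ _ (leqnn n))] := dct_l1norm_near mf (measurable_cst (0:R)) f_0 iG f_b e4.
rewrite /= => hn; have [_] := yP n; rewrite ltNge => /negP; apply.
have iGy : mu.-integrable setT (EFin \o (fun x => \1_G (x + y n))).
  exact: (integrable_shift (y n) iG).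
have ifn : mu.-integrable setT (EFin \o (f n)).
  apply/integrable_l1norm; split => //; apply: le_lt_trans (ltry (e/4)).
  by apply: le_trans hn; apply: le_l1norm => // [|x]; [exact: measurable_funB|rewrite subr0].
have i2f : mu.-integrable setT (EFin \o (fun x => 2 * f n x)) by exact: RintegrableZ.
have iB : mu.-integrable setT (EFin \o (fun x => \1_G (x + y n) - \1_G x)) by exact: RintegrableB.
(* For real r, |r| = 2 max(0, -r) + r. The last term integrates to 0 by translation invariance,
   which leaves twice the integral of [f n]. *)
rewrite /l1norm (_ : (fun _ => _) = (fun x => (2 * f n x)%:E + (\1_G (x + y n) - \1_G x)%:E)%E); last first.
  apply/funext => x; rewrite -EFinD; congr (_%:E).
  rewrite fG !indicE; case: (x \in G); case: (x + y n \in G) => /=;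
    rewrite ?subrr ?subr0 ?sub0r ?normrN ?normr1 ?normr0; lra.
rewrite integralD//=.
have -> : (\int[mu]_x (\1_G (x + y n)%R - \1_G x)%:E = 0)%E.
  rewrite integralB_EFin//= (integral_shift (y n) (f := EFin \o \1_G)).
    by rewrite subee//; exact: (integrable_fin_num _ iG).
  exact/measurable_EFinP.
rewrite adde0; under eq_integral do rewrite EFinM.
rewrite ge0_integralZl_EFin//; last 2 first.
- by move=> x _; rewrite lee_fin /f le_max lexx.
- exact/measurable_EFinP.
apply: (@le_trans _ _ (2%:E * (e/4)%:E)%E); last by rewrite -EFinM lee_fin; lra.
apply: lee_wpmul2l; first by rewrite lee_fin.
apply: le_trans hn; apply: ge0_le_integral => //.
- by move=> x _; rewrite lee_fin /f le_max lexx.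
- exact/measurable_EFinP.
- by apply: measurable_abs_EFin; exact: measurable_funB.
- by move=> x _; rewrite subr0 lee_fin ler_norm.
Qed.


(** A monotone class argument starting from open sets. The intersection with a ball keeps measures
    finite, as both the open case and dominated convergence require. *)
Lemma l1_translation_continuous_setI_ball (A : set X) (m : nat) : measurable A ->
  TC (\1_(A `&` [set x | `|x| < m%:R])).
Proof.
pose B k := [set x : X | `|x| < k%:R :> R].
have oB k : open (B k).
  exact: (open_comp (fun x _ => @norm_continuous _ _ x) (@open_lt _ k%:R)).
have Boo k : (mu (B k) < +oo)%E.
  apply: (@leb_bounded _ _ k%:R); first exact: rV_open_measurable.
  by move=> x /ltW.
have mB k : measurable (B k) by exact: rV_open_measurable.
pose H := [set A : set X | measurable A /\ forall k, TC (\1_(A `&` B k))].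
suff HA : @measurable _ X `<=` H by move=> /HA[_]; exact.
apply: (@lambda_system_subset _ (@open X) _ setT).
- by move=> U V; exact: openI.
- split => //.
  + split; first exact: measurableT.
    by move=> k; rewrite setTI; exact: l1_translation_continuous_open.
  + move=> U V VU [mU tU] [mV tV]; split; first exact: measurableD.
    move=> k; rewrite (_ : \1_((U `\` V) `&` B k) =
        \1_(U `&` B k) \+ (fun x => -1 * \1_(V `&` B k) x) :> (X -> R)); last first.
      apply/funext => x /=; rewrite !indicE !classical_sets.in_setI ?classical_sets.in_setD ?classical_sets.in_setC.
      have : (x \in V) ==> (x \in U).
        by apply/implyP; rewrite !inE; exact: VU.
      by case: (x \in U); case: (x \in V); case: (x \in B k) => //= _; ring.
    apply: l1_translation_continuousD => //.
    * exact: measurable_indic (measurableI _ _ mU (mB k)).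
    * by apply: measurable_funM => //; exact: measurable_indic (measurableI _ _ mV (mB k)).
    * apply: l1_translation_continuousZ => //.
      exact: measurable_indic (measurableI _ _ mV (mB k)).
  + move=> F ndF HF; have mF n : measurable (F n) by case: (HF n).
    split; first exact: bigcupT_measurable.
    move=> k; apply: l1_translation_continuous_approx.
      by apply: measurable_indic; apply: measurableI => //; exact: bigcupT_measurable.
    move=> e e0.
    have mi n : measurable_fun setT (\1_(F n `&` B k) : X -> R).
      by apply: measurable_indic; exact: measurableI.
    have [||||n _ /(_ _ (leqnn n)) hn] := dct_l1norm_near (mu := mu) (f := \1_(\bigcup_i F i `&` B k)) (g := \1_(B k)) mi _ _ _ _ e0.
    * by apply: measurable_indic; apply: measurableI => //; exact: bigcupT_measurable.
    * apply: aeW => x; have [[n _ Fnx]|nF] := pselect ((\bigcup_i F i) x).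
        apply: cvg_near_cst; exists n => // p /= np.
        rewrite !indicE !classical_sets.in_setI (@mem_set _ (F p) x).
          by rewrite (@mem_set _ (\bigcup_i F i) x)//; exists n.
        by move: Fnx; exact/subsetPset/ndF.
      apply: cvg_near_cst; apply: nearW => p.
      rewrite !indicE !classical_sets.in_setI (memNset nF) (@memNset _ (F p) x)// => Fp.
      by apply: nF; exists p.
    * exact: (integrable_indic_fin (mB k) (Boo k)).
    * apply: aeW => x n; rewrite ger0_norm// !indicE classical_sets.in_setI.
      by case: (x \in F n); case: (x \in B k) => //=; rewrite ler01.
    exists (\1_(F n `&` B k)); split => //.
      by case: (HF n).
    by rewrite l1normB_sym.
- move=> U oU; split; first exact: rV_open_measurable.
  move=> k; apply: l1_translation_continuous_open; first exact: openI.
  apply: le_lt_trans (Boo k); apply: le_measure; rewrite ?inE//.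
  by apply: measurableI => //; exact: rV_open_measurable.
- by [].
Qed.

Lemma l1_translation_continuous_sum (I : eqType) (s : seq I) (a : I -> R) (w : I -> X -> R) :
  (forall i, measurable_fun setT (w i)) -> (forall i, TC (w i)) ->
  TC (fun x => \sum_(i <- s) a i * w i x).
Proof.
move=> mw tw; elim: s => [|i s IH].
  under eq_fun do rewrite big_nil.
  move=> e e0; exists 1 => // y _; rewrite /l1norm.
  by under eq_integral do rewrite subrr normr0; rewrite integral0 lee_fin ltW.
under eq_fun do rewrite big_cons.
apply: (@l1_translation_continuousD (fun x => a i * w i x)) => //.
- exact: measurable_funM.
- by apply: measurable_sum => k; exact: measurable_funM.
- exact: l1_translation_continuousZ.
Qed.

Import HBSimple.

(** Density in two stages: [w] is cut off to a ball, then approximated by simple functions,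
    themselves cut off so that only bounded level sets occur. *)
Theorem integrable_l1_translation_continuous (w : X -> R) :
  mu.-integrable setT (EFin \o w) -> TC w.
Proof.
move=> iw; have [mw _] := (integrable_l1norm mu w).1 iw.
apply: l1_translation_continuous_approx => // e e0; have e2 : 0 < e / 2 by lra.
pose B k := [set x : X | `|x| < k%:R :> R].
have mB k : measurable (B k).
  by apply: rV_open_measurable; exact: (open_comp (fun x _ => @norm_continuous _ _ x) (@open_lt _ k%:R)).
have mwB (v : X -> R) k : measurable_fun setT v -> measurable_fun setT (fun x => v x * \1_(B k) x).
  by move=> mv; apply: measurable_funM => //; exact: measurable_indic.
have [||||m _ /(_ _ (leqnn m)) hm] := dct_l1norm_near (mu := mu) (f := w)
    (g := fun x => `|w x|) (fun k => mwB _ k mw) _ _ _ _ e2 => //.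
- apply: aeW => x; apply: cvg_near_cst; exists (Num.truncn `|x|).+1 => // k /= xk.
  rewrite indicE mem_set ?mulr1//= /B /=.
  by rewrite (lt_le_trans (truncnS_gt _))// ler_nat.
- exact: (integrable_norm iw).
- apply: aeW => x n; by rewrite normrM ler_piMr// ger0_norm// indicE; case: (_ \in _); rewrite ?lexx ?ler01.
have [g [ig _ gw]] := approximation_sfun_integrable measurableT iw.
move/fine_cvgP : gw => [gfin /cvgr_dist_le/(_ _ e2)] gw.
have [n [ngfin ngw]] := filter_ex (filterI gfin gw).
pose v x := g n x * \1_(B m) x.
have mg : measurable_fun setT (g n) by [].
exists v; split; first exact: mwB.
  pose s : seq R := finmap.enum_fset (fset_set (range (g n))).
  rewrite (_ : v = (fun x => \sum_(r <- s) r * \1_((g n @^-1` [set r]) `&` B m) x)).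
    apply: l1_translation_continuous_sum => r.
      by apply: measurable_indic; exact: measurableI.
    exact: l1_translation_continuous_setI_ball.
  apply/funext => x; rewrite /v fimfunE fsbig_finite// mulr_suml.
  by apply: eq_bigr => r _; rewrite -mulrA; congr (_ * _); rewrite indicI.
apply: le_trans (l1norm_triangle3 _ mw (mwB _ m mw) (mwB _ m mg)) _.
rewrite [e]splitr EFinD; apply: leeD; first by rewrite l1normB_sym.
apply: (@le_trans _ _ (l1norm mu (fun x => w x - g n x)%R)).
  apply: le_l1norm; [by apply: measurable_funB; exact: mwB|exact: measurable_funB|].
  move=> x; by rewrite -mulrBl normrM ler_piMr// ger0_norm// indicE; case: (_ \in _); rewrite ?lexx ?ler01.
move: ngfin ngw; rewrite /l1norm => ngfin.
rewrite sub0r normrN /= => ngw.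
by have := le_trans (ler_norm _) ngw; rewrite -lee_fin fineK.
Qed.

End translation_continuity.

(** * Jump measures *)

Section Rfubini.
Context {d1 d2} {T1 : measurableType d1} {T2 : measurableType d2} {R : realType}.
Variables (m1 : {sigma_finite_measure set T1 -> \bar R})
  (m2 : {sigma_finite_measure set T2 -> \bar R}).
Implicit Types f : T1 * T2 -> R.

Lemma le_Rintegrable_prod f a b : measurable_fun setT f ->
  Rintegrable m1 a -> Rintegrable m2 b ->
  (forall x y, `|f (x, y)| <= `|a x| * `|b y|) -> Rintegrable (m1 \x m2)%E f.
Proof.
move=> mf ia ib fab.
have ma := Rintegrable_measurable ia; have mb := Rintegrable_measurable ib.
apply/integrable12ltyP; first exact/measurable_EFinP.
apply: (@le_lt_trans _ _ (\int[m1]_x (`|a x|%:E * l1norm m2 b))%E).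
  apply: ge0_le_integral => //.
  - by move=> x _; exact: integral_ge0.
  - apply: (measurable_fun_fubini_tonelli_F (fun p => `|f p|%:E)) => //.
    exact: measurable_abs_EFin.
  - by apply: emeasurable_funM => //; exact: measurable_abs_EFin.
  - move=> x _; rewrite /l1norm -ge0_integralZl_EFin//; last exact: measurable_abs_EFin.
    apply: ge0_le_integral => //=.
    + by apply: measurable_abs_EFin; exact: (measurableT_comp mf (pair1_measurable x)).
    + by apply: measurable_funeM; exact: measurable_abs_EFin.
    + by move=> y _; rewrite -EFinM lee_fin.
have [_ aoo] := (integrable_l1norm m1 a).1 ia.
have [_ boo] := (integrable_l1norm m2 b).1 ib.
rewrite ge0_integralZr//; last 2 first.
- exact: measurable_abs_EFin.
- exact: l1norm_ge0.
by apply: lte_mul_pinfty => //; [exact: l1norm_ge0|rewrite ge0_fin_numE ?l1norm_ge0].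
Qed.

Section fubini_f.
Variable f : T1 * T2 -> R.
Hypothesis intf : Rintegrable (m1 \x m2)%E f.

(** [Rintegral] sends an infinite integral to 0, so the real inner integral is known to match the
    extended one where the section is integrable, that is for almost every [x]. *)
Let ae1 : {ae m1, forall x, (\int[m2]_y f (x, y))%:E = (\int[m2]_y (f (x, y))%:E)%E}.
Proof.
apply: ae_imply (ae_integrable1 intf) => x ix.
by rewrite /Rintegral fineK//; exact: (integrable_fin_num _ ix).
Qed.

Let ae2 : {ae m2, forall y, (\int[m1]_x f (x, y))%:E = (\int[m1]_x (f (x, y))%:E)%E}.
Proof.
apply: ae_imply (ae_integrable2 intf) => x ix.
by rewrite /Rintegral fineK//; exact: (integrable_fin_num _ ix).
Qed.

Lemma measurable_Rintegral1 : measurable_fun setT (fun x => \int[m2]_y f (x, y)).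
Proof.
apply: (measurableT_comp (fine_measurable measurableT)) => //.
exact: (measurable_fubini_F intf).
Qed.

Lemma measurable_Rintegral2 : measurable_fun setT (fun y => \int[m1]_x f (x, y)).
Proof.
apply: (measurableT_comp (fine_measurable measurableT)) => //.
exact: (measurable_fubini_G intf).
Qed.

Lemma Rintegral12 : \int[m1]_x \int[m2]_y f (x, y) = \int[(m1 \x m2)%E]_p f p.
Proof.
rewrite {1}/Rintegral /Rintegral; congr fine.
rewrite -(integral12_prod_meas1 intf); apply: ae_eq_integral => //.
- by apply/measurable_EFinP; exact: measurable_Rintegral1.
- exact: (measurable_fubini_F intf).
- by apply: ae_imply ae1 => x + _.
Qed.

Lemma Rintegral21 : \int[m2]_y \int[m1]_x f (x, y) = \int[(m1 \x m2)%E]_p f p.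
Proof.
rewrite {1}/Rintegral /Rintegral; congr fine.
rewrite -(integral21_prod_meas1 intf); apply: ae_eq_integral => //.
- by apply/measurable_EFinP; exact: measurable_Rintegral2.
- exact: (measurable_fubini_G intf).
- by apply: ae_imply ae2 => x + _.
Qed.

Lemma Rfubini : \int[m1]_x \int[m2]_y f (x, y) = \int[m2]_y \int[m1]_x f (x, y).
Proof. by rewrite Rintegral12 Rintegral21. Qed.

Lemma Rintegrable1 : Rintegrable m1 (fun x => \int[m2]_y f (x, y)).
Proof.
have iF := integrable_fubini_F intf.
have : (l1norm m1 (fun x => \int[m2]_y f (x, y))%R < +oo)%E.
  have /integrableP[mF] := iF; apply: le_lt_trans.
  apply: ae_ge0_le_integral => //.
  - by apply: measurable_abs_EFin; exact: measurable_Rintegral1.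
  - exact: measurableT_comp.
  - by apply: ae_imply ae1 => x e _; rewrite /fubini_F /= -e.
by move=> ?; apply/integrable_l1norm; split => //; exact: measurable_Rintegral1.
Qed.

Lemma Rintegrable2 : Rintegrable m2 (fun y => \int[m1]_x f (x, y)).
Proof.
have mf := Rintegrable_measurable intf.
have mfE : measurable_fun setT (EFin \o f) by exact/measurable_EFinP.
apply/integrable_l1norm; split; first exact: measurable_Rintegral2.
apply: le_lt_trans ((integrable21ltyP m1 m2 mfE).1 intf).
apply: ae_ge0_le_integral => //.
- by apply: measurable_abs_EFin; exact: measurable_Rintegral2.
- by move=> y _; exact: integral_ge0.
- apply: (measurable_fun_fubini_tonelli_G (fun p => `|f p|%:E)) => //.
  exact: measurable_abs_EFin.
apply: ae_imply (ae_integrable2 intf) => y iy _.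
rewrite -[leRHS]/(l1norm m1 (fun x => f (x, y))%R) -(Rintegral_l1norm iy) lee_fin.
exact: le_normr_Rintegral measurableT iy.
Qed.

End fubini_f.
End Rfubini.

Lemma RintegralN {d} {T : measurableType d} {R : realType}
  (mu : {measure set T -> \bar R}) (u : T -> R) : Rintegrable mu u ->
  \int[mu]_x (- u x) = - \int[mu]_x u x.
Proof.
move=> iu; under eq_Rintegral do rewrite -mulN1r.
by rewrite RintegralZl// mulN1r.
Qed.

Lemma ae_le_Rintegral {d} {T : measurableType d} {R : realType}
  (mu : {measure set T -> \bar R}) (u v : T -> R) : Rintegrable mu u -> Rintegrable mu v ->
  {ae mu, forall x, u x <= v x} -> \int[mu]_x u x <= \int[mu]_x v x.
Proof.
move=> iu iv uv; rewrite -subr_ge0 -RintegralB//.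
rewrite (_ : Rintegral _ _ _ = \int[mu]_x `|v x - u x|); first exact: Rintegral_ge0.
have iB : Rintegrable mu (fun x => v x - u x) by exact: RintegrableB.
have mB := Rintegrable_measurable iB.
congr fine; apply: ae_eq_integral => //; first exact/measurable_EFinP.
  exact: measurable_abs_EFin.
by apply: ae_imply uv => x uvx _ /=; rewrite ger0_norm// subr_ge0.
Qed.

Lemma ae_eq_Rintegral {d} {T : measurableType d} {R : realType}
  (mu : {measure set T -> \bar R}) (u v : T -> R) :
  measurable_fun setT u -> measurable_fun setT v ->
  {ae mu, forall x, u x = v x} -> \int[mu]_x u x = \int[mu]_x v x.
Proof.
move=> mu' mv uv; congr fine; apply: ae_eq_integral => //; try exact/measurable_EFinP.
by apply: ae_imply uv => x + _ => ->.
Qed.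

Section jump.
Context {R : realType} {N : nat}.
Notation X := 'rV[R]_N.
Variable nu : {finite_measure set X -> \bar R}.
Hypothesis nuN : forall A : set X, measurable A -> nu (-%R @^-1` A) = nu A.
Notation mu := (@leb R N).
Implicit Types (W u : X -> R) (x z : X).

Definition mass : R := fine (nu setT).
(** Not normalised: constants are multiplied by [mass]. The same operator describes the gain part of
    a jump operator and the average over a ball. *)
Definition jump_avg W x : R := \int[nu]_z W (x + z).

Notation P := (mu \x nu)%E.

Lemma mass_ge0 : 0 <= mass. Proof. by rewrite fine_ge0. Qed.

Lemma Rintegrable_cst_finite c : Rintegrable nu (cst c).
Proof. exact: finite_measure_integrable_cst. Qed.

Lemma Rintegrable_bounded W C : measurable_fun setT W -> (forall x, `|W x| <= C) ->
  Rintegrable nu W.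
Proof.
move=> mW WC; apply: (le_Rintegrable mW (Rintegrable_cst_finite C)) => x /=.
by apply: (le_trans (WC x)); exact: ler_norm.
Qed.

Lemma measurable_shiftl W (x : X) : measurable_fun setT W ->
  measurable_fun setT (fun z : X => W (x + z)).
Proof.
move=> mW; under eq_fun do rewrite addrC; exact: measurable_fun_shift.
Qed.

Lemma measurable_shift2 W : measurable_fun setT W ->
  measurable_fun setT (fun p : X * X => W (p.1 + p.2)).
Proof. by move=> mW; exact: (measurableT_comp mW (@measurable_addV R N)). Qed.

Lemma Rintegrable_shiftl W C x : measurable_fun setT W -> (forall x, `|W x| <= C) ->
  Rintegrable nu (fun z => W (x + z)).
Proof.
by move=> mW WC; apply: (@Rintegrable_bounded _ C) => //; exact: measurable_shiftl.
Qed.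

Lemma Rintegral_cst_finite c : \int[nu]_z c = mass * c.
Proof. by rewrite Rintegral_cst// mulrC. Qed.

Lemma discrete_opE W C x : measurable_fun setT W -> (forall x, `|W x| <= C) ->
  discrete_op nu W x = jump_avg W x - mass * W x.
Proof.
move=> mW WC; rewrite /discrete_op RintegralB//.
- by rewrite Rintegral_cst_finite.
- exact: Rintegrable_shiftl WC.
- exact: Rintegrable_cst_finite.
Qed.

Lemma le_jump_avg W W' C x : measurable_fun setT W -> measurable_fun setT W' ->
  (forall x, `|W x| <= C) -> (forall x, `|W' x| <= C) ->
  (forall x, W x <= W' x) -> jump_avg W x <= jump_avg W' x.
Proof.
move=> mW mW' WC WC' WW; apply: le_Rintegral => //; exact: Rintegrable_shiftl.
Qed.

Lemma norm_jump_avg W C x : measurable_fun setT W -> (forall x, `|W x| <= C) ->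
  `|jump_avg W x| <= mass * C.
Proof.
move=> mW WC; apply: le_trans (le_normr_Rintegral _ _) _ => //.
  exact: Rintegrable_shiftl WC.
rewrite -Rintegral_cst_finite; apply: le_Rintegral => //.
  by apply: Rintegrable_norm; exact: Rintegrable_shiftl WC.
exact: Rintegrable_cst_finite.
Qed.

Lemma measurable_jump_avg W C : measurable_fun setT W -> (forall x, `|W x| <= C) ->
  measurable_fun setT (jump_avg W).
Proof.
move=> mW WC.
(* Adding [C] makes the integrand nonnegative, so that Tonelli's theorem gives measurability. *)
rewrite (_ : jump_avg W = (fun x => fine (\int[nu]_z (W (x + z)%R + C)%:E)%E - mass * C)).
  apply: measurable_funB => //; apply: (measurableT_comp (fine_measurable measurableT)) => //.
  apply: (measurable_fun_fubini_tonelli_F (fun p : X * X => (W (p.1 + p.2) + C)%:E)).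
    by apply/measurable_EFinP; apply: measurable_funD => //; exact: measurable_shift2.
  by move=> [x z]; rewrite lee_fin -lerBlDr sub0r; have := WC (x + z)%R; rewrite ler_norml => /andP[].
apply/funext => x; rewrite -[X in X - _]/(\int[nu]_z (W (x + z) + C)) RintegralD//.
- by rewrite Rintegral_cst_finite addrK.
- exact: Rintegrable_shiftl WC.
- exact: Rintegrable_cst_finite.
Qed.

Lemma measurable_discrete_op W C : measurable_fun setT W -> (forall x, `|W x| <= C) ->
  measurable_fun setT (discrete_op nu W).
Proof.
move=> mW WC; rewrite (_ : discrete_op nu W = (fun x => jump_avg W x - mass * W x)).
  apply: measurable_funB; first exact: measurable_jump_avg WC.
  exact: measurable_funM.
by apply/funext => x; exact: discrete_opE WC.
Qed.

Lemma norm_discrete_op W C x : measurable_fun setT W -> (forall x, `|W x| <= C) ->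
  `|discrete_op nu W x| <= 2 * mass * C.
Proof.
move=> mW WC; rewrite (discrete_opE _ mW WC).
apply: (le_trans (ler_normB _ _)).
rewrite (_ : 2 * mass * C = mass * C + mass * C); last by ring.
apply: lerD; first exact: norm_jump_avg.
by rewrite normrM ger0_norm ?mass_ge0// ler_wpM2l ?mass_ge0.
Qed.

Lemma Rintegrable_fst u : Rintegrable mu u -> Rintegrable P (fun p => u p.1).
Proof.
move=> iu; apply: (@le_Rintegrable_prod _ _ _ _ _ mu nu _ u (cst 1)) => //.
- exact: (measurableT_comp (Rintegrable_measurable iu) measurable_fst).
- exact: Rintegrable_cst_finite.
- by move=> x y /=; rewrite normr1 mulr1.
Qed.

Lemma Rintegral_fst u : Rintegrable mu u -> \int[P]_p u p.1 = mass * \int[mu]_x u x.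
Proof.
move=> iu; rewrite -(Rintegral21 (Rintegrable_fst iu)) /=.
by rewrite Rintegral_cst_finite.
Qed.

Lemma Rintegrable_sum u : Rintegrable mu u -> Rintegrable P (fun p => u (p.1 + p.2)).
Proof.
move=> iu; have [mu' uoo] := (integrable_l1norm mu u).1 iu.
apply/integrable21ltyP; first by apply/measurable_EFinP; exact: measurable_shift2.
rewrite (eq_integral (fun=> l1norm mu u)); last first.
  by move=> z _; rewrite -(l1norm_shift z mu').
rewrite integral_cst//; apply: lte_mul_pinfty => //; first exact: l1norm_ge0.
  by rewrite ge0_fin_numE// l1norm_ge0.
by rewrite -ge0_fin_numE// fin_num_measure.
Qed.

Lemma Rintegral_sum u : Rintegrable mu u ->
  \int[P]_p u (p.1 + p.2) = mass * \int[mu]_x u x.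
Proof.
move=> iu; rewrite -(Rintegral21 (Rintegrable_sum iu)) /=.
rewrite -Rintegral_cst_finite; apply: eq_Rintegral => z _.
rewrite /Rintegral (integral_shift z (f := EFin \o u))//.
by apply/measurable_EFinP; exact: Rintegrable_measurable iu.
Qed.

Lemma Rintegral_opp g : measurable_fun setT g -> \int[nu]_z g (- z) = \int[nu]_z g z.
Proof.
move=> mg; congr fine.
have mN : measurable_fun setT (fun x : X => - x) by exact: measurable_oppV.
transitivity (\int[pushforward nu (fun x : X => - x)%R]_z (g z)%:E)%E; last first.
  by apply: eq_measure_integral => // A mA _; exact: nuN.
have gE : measurable_fun setT (EFin \o g) by exact/measurable_EFinP.
rewrite integralE [RHS]integralE; congr (_ - _)%E.
  rewrite (ge0_integral_pushforward mN)//; last exact: measurable_funepos.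
  by apply: eq_integral => x _; rewrite /= !funeposE.
rewrite (ge0_integral_pushforward mN)//; last exact: measurable_funeneg.
by apply: eq_integral => x _; rewrite /= !funenegE.
Qed.

Section pairing.
Variables (W p : X -> R) (C : R).
Hypotheses (mW : measurable_fun setT W) (WC : forall x, `|W x| <= C).
Hypothesis ip : Rintegrable mu p.

Let mp := Rintegrable_measurable ip.
Let C0 : 0 <= C. Proof. exact: le_trans (WC 0). Qed.

Lemma Rintegrable_pW : Rintegrable P (fun q => p q.1 * W (q.1 + q.2)).
Proof.
apply: (le_Rintegrable _ (Rintegrable_fst (RintegrableZ C ip))).
  apply: measurable_funM; last exact: measurable_shift2.
  exact: (measurableT_comp mp measurable_fst).
move=> [x z] /=; rewrite !normrM mulrC ler_wpM2r//.
by apply: (le_trans (WC _)); exact: ler_norm.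
Qed.

Lemma Rintegrable_Wp : Rintegrable P (fun q => p (q.1 + q.2) * W q.1).
Proof.
apply: (le_Rintegrable _ (Rintegrable_sum (RintegrableZ C ip))).
  apply: measurable_funM; first exact: measurable_shift2.
  exact: (measurableT_comp mW measurable_fst).
move=> [x z] /=; rewrite !normrM mulrC ler_wpM2r//.
by apply: (le_trans (WC _)); exact: ler_norm.
Qed.

Lemma Rintegrable_mul_bounded : Rintegrable mu (fun x => p x * W x).
Proof.
apply: (le_Rintegrable _ (RintegrableZ C ip)); first exact: measurable_funM.
move=> x /=; rewrite !normrM mulrC ler_wpM2r//.
by apply: (le_trans (WC _)); exact: ler_norm.
Qed.

(** Self-adjointness: the substitution of [x - z] for [x], followed by that of [-z] for [z], which
    the symmetry of [nu] permits. *)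
Lemma Rintegral_Wp : \int[P]_q (p (q.1 + q.2) * W q.1) = \int[P]_q (p q.1 * W (q.1 + q.2)).
Proof.
rewrite -(Rintegral21 Rintegrable_Wp) -(Rintegral21 Rintegrable_pW) /=.
rewrite -[RHS]Rintegral_opp; last exact: (measurable_Rintegral2 Rintegrable_pW).
apply: eq_Rintegral => z _; rewrite /Rintegral; congr fine.
rewrite -(integral_shift (- z) (f := fun x => (p (x + z)%R * W x)%:E)).
  by apply: eq_integral => x _; rewrite addrNK.
apply/measurable_EFinP; apply: measurable_funM => //.
exact: measurable_fun_shift.
Qed.

Lemma Rintegral_discrete_op : \int[mu]_x (p x * discrete_op nu W x) =
  \int[P]_q (p q.1 * W (q.1 + q.2)) - mass * \int[mu]_x (p x * W x).
Proof.
rewrite -(Rintegral12 Rintegrable_pW) /= -RintegralZl//; last exact: Rintegrable_mul_bounded.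
rewrite -RintegralB//; last 2 first.
- exact: (Rintegrable1 Rintegrable_pW).
- exact: RintegrableZ Rintegrable_mul_bounded.
apply: eq_Rintegral => x _; rewrite (discrete_opE _ mW WC) RintegralZl//.
  by rewrite mulrBr mulrCA.
exact: Rintegrable_shiftl WC.
Qed.

(** By self-adjointness, minus twice the left side is the double integral of (p x - p y) (W x - W y)
    with y = x + z. The function [q] measures the permitted defect of monotonicity between [p] and
    [W]; [q = 0] is plain dissipativity. *)
Lemma Rintegral_discrete_op_le q : Rintegrable mu q ->
  (forall x y, 0 <= (p x - p y) * (W x - W y) + q x + q y) ->
  \int[mu]_x (p x * discrete_op nu W x) <= mass * \int[mu]_x q x.
Proof.
move=> iq h; rewrite Rintegral_discrete_op.
have ipW := Rintegrable_mul_bounded.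
pose I := \int[P]_q (p q.1 * W (q.1 + q.2)).
suff : 0 <= 2 * (mass * \int[mu]_x (p x * W x)) - 2 * I + 2 * (mass * \int[mu]_x q x).
  by rewrite -/I => ?; lra.
have i1 := Rintegrable_fst ipW; have i2 := Rintegrable_sum ipW.
have i3 := Rintegrable_pW; have i4 := Rintegrable_Wp.
have i5 := Rintegrable_fst iq; have i6 := Rintegrable_sum iq.
rewrite [X in _ <= X](_ : _ = \int[P]_r (
   ((p r.1 * W r.1 + p (r.1 + r.2) * W (r.1 + r.2)) -
    (p r.1 * W (r.1 + r.2) + p (r.1 + r.2) * W r.1)) + (q r.1 + q (r.1 + r.2)))).
  apply: Rintegral_ge0 => -[x z] _ /=; apply: (le_trans (h x (x + z))).
  by rewrite le_eqVlt; apply/orP; left; apply/eqP; ring.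
have i12 := RintegrableD i1 i2; have i34 := RintegrableD i3 i4; have i56 := RintegrableD i5 i6.
rewrite RintegralD//; last exact: (RintegrableB i12 i34).
rewrite RintegralB// RintegralD// RintegralD// RintegralD//.
rewrite Rintegral_Wp (Rintegral_fst ipW) (Rintegral_sum ipW) (Rintegral_fst iq) (Rintegral_sum iq) -/I.
ring.
Qed.

End pairing.
End jump.

(** * One step of the scheme *)

Section real_nonlinearities.
Context {R : realType}.

Lemma homo_bounded (phi : R -> R) (C : R) : {homo phi : r s / r <= s} ->
  exists2 B, 0 <= B & forall r, `|r| <= C -> `|phi r| <= B.
Proof.
move=> hphi; exists (`|phi C| + `|phi (- C)|); first by rewrite addr_ge0.
move=> r; rewrite ler_norml => /andP[Cr rC].
have := hphi _ _ Cr; have := hphi _ _ rC.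
have := ler_norm (phi C); have := ler_norm (- phi (- C)); rewrite normrN.
have := normr_ge0 (phi C); have := normr_ge0 (phi (- C)).
by move=> *; rewrite ler_norml; apply/andP; split; lra.
Qed.

Lemma ae0_of_Rintegral_le0 {d} {T : measurableType d} (mu : {measure set T -> \bar R})
    (p : T -> R) : Rintegrable mu p -> (forall x, 0 <= p x) ->
  \int[mu]_x p x <= 0 -> {ae mu, forall x, p x = 0}.
Proof.
move=> ip p0 h; have mp := Rintegrable_measurable ip.
have : l1norm mu p = 0%E.
  apply/eqP; rewrite eq_le l1norm_ge0 andbT -Rintegral_l1norm//.
  rewrite lee_fin; apply: le_trans h; rewrite le_eqVlt; apply/orP; left; apply/eqP.
  by apply: eq_Rintegral => x _; rewrite ger0_norm.
have mpE : measurable_fun setT (EFin \o p) by exact/measurable_EFinP.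
move/(ae_eq_integral_abs mu measurableT mpE).
by apply: ae_imply => x /(_ I) /= [].
Qed.

(** There is no overshoot: [d] and [w] point the same way and the amount subtracted does not exceed
    |d|. *)
Lemma norm_sub_same_sign (a d w : R) : 0 <= a -> 0 <= d * w -> a * `|w| <= `|d| ->
  `|d - a * w| <= `|d| - a * `|w|.
Proof.
move=> a0 dw; have [d0|d0|->] := ltgtP d 0.
- have w0 : w <= 0 by rewrite leNgt; apply/negP => w0; nra.
  by rewrite (ltr0_norm d0) (ler0_norm w0) => h; rewrite ler_norml; apply/andP; split; lra.
- have w0 : 0 <= w by rewrite leNgt; apply/negP => w0; nra.
  by rewrite (gtr0_norm d0) (ger0_norm w0) => h; rewrite ler_norml; apply/andP; split; lra.
- rewrite normr0 => h; have : a * w = 0.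
    by apply/eqP; rewrite -normr_le0 normrM (ger0_norm a0).
  by move/eqP; rewrite mulf_eq0 => /orP[/eqP ->|/eqP ->]; rewrite ?mul0r ?mulr0 ?normr0 subr0 ?normr0 ?mulr0.
Qed.

(** Read contrapositively, it bounds |r - s| below where |phi r - phi s| exceeds [e]; this is how
    truncated signs become integrable. *)
Lemma segment_unif_continuous (phi : R -> R) (C e : R) : continuous phi -> 0 < e ->
  exists2 d, 0 < d & forall r s, `|r| <= C -> `|s| <= C -> `|r - s| < d ->
    `|phi r - phi s| <= e.
Proof.
move=> cphi e0; have e2 : 0 < e / 2 by rewrite divr_gt0.
have := (compact_near_coveringP `[- C, C]%classic).1 (@segment_compact R (- C) C).
move=> /(_ _ (0^'+ : set_system R) (fun d r => forall s, `|r - s| < d -> `|phi r - phi s| <= e) _) h.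
have {h} : \forall d \near (0:R)^'+,
    `[- C, C]%classic `<=` (fun r => forall s, `|r - s| < d -> `|phi r - phi s| <= e).
  apply: h => x _; have /cvgr_dist_lt/(_ _ e2) /nbhs_ballP[d /= d0 dP] := cphi x.
  have d2 : 0 < d / 2 by rewrite divr_gt0.
  exists (ball x (d / 2), [set t | t < d / 2]).
    split; first exact: nbhsx_ballx.
    by exists (d / 2) => //= t /=; rewrite sub0r normrN => + t0; rewrite gtr0_norm.
  move=> [r t] /= [xr td] s rs.
  move: xr; rewrite -ball_normE /= => xr.
  have /dP hr : ball x d r by rewrite -ball_normE /=; lra.
  have /dP hs : ball x d s.
    rewrite -ball_normE /= (_ : x - s = (x - r) + (r - s)); last by ring.
    by apply: le_lt_trans (ler_normD _ _) _; lra.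
  rewrite (_ : phi r - phi s = (phi x - phi s) - (phi x - phi r)); last by ring.
  by apply: le_trans (ler_normB _ _) _; rewrite /= in hr hs; lra.
move=> [d /= d0 dP]; exists (d / 2); first by rewrite divr_gt0.
move=> r s rC _ rs; apply: (dP (d / 2) _ _ r _ s rs).
- by rewrite /= sub0r normrN gtr0_norm ?divr_gt0// ltr_pdivrMr// ltr_pMr// ltr1n.
- by rewrite divr_gt0.
- by rewrite /= in_itv/= -ler_norml.
Qed.

(* Sign condition for the truncated sign [p] of [d] used as a test function in the
   [L^1] contraction; [W] may vanish where [d] does not when the nonlinearity is flat. *)
Lemma truncated_sign_pairing (e d d' W W' : R) (p := fun d W : R =>
    if (e ^+ 2 < `|W|) || ((W == 0) && (e < `|d|)) then Num.sg d else 0) :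
  0 <= e -> 0 <= d * W -> (d = 0 -> W = 0) -> 0 <= d' * W' -> (d' = 0 -> W' = 0) ->
  0 <= (p d W - p d' W') * (W - W') + e * `|d| + e * `|d'|.
Proof.
have pW (x y : R) : 0 <= x * y -> (x = 0 -> y = 0) -> Num.sg x * y = `|y|.
  move=> xy x0; have [y0|y0|->] := ltgtP y 0; last by rewrite mulr0 normr0.
    have : x < 0.
      rewrite lt_neqAle leNgt; apply/andP; split; first by apply/eqP => /x0 h; rewrite h ltxx in y0.
      by apply/negP => ?; nra.
    by move=> /ltr0_sg ->; rewrite mulN1r ltr0_norm.
  have : 0 < x.
    rewrite lt_neqAle leNgt; apply/andP; split; first by apply/eqP => /esym /x0 h; rewrite h ltxx in y0.
    by apply/negP => ?; nra.
  by move=> /gtr0_sg ->; rewrite mul1r gtr0_norm.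
have psg (x y : R) : `|Num.sg x * y| <= `|y|.
  by rewrite normrM normr_sg; case: (x != 0); rewrite /= ?mul1r ?mul0r.
move=> e0 dW d0 dW' d0'; have h := pW _ _ dW d0; have h' := pW _ _ dW' d0'.
have k := psg d W'; have k' := psg d' W.
have dn := mulr_ge0 e0 (normr_ge0 d); have dn' := mulr_ge0 e0 (normr_ge0 d').
rewrite /p; case: ifPn => hW; case: ifPn => hW'.
- have := ler_norm (Num.sg d * W'); have := ler_norm (Num.sg d' * W).
  by rewrite mulrBr !mulrBl; lra.
- rewrite subr0 mulrBr h; have := ler_norm (Num.sg d * W').
  move: hW'; rewrite negb_or -leNgt => /andP[hW' _].
  (* Either |W| exceeds e^2 >= |W'| and dominates, or [W = 0] and |W'| <= e^2 <= e |d|; the two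
     thresholds are matched for this second case. *)
  case/orP: hW => [hW|/andP[/eqP W0 hd]]; first lra.
  have : e * e <= e * `|d| by rewrite ler_wpM2l// ltW.
  by rewrite W0 normr0; move: hW'; rewrite expr2; lra.
- rewrite sub0r mulrBr mulNr mulNr h'; have := ler_norm (Num.sg d' * W).
  move: hW; rewrite negb_or -leNgt => /andP[hW _].
  case/orP: hW' => [hW'|/andP[/eqP W0 hd]]; first lra.
  have : e * e <= e * `|d'| by rewrite ler_wpM2l// ltW.
  by rewrite W0 normr0; move: hW; rewrite expr2; lra.
- by rewrite subrr mul0r add0r addr_ge0.
Qed.

End real_nonlinearities.

Section step.
Context {R : realType} {N : nat}.
Notation X := 'rV[R]_N.
Variable nu : {finite_measure set X -> \bar R}.
Hypothesis nuN : forall A : set X, measurable A -> nu (-%R @^-1` A) = nu A.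
Notation mu := (@leb R N).
Notation mass := (mass nu).

Lemma measurable_homo_comp (phi : R -> R) (V : X -> R) : {homo phi : r s / r <= s} ->
  measurable_fun setT V -> measurable_fun setT (phi \o V).
Proof.
move=> hphi mV; apply: measurableT_comp => //.
exact: nondecreasing_measurable.
Qed.

Lemma discrete_opN (W : X -> R) C x : measurable_fun setT W -> (forall x, `|W x| <= C) ->
  discrete_op nu (fun x => - W x) x = - discrete_op nu W x.
Proof.
move=> mW WC; have iW := Rintegrable_shiftl nu x mW WC.
rewrite /discrete_op -RintegralN; last exact: (RintegrableB iW (Rintegrable_cst_finite nu (W x))).
by apply: eq_Rintegral => z _; ring.
Qed.

Lemma discrete_opB (W W' : X -> R) C x : measurable_fun setT W -> measurable_fun setT W' ->
  (forall x, `|W x| <= C) -> (forall x, `|W' x| <= C) ->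
  discrete_op nu (fun x => W x - W' x) x = discrete_op nu W x - discrete_op nu W' x.
Proof.
move=> mW mW' WC WC'.
have iW := RintegrableB (Rintegrable_shiftl nu x mW WC) (Rintegrable_cst_finite nu (W x)).
have iW' := RintegrableB (Rintegrable_shiftl nu x mW' WC') (Rintegrable_cst_finite nu (W' x)).
rewrite /discrete_op -RintegralB//.
by apply: eq_Rintegral => z _ /=; ring.
Qed.

(* Testing with the positive part of [V - c], a nondecreasing function of [V],
   keeps the test function integrable even for [c = 0]. *)
Lemma implicit_step_le (phi : R -> R) (V G : X -> R) tau c C :
  {homo phi : r s / r <= s} -> Rintegrable mu V -> (forall x, `|V x| <= C) ->
  0 <= tau -> 0 <= c ->
  {ae mu, forall x, V x = tau * discrete_op nu (phi \o V) x + G x} ->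
  {ae mu, forall x, G x <= c} -> {ae mu, forall x, V x <= c}.
Proof.
move=> hphi iV VC tau0 c0 VG Gc; have mV := Rintegrable_measurable iV.
have [B B0 phiB] := homo_bounded C hphi.
have mW := measurable_homo_comp hphi mV.
have WB x : `|(phi \o V) x| <= B by exact: phiB.
pose p x := Num.max (V x - c) 0.
have p0 x : 0 <= p x by rewrite le_max lexx orbT.
have mp : measurable_fun setT p.
  by apply: measurable_maxr => //; exact: measurable_funB.
have pV x : `|p x| <= `|V x|.
  rewrite ger0_norm// ge_max normr_ge0 andbT.
  by apply: le_trans (ler_norm _); rewrite gerBl.
have ip : Rintegrable mu p by exact: le_Rintegrable iV _.
have ipp : Rintegrable mu (fun x => p x * p x).
  by apply: (@Rintegrable_mul_bounded _ _ p p C) => // x; exact: le_trans (VC x).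
have iD : Rintegrable mu (fun x => p x * discrete_op nu (phi \o V) x).
  apply: (@Rintegrable_mul_bounded _ _ (discrete_op nu (phi \o V)) p (2 * mass * B)) => //.
    exact: measurable_discrete_op WB.
  by move=> x; exact: norm_discrete_op.
have iD' := RintegrableZ tau iD.
have hD : \int[mu]_x (p x * discrete_op nu (phi \o V) x) <= mass * \int[mu]_x 0.
  apply: (Rintegral_discrete_op_le nuN mW WB ip (q := fun=> 0)).
    by apply: le_Rintegrable iV _ => // x; rewrite normr0.
  move=> x y; rewrite !addr0 /p /=.
  have [xy|/ltW xy] := leP (V x) (V y).
    by apply: mulr_le0; rewrite subr_le0 ?hphi// ge_max le_max lerD2r xy/= le_max lexx orbT.
  by apply: mulr_ge0; rewrite subr_ge0 ?hphi// ge_max le_max lerD2r xy/= le_max lexx orbT.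
(* Where [p] is nonzero it equals V - c <= V - G, which is [tau] times the jump term; multiplied by
   [p], the right side has an integral at most 0. *)
have ppE : {ae mu, forall x, p x * p x <= tau * (p x * discrete_op nu (phi \o V) x)}.
  apply: ae_imply2 VG Gc => x VE Gxc.
  have [->|pn0] := eqVneq (p x) 0; first by rewrite !mul0r mulr0.
  have pE : p x = V x - c.
    by move: pn0; rewrite /p; case: leP => //; rewrite eqxx.
  by rewrite mulrCA; apply: ler_wpM2l => //; rewrite pE {1}VE; lra.
have : \int[mu]_x (p x * p x) <= 0.
  apply: le_trans (ae_le_Rintegral ipp iD' ppE) _; rewrite RintegralZl//.
  by move: hD; rewrite Rintegral_cst// mul0r mulr0 => ?; apply: mulr_ge0_le0.
move=> /(ae0_of_Rintegral_le0 ipp) h.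
have : {ae mu, forall x, p x * p x = 0} by apply: h => x; rewrite mulr_ge0.
apply: ae_imply => x /eqP; rewrite mulf_eq0 orbb /p => /eqP e.
by rewrite -subr_le0 -[leRHS]e le_max lexx.
Qed.

Lemma implicit_step_norm_le (phi : R -> R) (V G : X -> R) tau c C :
  {homo phi : r s / r <= s} -> Rintegrable mu V -> (forall x, `|V x| <= C) ->
  0 <= tau -> 0 <= c ->
  {ae mu, forall x, V x = tau * discrete_op nu (phi \o V) x + G x} ->
  {ae mu, forall x, `|G x| <= c} -> {ae mu, forall x, `|V x| <= c}.
Proof.
move=> hphi iV VC tau0 c0 VG Gc; have mV := Rintegrable_measurable iV.
have [B B0 phiB] := homo_bounded C hphi.
have mW := measurable_homo_comp hphi mV.
have WB x : `|(phi \o V) x| <= B by exact: phiB.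
have up : {ae mu, forall x, V x <= c}.
  apply: (@implicit_step_le phi V G tau c C) => //.
  by apply: ae_imply Gc => x; apply: le_trans; exact: ler_norm.
have lo : {ae mu, forall x, - V x <= c}.
  (* Reflection: -V solves the equation with the nonlinearity r -> - phi (- r), again
     nondecreasing. *)
  apply: (@implicit_step_le (fun r => - phi (- r)) (fun x => - V x) (fun x => - G x) tau c C) => //.
  - by move=> r s rs; rewrite lerN2 hphi// lerN2.
  - by apply: le_Rintegrable iV _ => [|x]; [exact: measurableT_comp|rewrite normrN].
  - by move=> x; rewrite normrN.
  - apply: ae_imply VG => x VE; rewrite {1}VE.
    rewrite (_ : (fun r => - phi (- r)) \o (fun x => - V x) = (fun x => - (phi \o V) x)); last first.
      by apply/funext => y /=; rewrite opprK.
    by rewrite (discrete_opN _ mW WB); ring.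
  - by apply: ae_imply Gc => x; apply: le_trans; rewrite -normrN ler_norm.
by apply: ae_imply2 up lo => x Vc cV; rewrite ler_norml Vc andbT lerNl.
Qed.

(* Under the CFL condition the step is nondecreasing in every value of [U]. *)
Lemma explicit_step_norm_le (phi : R -> R) (U : X -> R) tau L m x :
  {homo phi : r s / r <= s} -> measurable_fun setT U -> (forall x, `|U x| <= m) ->
  (forall r s, `|r| <= m -> `|s| <= m -> `|phi r - phi s| <= L * `|r - s|) ->
  0 <= tau -> tau * L * mass <= 1 ->
  `|U x + tau * discrete_op nu (phi \o U) x| <= m.
Proof.
move=> hphi mU Um hL tau0 cfl.
have m0 : 0 <= m by exact: le_trans (Um 0).
have [B B0 phiB] := homo_bounded m hphi.
have mW := measurable_homo_comp hphi mU.
have WB y : `|(phi \o U) y| <= B by exact: phiB.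
have mass0 := mass_ge0 nu.
have mm : `|m| <= m by rewrite ger0_norm.
have mNm : `|- m| <= m by rewrite normrN ger0_norm.
have cavg c : jump_avg nu (cst c) x = mass * c.
  by rewrite /jump_avg /cst Rintegral_cst_finite.
have up : jump_avg nu (phi \o U) x <= mass * phi m.
  rewrite -cavg; apply: (@le_jump_avg _ _ nu _ _ B) => // y; first exact: phiB.
  by rewrite /= hphi//; have := Um y; rewrite ler_norml => /andP[].
have lo : mass * phi (- m) <= jump_avg nu (phi \o U) x.
  rewrite -cavg; apply: (@le_jump_avg _ _ nu _ _ B) => // y; first exact: phiB.
  by rewrite /= hphi//; have := Um y; rewrite ler_norml => /andP[].
rewrite (discrete_opE nu x mW WB) /=.
have /andP[Ul Uu] : - m <= U x <= m by rewrite -ler_norml.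
have h1 : phi m - phi (U x) <= L * (m - U x).
  have := hL _ _ mm (Um x); rewrite (ger0_norm (x := m - U x)) ?subr_ge0//.
  by apply: le_trans; exact: ler_norm.
have h2 : phi (U x) - phi (- m) <= L * (U x + m).
  have := hL _ _ (Um x) mNm; rewrite opprK (ger0_norm (x := U x + m)); last lra.
  by apply: le_trans; exact: ler_norm.
have tm0 : 0 <= tau * mass by exact: mulr_ge0.
(* An upward move is at most tau mass (phi m - phi (U x)) <= tau mass L (m - U x), and the CFL
   condition bounds this by the room m - U x. *)
have k1 : tau * (jump_avg nu (phi \o U) x - mass * phi (U x)) <= m - U x.
  apply: (@le_trans _ _ (tau * mass * (L * (m - U x)))).
    apply: (@le_trans _ _ (tau * mass * (phi m - phi (U x)))); last exact: ler_wpM2l.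
    by rewrite -mulrA ler_wpM2l// mulrBr lerB.
  rewrite (_ : _ * _ = (tau * L * mass) * (m - U x)); last by ring.
  by apply: ler_piMl => //; rewrite subr_ge0.
have k2 : - (U x + m) <= tau * (jump_avg nu (phi \o U) x - mass * phi (U x)).
  rewrite lerNl -mulrN opprB.
  apply: (@le_trans _ _ (tau * mass * (L * (U x + m)))).
    apply: (@le_trans _ _ (tau * mass * (phi (U x) - phi (- m)))); last exact: ler_wpM2l.
    by rewrite -mulrA ler_wpM2l// mulrBr lerB.
  rewrite (_ : _ * _ = (tau * L * mass) * (U x + m)); last by ring.
  by apply: ler_piMl => //; lra.
by rewrite ler_norml; apply/andP; split; lra.
Qed.

(** The jump term splits into a loss at [x] and a gain from elsewhere. Under the CFL condition the
    loss lowers |U - U'| by tau mass |W|, and after integration the gain restores at most the same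
    amount. *)
Lemma explicit_step_l1norm (phi : R -> R) (U U' : X -> R) tau L m :
  {homo phi : r s / r <= s} -> Rintegrable mu U -> Rintegrable mu U' ->
  (forall x, `|U x| <= m) -> (forall x, `|U' x| <= m) ->
  (forall r s, `|r| <= m -> `|s| <= m -> `|phi r - phi s| <= L * `|r - s|) ->
  0 <= tau -> tau * L * mass <= 1 ->
  let G x := U x - U' x + tau * (discrete_op nu (phi \o U) x - discrete_op nu (phi \o U') x) in
  Rintegrable mu G /\ (l1norm mu G <= l1norm mu (fun x => U x - U' x)%R)%E.
Proof.
move=> hphi iU iU' Um Um' hL tau0 cfl G.
have mU := Rintegrable_measurable iU; have mU' := Rintegrable_measurable iU'.
have m0 : 0 <= m by exact: le_trans (Um 0).
have [B B0 phiB] := homo_bounded m hphi.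
have mw := measurable_homo_comp hphi mU; have mw' := measurable_homo_comp hphi mU'.
have wB y : `|(phi \o U) y| <= B by exact: phiB.
have wB' y : `|(phi \o U') y| <= B by exact: phiB.
have mass0 := mass_ge0 nu.
pose W x := phi (U x) - phi (U' x).
have mW : measurable_fun setT W by exact: measurable_funB.
have WB x : `|W x| <= B + B by apply: (le_trans (ler_normB _ _)); apply: lerD; exact: phiB.
have iW : Rintegrable mu W.
  apply: (le_Rintegrable mW (RintegrableZ L (RintegrableB iU iU'))) => x.
  rewrite normrM; apply: (le_trans (hL _ _ (Um x) (Um' x))).
  by apply: ler_wpM2r => //; exact: ler_norm.
have iaW := Rintegrable_norm iW.
have iU2 := RintegrableB iU iU'; have iaU2 := Rintegrable_norm iU2.
have iS := Rintegrable1 (Rintegrable_sum nu iaW).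
have GE x : G x = (U x - U' x - tau * mass * W x) + tau * jump_avg nu W x.
  rewrite /G -(discrete_opB x mw mw' wB wB') -/W (discrete_opE nu x mW WB); ring.
have Gle x : `|G x| <= (`|U x - U' x| - tau * mass * `|W x|) + tau * jump_avg nu (fun y => `|W y|) x.
  rewrite GE; apply: (le_trans (ler_normD _ _)); apply: lerD.
    apply: norm_sub_same_sign; first exact: mulr_ge0.
      have [h|/ltW h] := leP (U x) (U' x).
        by apply: mulr_le0; rewrite subr_le0 ?hphi.
      by apply: mulr_ge0; rewrite subr_ge0 ?hphi.
    apply: (@le_trans _ _ (tau * mass * (L * `|U x - U' x|))).
      by apply: ler_wpM2l; [exact: mulr_ge0|exact: hL].
    rewrite (_ : _ * _ = (tau * L * mass) * `|U x - U' x|); last by ring.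
    exact: ler_piMl.
  rewrite normrM (ger0_norm tau0) ler_wpM2l//.
  by apply: le_normr_Rintegral => //; exact: (Rintegrable_shiftl nu x mW WB).
have iB1 := RintegrableB iaU2 (RintegrableZ (tau * mass) iaW).
have iR := RintegrableD iB1 (RintegrableZ tau iS).
have mG : measurable_fun setT G.
  rewrite (_ : G = fun x => (U x - U' x - tau * mass * W x) + tau * jump_avg nu W x); last first.
    by apply/funext => x; exact: GE.
  apply: measurable_funD; last by apply: measurable_funM => //; exact: measurable_jump_avg WB.
  by apply: measurable_funB; [exact: measurable_funB|exact: measurable_funM].
have iG : Rintegrable mu G.
  by apply: (le_Rintegrable mG iR) => x; apply: (le_trans (Gle x)); exact: ler_norm.
split => //; rewrite -!Rintegral_l1norm// lee_fin.
apply: le_trans (le_Rintegral (f2 := fun x => (`|U x - U' x| - tau * mass * `|W x|) + tau * jump_avg nu (fun y => `|W y|) x) measurableT (Rintegrable_norm iG) iR _) _ => //.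
rewrite RintegralD//; last exact: (RintegrableZ tau iS).
rewrite RintegralB//; last exact: (RintegrableZ _ iaW).
rewrite !RintegralZl//.
have -> : \int[mu]_x jump_avg nu (fun y => `|W y|) x = mass * \int[mu]_x `|W x|.
  by rewrite -(Rintegral_sum nu iaW) -(Rintegral12 (Rintegrable_sum nu iaW)).
by rewrite mulrA subrK.
Qed.

Lemma measurable_sg : measurable_fun setT (Num.sg : R -> R).
Proof.
rewrite (_ : Num.sg = (fun x : R => if 0 < x then 1 else if x < 0 then -1 else 0)).
  apply: measurable_fun_ifT => //; first exact: measurable_fun_ltr.
  by apply: measurable_fun_ifT => //; exact: measurable_fun_ltr.
apply/funext => x; case: ltgtP => [/gtr0_sg //|/ltr0_sg //|<-]; exact: sgr0.
Qed.

(** Formally one tests with the sign of V - V'. The truncated sign [p n] replaces it, with a defect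
    of dissipativity bounded by eps_n times |V - V'|; defect and truncation both disappear as n
    grows. *)
Lemma implicit_step_l1norm (phi : R -> R) (V V' G : X -> R) tau C :
  {homo phi : r s / r <= s} -> continuous phi ->
  Rintegrable mu V -> Rintegrable mu V' -> Rintegrable mu G ->
  (forall x, `|V x| <= C) -> (forall x, `|V' x| <= C) -> 0 <= tau ->
  {ae mu, forall x, V x - V' x =
     tau * (discrete_op nu (phi \o V) x - discrete_op nu (phi \o V') x) + G x} ->
  (l1norm mu (fun x => V x - V' x)%R <= l1norm mu G)%E.
Proof.
move=> hphi cphi iV iV' iG VC VC' tau0 VG.
have mV := Rintegrable_measurable iV; have mV' := Rintegrable_measurable iV'.
have mG := Rintegrable_measurable iG.
have [B B0 phiB] := homo_bounded C hphi.
have mw := measurable_homo_comp hphi mV; have mw' := measurable_homo_comp hphi mV'.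
have wB y : `|(phi \o V) y| <= B by exact: phiB.
have wB' y : `|(phi \o V') y| <= B by exact: phiB.
have mass0 := mass_ge0 nu.
pose d x := V x - V' x; pose W x := phi (V x) - phi (V' x).
have md : measurable_fun setT d by exact: measurable_funB.
have mW : measurable_fun setT W by exact: measurable_funB.
have WB x : `|W x| <= B + B by apply: (le_trans (ler_normB _ _)); apply: lerD; exact: phiB.
have id : Rintegrable mu d by exact: RintegrableB.
have idn := Rintegrable_norm id.
have dW x : 0 <= d x * W x.
  rewrite /d /W; have [h|/ltW h] := leP (V x) (V' x).
    by apply: mulr_le0; rewrite subr_le0 ?hphi.
  by apply: mulr_ge0; rewrite subr_ge0 ?hphi.
have d0W x : d x = 0 -> W x = 0.
  by move/eqP; rewrite subr_eq0 /W => /eqP ->; rewrite subrr.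
pose eps (n : nat) : R := n.+1%:R^-1.
have eps0 n : 0 < eps n by rewrite invr_gt0.
pose p n x := if ((eps n) ^+ 2 < `|W x|) || ((W x == 0) && (eps n < `|d x|))
  then Num.sg (d x) else 0.
have mp n : measurable_fun setT (p n).
  apply: measurable_fun_ifT => //; last exact: (measurableT_comp measurable_sg md).
  apply: measurable_or; first by apply: measurable_fun_ltr => //; exact: measurableT_comp.
  apply: measurable_and; first exact: measurable_fun_eqr.
  by apply: measurable_fun_ltr => //; exact: measurableT_comp.
have p1 n x : `|p n x| <= 1.
  by rewrite /p; case: ifP => _; rewrite ?normr0// normr_sg; case: (_ != _).
(* Where [p n] is nonzero, |d| is at least [eta]: by uniform continuity of [phi] if |W| > eps_n^2,
   by definition otherwise. Hence |p n| <= |d| / eta. *)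
have ip n : Rintegrable mu (p n).
  have e20 : 0 < eps n ^+ 2 by rewrite exprn_gt0.
  have [h h0 hP] := segment_unif_continuous C cphi e20.
  pose eta := Num.min h (eps n).
  have eta0 : 0 < eta by rewrite lt_min h0 eps0.
  apply: (le_Rintegrable (mp n) (RintegrableZ eta^-1 id)) => x.
  rewrite normrM (ger0_norm (x := eta^-1)) ?invr_ge0 ?(ltW eta0)//.
  rewrite /p; case: ifP => [hx|_]; last by rewrite normr0 mulr_ge0 ?invr_ge0 ?(ltW eta0).
  rewrite normr_sg; apply: (@le_trans _ _ 1); first by case: (_ != _).
  rewrite ler_pdivlMl// mulr1; case/orP: hx => [Wx|/andP[_ dx]].
    rewrite leNgt; apply/negP => dh; move: Wx; rewrite ltNge => /negP; apply.
    by apply: hP; rewrite ?VC ?VC'// (lt_le_trans dh)// ge_min lexx.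
  by rewrite (le_trans _ (ltW dx))// ge_min lexx orbT.
have hD n : \int[mu]_x (p n x * discrete_op nu W x) <= mass * (eps n * \int[mu]_x `|d x|).
  rewrite -RintegralZl//.
  apply: (Rintegral_discrete_op_le nuN mW WB (ip n)); first exact: RintegrableZ.
  by move=> x y; exact: (truncated_sign_pairing (ltW (eps0 n)) (dW x) (@d0W x) (dW y) (@d0W y)).
have idp n : Rintegrable mu (fun x => d x * p n x) by exact: Rintegrable_mul_bounded (p1 n) id.
have iGp n : Rintegrable mu (fun x => G x * p n x) by exact: Rintegrable_mul_bounded (p1 n) iG.
have iDp n : Rintegrable mu (fun x => p n x * discrete_op nu W x).
  apply: (@Rintegrable_mul_bounded _ _ _ _ (2 * mass * (B + B))) => //.
    exact: measurable_discrete_op WB.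
  by move=> x; exact: norm_discrete_op.
have key n : \int[mu]_x (d x * p n x) <=
    tau * (mass * (eps n * \int[mu]_x `|d x|)) + \int[mu]_x `|G x|.
  apply: (@le_trans _ _ (\int[mu]_x (tau * (p n x * discrete_op nu W x) + G x * p n x))).
    apply: ae_le_Rintegral => //; first exact: (RintegrableD (RintegrableZ tau (iDp n))).
    apply: ae_imply VG => x; rewrite -(discrete_opB x mw mw' wB wB') -/(d x) => ->.
    by rewrite mulrDl mulrAC mulrA.
  have i1 := RintegrableZ tau (iDp n); have i2 := iGp n.
  rewrite RintegralD// (RintegralZl _ measurableT (iDp n)); apply: lerD; first exact: ler_wpM2l.
  apply: le_Rintegral => //; first exact: Rintegrable_norm.
  move=> x _; apply: (le_trans (ler_norm _)); rewrite normrM.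
  by apply: ler_piMr.
rewrite -!Rintegral_l1norm// lee_fin -/d.
apply/ler_addgt0Pr => e e0.
have e2 : 0 < e / 2 by rewrite divr_gt0.
have eps_cvg : eps @ \oo --> 0 by exact: cvg_harmonic.
have near_lt (u : nat -> R) c : u @ \oo --> 0 -> 0 < c -> \forall n \near \oo, u n < c.
  by move=> u0 c0; have /cvgr_lt := u0; apply.
(* At fixed [x] the sequence is eventually constant: if [d x] is nonzero, one of the two thresholds
   is eventually passed, according to whether [W x] vanishes. *)
have conv : {ae mu, forall x, (fun n => d x * p n x) @ \oo --> `|d x|}.
  apply: aeW => x; apply: cvg_near_cst.
  have [dx0|dx0] := eqVneq (d x) 0; first by apply: nearW => n; rewrite dx0 mul0r normr0.
  have pE n : ((eps n) ^+ 2 < `|W x|) || ((W x == 0) && (eps n < `|d x|)) ->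
      d x * p n x = `|d x|.
    by rewrite /p => ->; rewrite mulrC; case: (ltgtP (d x) 0) dx0 => // h _;
      [rewrite (ltr0_sg h) mulN1r ltr0_norm|rewrite (gtr0_sg h) mul1r gtr0_norm].
  have [Wx0|Wx0] := eqVneq (W x) 0.
    have dx : 0 < `|d x| by rewrite normr_gt0.
    apply: filterS (near_lt _ _ eps_cvg dx) => n hn; apply: pE.
    by rewrite Wx0 eqxx hn orbT.
  have Wx : 0 < `|W x| by rewrite normr_gt0.
  have e2cvg : (fun n => eps n ^+ 2) @ \oo --> 0.
    rewrite (_ : (fun n => eps n ^+ 2) = (fun n => eps n * eps n)); last first.
      by apply/funext => n; rewrite expr2.
    by have := cvgM eps_cvg eps_cvg; rewrite mulr0; exact.
  by apply: filterS (near_lt _ _ e2cvg Wx) => n hn; apply: pE; rewrite hn.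
have near1 := dct_l1norm_near (mu := mu) (f_ := fun n x => d x * p n x) (f := fun x => `|d x|)
  (g := fun x => `|d x|) (fun n => Rintegrable_measurable (idp n))
  (Rintegrable_measurable idn) conv idn _ e2.
have {near1} near1 : \forall n \near \oo,
    (l1norm mu (fun x => d x * p n x - `|d x|)%R <= (e / 2)%:E)%E.
  by apply: near1; apply: aeW => x n; rewrite normrM ler_piMr.
pose K := tau * (mass * \int[mu]_x `|d x|).
have near2 : \forall n \near \oo, eps n * K < e / 2.
  have : (fun n => eps n * K) @ \oo --> 0.
    by have := cvgM eps_cvg (@cvg_cst _ K _ \oo _); rewrite mul0r; exact.
  by move=> h; exact: near_lt h e2.
have [n [n1 n2]] := filter_ex (filterI near1 near2).
have i1 : Rintegrable mu (fun x => `|d x| - d x * p n x) by exact: RintegrableB.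
have : \int[mu]_x (`|d x| - d x * p n x) <= e / 2.
  rewrite -lee_fin; apply: le_trans (l1norm_ge_Rintegral i1) _.
  by rewrite l1normB_sym.
rewrite (RintegralB measurableT idn (idp n)); have := key n.
have -> : tau * (mass * (eps n * \int[mu]_x `|d x|)) = eps n * K by rewrite /K; ring.
by move: n2; lra.
Qed.

End step.

(** * Averaging over balls *)

Section ball_measure.
Context {R : realType} {N : nat}.
Notation X := 'rV[R]_N.
Notation mu := (@leb R N).

(** Balls of the sup norm are cubes. *)
Lemma leb_norm_leE (r : R) : 0 <= r ->
  leb N [set x : X | (`|x| <= r)%R] = ((2 * r) ^+ N)%:E.
Proof.
move=> r0.
have mI i : measurable ((fun _ : 'I_N => `[- r, r]%classic : set (measurableTypeR R)) i).
  exact: measurable_itv.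
rewrite (_ : mkset _ = [set v : X | forall i, `[- r, r]%classic (v 0 i)]); last first.
  apply/seteqP; split => x /=.
    by move=> xr i; rewrite /= in_itv/= -ler_norml; exact: le_trans (ler_coord_norm x i) xr.
  move=> h; rewrite [leLHS]/Num.norm/= mx_normrE; apply/bigmax_leP; split => // -[i j] _ /=.
  by rewrite ord1; have := h j; rewrite /= in_itv/= -ler_norml.
rewrite (leb_box mI) (eq_bigr (fun=> (2 * r)%:E)); last first.
  move=> i _; rewrite lebesgue_measure_itv/= lte_fin; case: ifPn => h.
    by rewrite -EFinD; congr (_%:E); lra.
  by congr (_%:E); lra.
by rewrite prodEFin prodr_const card_ord.
Qed.

Lemma exprn_lipschitz (n : nat) (A : R) : 0 <= A -> exists2 K, 0 <= K &
  forall a b, 0 <= b -> b <= a -> a <= A -> a ^+ n - b ^+ n <= K * (a - b).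
Proof.
move=> A0; elim: n => [|n [K K0 IH]].
  by exists 0 => // a b _ _ _; rewrite !expr0 subrr mul0r.
exists (A * K + A ^+ n); first by rewrite addr_ge0 ?mulr_ge0 ?exprn_ge0.
move=> a b b0 ba aA; have a0 := le_trans b0 ba.
rewrite !exprS (_ : _ - _ = a * (a ^+ n - b ^+ n) + (a - b) * b ^+ n); last by ring.
rewrite [leRHS]mulrDl; apply: lerD.
  apply: (@le_trans _ _ (a * (K * (a - b)))); first by rewrite ler_wpM2l// IH.
  by rewrite -mulrA ler_wpM2r// mulr_ge0// subr_ge0.
rewrite mulrC ler_wpM2r ?subr_ge0//.
by rewrite lerXn2r// ?nnegrE// (le_trans ba).
Qed.

(** For |z| <= delta the increment lives in the shell between the radii delta - |z| and delta + |z|,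
    of volume O(|z|); otherwise twice the volume of the ball is enough. *)
Lemma l1norm_ball_shift (delta : R) : 0 < delta ->
  exists2 C, 0 <= C & forall z : X,
    (l1norm mu (fun y => \1_[set x : X | `|x| <= delta] (y + z) -
       \1_[set x : X | `|x| <= delta] y)%R <= (C * Num.min `|z| 1)%:E)%E.
Proof.
move=> d0; pose B := [set x : X | `|x| <= delta].
have mB : measurable B by exact: measurable_norm_le.
have mi : measurable_fun setT (\1_B : X -> R) by exact: measurable_indic.
have miz z : measurable_fun setT (fun y : X => \1_B (y + z) : R) by exact: measurable_fun_shift.
have B_ge0 : (0:R) <= (2 * delta) ^+ N by rewrite exprn_ge0// mulr_ge0// ltW.
have muB : mu B = ((2 * delta) ^+ N)%:E by rewrite leb_norm_leE// ltW.
have l1B : l1norm mu \1_B = ((2 * delta) ^+ N)%:E by rewrite l1norm_indic//; exact: muB.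
have triv z : (l1norm mu (fun y => \1_B (y + z) - \1_B y)%R <= (2 * (2 * delta) ^+ N)%:E)%E.
  rewrite (_ : (fun y => _) = (fun y => \1_B (y + z)) \+ (fun y => -1 * \1_B y)); last first.
    by apply/funext => y /=; ring.
  apply: le_trans (l1norm_triangle _ _ _) _ => //; first exact: measurable_funM.
  rewrite (l1normZ mu (-1) mi) normrN1 mul1e (l1norm_shift z mi) l1B.
  by rewrite -EFinD lee_fin; lra.
(* The cubes of sides 2 (delta + |z|) and 2 (delta - |z|) have sides at most 4 delta when |z| <=
   delta; the difference of the sides is 4 |z|. *)
have [K K0 HK] := @exprn_lipschitz N (4 * delta) ltac:(by rewrite mulr_ge0// ltW).
have small z : `|z| <= delta ->
    (l1norm mu (fun y => \1_B (y + z) - \1_B y)%R <= (4 * K * `|z|)%:E)%E.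
  move=> zd; pose Bp := [set x : X | `|x| <= delta + `|z|].
  pose Bm := [set x : X | `|x| <= delta - `|z|].
  have mBp : measurable Bp by exact: measurable_norm_le.
  have mBm : measurable Bm by exact: measurable_norm_le.
  have sub : Bm `<=` Bp.
    by move=> x /= h; apply: (le_trans h); have := normr_ge0 z; lra.
  apply: (@le_trans _ _ (mu (Bp `\` Bm))).
    rewrite -(l1norm_indic mu (measurableD mBp mBm)).
    apply: le_l1norm; [exact: measurable_funB|exact: measurable_indic (measurableD mBp mBm)|].
    move=> y; rewrite [leRHS]ger0_norm// !indicE.
    have [yp|yp] := boolP (y \in Bp `\` Bm).
      by case: (_ \in _); case: (_ \in _); rewrite /= ?subrr ?subr0 ?sub0r ?normrN ?normr0 ?normr1.
    have zy : `|y + z| <= `|y| + `|z| := ler_normD _ _.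
    have yz : `|y| <= `|y + z| + `|z|.
      by rewrite -{1}(addrK z y); exact: ler_normB.
    have [ym|ym] := leP `|y| (delta - `|z|).
      rewrite !mem_set ?subrr ?normr0//; rewrite /B /=; have := normr_ge0 z; lra.
    have [yp'|yp'] := leP `|y| (delta + `|z|).
      move/negP: yp; case; rewrite inE; split => //=.
      by rewrite /Bm /=; apply/negP; rewrite -ltNge.
    by rewrite !memNset ?subrr ?normr0// /B /=; apply/negP; rewrite -ltNge; have := normr_ge0 z; lra.
  have z0 := normr_ge0 z.
  have Bpoo : (mu Bp < +oo)%E by exact: leb_norm_le.
  have eBp : mu Bp = ((2 * (delta + `|z|)) ^+ N)%:E by rewrite leb_norm_leE//; lra.
  have eBm : mu Bm = ((2 * (delta - `|z|)) ^+ N)%:E by rewrite leb_norm_leE//; lra.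
  rewrite measureD// setIidr//.
  rewrite [X in (X - _)%E](_ : _ = ((2 * (delta + `|z|)) ^+ N)%:E); last exact: eBp.
  rewrite [X in (_ - X)%E](_ : _ = ((2 * (delta - `|z|)) ^+ N)%:E); last exact: eBm.
  rewrite -EFinD lee_fin; apply: (le_trans (HK _ _ _ _ _)); try lra.
(* The summands cover in turn |z| <= min(delta, 1), delta < |z| <= 1 and |z| > 1. *)
pose C := 4 * K + 2 * (2 * delta) ^+ N / delta + 2 * (2 * delta) ^+ N.
have q0 : 0 <= 2 * (2 * delta) ^+ N / delta by rewrite divr_ge0 ?mulr_ge0 ?(ltW d0).
exists C; first by rewrite /C; lra.
move=> z; have z0 := normr_ge0 z.
have [z1|z1] := leP `|z| 1; last first.
  by apply: le_trans (triv z) _; rewrite lee_fin mulr1 /C; lra.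
have [zd|zd] := leP `|z| delta.
  apply: le_trans (small z zd) _; rewrite lee_fin ler_wpM2r// /C; lra.
apply: le_trans (triv z) _; rewrite lee_fin.
apply: (@le_trans _ _ (2 * (2 * delta) ^+ N / delta * `|z|)).
  rewrite -mulrA -[leLHS]mulr1 ler_wpM2l//; first by rewrite mulr_ge0.
  by rewrite mulrC ler_pdivlMr// mul1r ltW.
by rewrite ler_wpM2r// /C; lra.
Qed.

End ball_measure.

(** The second difference of [h] at [x] is the increment, from x - z to x, of the first difference
    [r]. *)
Lemma second_difference_increment {R : realType} {N : nat} (h r : 'rV[R]_N -> R) x z K :
  (forall y, r y = h (y + z) - h y) -> `|r (x - z + z) - r (x - z)| <= K ->
  `|(h (x + z) - h x) + (h (x - z) - h x)| <= K.
Proof.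
move=> hr; rewrite !hr subrK; congr (`|_| <= _); ring.
Qed.

Lemma jump_avg_increment {R : realType} {N : nat}
    (nu : {finite_measure set 'rV[R]_N -> \bar R}) (W : 'rV[R]_N -> R) C y z :
  measurable_fun setT W -> (forall x, `|W x| <= C) ->
  jump_avg nu (fun x => W (x + z) - W x) y = jump_avg nu W (y + z) - jump_avg nu W y.
Proof.
move=> mW WC; have i1 := Rintegrable_shiftl nu (y + z) mW WC.
have i2 := Rintegrable_shiftl nu y mW WC.
rewrite /jump_avg -RintegralB//.
by apply: eq_Rintegral => w _; rewrite addrAC.
Qed.

(* Symmetrizing in [z] replaces first differences by second ones. *)
Lemma discrete_op_second_difference {R : realType} {N : nat}
    (nu : {finite_measure set 'rV[R]_N -> \bar R}) (h : 'rV[R]_N -> R) (C K Lam : R) (x : 'rV[R]_N) :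
  (forall A : set 'rV[R]_N, measurable A -> nu (-%R @^-1` A) = nu A) ->
  measurable_fun setT h -> (forall x, `|h x| <= C) -> 0 <= K ->
  (forall z, `|(h (x + z) - h x) + (h (x - z) - h x)| <= K * Num.min (`|z| ^+ 2) 1) ->
  \int[nu]_z Num.min (`|z| ^+ 2) 1 <= Lam ->
  `|discrete_op nu h x| <= K * Lam.
Proof.
move=> nuN mh hC K0 second hLam.
pose F (z : 'rV[R]_N) := h (x + z) - h x.
have mF : measurable_fun setT F by apply: measurable_funB => //; exact: measurable_shiftl.
have FC z : `|F z| <= C + C by apply: (le_trans (ler_normB _ _)); apply: lerD; exact: hC.
have mFN : measurable_fun setT (fun z : 'rV[R]_N => F (- z)) by exact: (measurableT_comp mF (@measurable_oppV R N)).
have iF := Rintegrable_bounded nu mF FC.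
have iFN : Rintegrable nu (fun z : 'rV[R]_N => F (- z)) := Rintegrable_bounded nu mFN (fun z => FC (- z)).
have mnorm : measurable_fun setT (fun z : 'rV[R]_N => Num.min (`|z| ^+ 2) 1).
  apply: measurable_minr => //; apply: measurable_funX; exact: measurable_rV_norm.
have imin : Rintegrable nu (fun z : 'rV[R]_N => Num.min (`|z| ^+ 2) 1).
  apply: (Rintegrable_bounded (C := 1) nu mnorm) => z.
  by rewrite ger0_norm ?ge_min ?lexx ?orbT// le_min ler01 exprn_ge0.
have E : 2 * discrete_op nu h x = \int[nu]_z (F z + F (- z)).
  rewrite RintegralD// (Rintegral_opp nuN mF) /discrete_op -/F; ring.
have : `|2 * discrete_op nu h x| <= K * Lam.
  rewrite E; have iFF := RintegrableD iF iFN.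
  apply: (le_trans (le_normr_Rintegral measurableT iFF)).
  apply: (@le_trans _ _ (\int[nu]_z (K * Num.min (`|z| ^+ 2) 1))).
    apply: le_Rintegral => //; first exact: (Rintegrable_norm iFF).
      exact: RintegrableZ imin.
    by move=> z _; exact: second.
  by rewrite RintegralZl// ler_wpM2l.
apply: le_trans; rewrite normrM (ger0_norm (x := 2))//.
by have := normr_ge0 (discrete_op nu h x); lra.
Qed.

Section mollifier.
Context {R : realType} {N : nat}.
Notation X := 'rV[R]_N.
Notation mu := (@leb R N).
Variable delta : R.
Hypothesis d0 : 0 < delta.
Let B := [set x : X | `|x| <= delta].

(* Averaging is [jump_avg] for a finite measure, so that it commutes with the discrete
   operators by Fubini's theorem. *)
Definition ball_restr : {finite_measure set X -> \bar R} :=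
  mfrestr (@measurable_norm_le R N delta) (@leb_norm_le R N delta).
Notation rho := ball_restr.
Notation A := (jump_avg rho).

Lemma mass_ball_restr : mass rho = (2 * delta) ^+ N.
Proof.
by rewrite /mass /= /mfrestr /mrestr setTI leb_norm_leE// ltW.
Qed.

Lemma mass_ball_restr_gt0 : 0 < mass rho.
Proof. by rewrite mass_ball_restr exprn_gt0// mulr_gt0. Qed.

Let mB : measurable B. Proof. exact: measurable_norm_le. Qed.

Let rhoC0 : rho (~` B) = 0%E.
Proof. by rewrite /= /mfrestr /mrestr setICl measure0. Qed.

Lemma ae_ball_restr : {ae rho, forall z, `|z| <= delta}.
Proof.
exists (~` B); split => //; first exact: measurableC.
Qed.

Lemma Rintegral_ball_restr (f : X -> R) C : measurable_fun setT f -> (forall x, `|f x| <= C) ->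
  \int[rho]_y f y = \int[mu]_y (f y * \1_B y).
Proof.
move=> mf fC; have irho := Rintegrable_bounded rho mf fC.
rewrite /Rintegral; congr fine.
rewrite (negligible_integral (measurableC mB) measurableT irho rhoC0) setTD setCK.
rewrite (@eq_measure_integral _ _ _ _ mu); last first.
  by move=> D mD DB /=; rewrite /mfrestr /mrestr setIidl.
rewrite integral_mkcond; apply: eq_integral => x _.
by rewrite patchE indicE; case: (x \in B); rewrite /= ?mulr1 ?mulr0.
Qed.

(** A change of variables moves the shift from [g] to the indicator of the ball, whose L^1 modulus
    is linear. *)
Lemma jump_avg_ball_lipschitz : exists2 C1, 0 <= C1 & forall (g : X -> R) (C : R) (x z : X),
  measurable_fun setT g -> (forall x, `|g x| <= C) ->
  `|A g (x + z) - A g x| <= C1 * C * Num.min `|z| 1.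
Proof.
have [C1 C10 HC] := l1norm_ball_shift (N := N) d0; exists C1 => // g C x z mg gC.
have C0 : 0 <= C by exact: le_trans (gC 0).
have mi : measurable_fun setT (\1_B : X -> R) by exact: measurable_indic.
have iB : Rintegrable mu \1_B by exact: integrable_indic_fin mB (leb_norm_le delta).
have iBz := integrable_shift (- z) iB.
have mgx (y : X) : measurable_fun setT (fun z : X => g (y + z)) by exact: measurable_shiftl.
have int1 : Rintegrable mu (fun y => \1_B (y - z) * g (x + y)).
  exact: Rintegrable_mul_bounded (mgx x) (fun y => gC (x + y)) iBz.
have int2 : Rintegrable mu (fun y => \1_B y * g (x + y)).
  exact: Rintegrable_mul_bounded (mgx x) (fun y => gC (x + y)) iB.
have -> : A g (x + z) = \int[mu]_y (\1_B (y - z) * g (x + y)).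
  rewrite /jump_avg (@Rintegral_ball_restr _ C)// /Rintegral.
  rewrite -(integral_shift z (f := fun y => (\1_B (y - z) * g (x + y))%:E)).
    by congr fine; apply: eq_integral => y _; rewrite addrK mulrC addrA addrAC.
  by apply/measurable_EFinP; exact: (Rintegrable_measurable int1).
have -> : A g x = \int[mu]_y (\1_B y * g (x + y)).
  rewrite /jump_avg (@Rintegral_ball_restr _ C)//.
  by apply: eq_Rintegral => y _; rewrite mulrC.
rewrite -RintegralB//.
have int3 := RintegrableB int1 int2.
apply: le_trans (le_normr_Rintegral _ int3) _ => //.
have int4 := RintegrableB iBz iB.
apply: (@le_trans _ _ (\int[mu]_y (C * `|\1_B (y - z) - \1_B y|))).
  apply: le_Rintegral => //; first exact: Rintegrable_norm.
    exact: (RintegrableZ C (Rintegrable_norm int4)).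
  by move=> y _; rewrite -mulrBl normrM mulrC ler_wpM2r.
rewrite RintegralZl//; last exact: (Rintegrable_norm int4).
rewrite (mulrC C1) -mulrA ler_wpM2l// -lee_fin (Rintegral_l1norm int4).
by apply: le_trans (HC (- z)) _; rewrite normrN.
Qed.

Section commutation.
Variable nu : {finite_measure set X -> \bar R}.
Hypothesis nuN : forall A : set X, measurable A -> nu (-%R @^-1` A) = nu A.

Lemma jump_avg_comm (g : X -> R) C x : measurable_fun setT g -> (forall x, `|g x| <= C) ->
  A (jump_avg nu g) x = jump_avg nu (A g) x.
Proof.
move=> mg gC.
have ip : Rintegrable (rho \x nu)%E (fun p : X * X => g (x + p.1 + p.2)).
  apply: (@le_Rintegrable_prod _ _ _ _ _ rho nu _ (cst C) (cst 1)).
  - under eq_fun do rewrite -addrA.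
    exact: (measurable_shift2 (measurable_shiftl x mg)).
  - exact: Rintegrable_cst_finite.
  - exact: Rintegrable_cst_finite.
  - move=> y z /=; rewrite normr1 mulr1; apply: (le_trans (gC _)); exact: ler_norm.
rewrite /jump_avg (Rfubini ip) /=; apply: eq_Rintegral => z _.
by apply: eq_Rintegral => y _; rewrite addrAC.
Qed.

(** Each average contributes one factor C1 min(|z|, 1): the inner one bounds the increment [r] of
    [A g], the outer one the increment of [A r], which is a second difference of [A (A g)]. *)
Lemma norm_discrete_op_levy (g : X -> R) (C C1 Lam : R) (x : X) :
  0 <= C1 -> measurable_fun setT g -> (forall x, `|g x| <= C) ->
  (forall (g : X -> R) (C : R) (x z : X), measurable_fun setT g -> (forall x, `|g x| <= C) ->
    `|A g (x + z) - A g x| <= C1 * C * Num.min `|z| 1) ->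
  \int[nu]_z Num.min (`|z| ^+ 2) 1 <= Lam ->
  `|discrete_op nu (A (A g)) x| <= C1 ^+ 2 * C * Lam.
Proof.
move=> C10 mg gC hA hLam.
have C0 : 0 <= C by exact: le_trans (gC 0).
have mA := measurable_jump_avg rho mg gC.
have AC y := norm_jump_avg rho y mg gC.
apply: (discrete_op_second_difference nuN (measurable_jump_avg rho mA AC)
  (fun y => norm_jump_avg rho y mA AC)) => // [|z]; first by rewrite mulr_ge0// exprn_ge0.
pose r y := A g (y + z) - A g y.
have mr : measurable_fun setT r.
  by apply: measurable_funB; [exact: measurable_fun_shift|exact: mA].
have rC y : `|r y| <= C1 * C * Num.min `|z| 1 by exact: hA.
have Ar y : A r y = A (A g) (y + z) - A (A g) y.
  exact: (jump_avg_increment rho y z mA AC).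
apply: (second_difference_increment Ar); apply: (le_trans (hA _ _ (x - z) z mr rC)).
have z0 := normr_ge0 z.
have m0 : 0 <= Num.min `|z| 1 by rewrite le_min z0 ler01.
rewrite (_ : C1 * (C1 * C * Num.min `|z| 1) * Num.min `|z| 1 =
  C1 ^+ 2 * C * (Num.min `|z| 1 * Num.min `|z| 1)); last by ring.
rewrite ler_wpM2l//; first by rewrite mulr_ge0// exprn_ge0.
rewrite le_min; apply/andP; split.
  by rewrite expr2 ler_pM// ge_min lexx.
by rewrite -[leRHS](mulr1 1) ler_pM// ge_min lexx orbT.
Qed.

Lemma discrete_op_comm (g : X -> R) C x : measurable_fun setT g -> (forall x, `|g x| <= C) ->
  A (discrete_op nu g) x = discrete_op nu (A g) x.
Proof.
move=> mg gC; have mA := measurable_jump_avg rho mg gC.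
have AC y := norm_jump_avg rho y mg gC.
rewrite (discrete_opE nu x mA AC) -(jump_avg_comm x mg gC).
have mJ := measurable_jump_avg nu mg gC; have JC y := norm_jump_avg nu y mg gC.
have i1 := Rintegrable_shiftl rho x mJ JC.
have i2 := Rintegrable_shiftl rho x mg gC.
rewrite /jump_avg -/(jump_avg nu g) -RintegralZl// -RintegralB//; last exact: RintegrableZ.
by apply: eq_Rintegral => z _; rewrite (discrete_opE nu _ mg gC).
Qed.

End commutation.

(** Restricted Lebesgue measure ignores null sets whatever the base point; averaging thus turns
    relations valid almost everywhere into pointwise ones. *)
Lemma jump_avg_ae (g g' : X -> R) : measurable_fun setT g -> measurable_fun setT g' ->
  {ae mu, forall x, g x = g' x} -> forall x, A g x = A g' x.
Proof.
move=> mg mg' gg x; apply: ae_eq_Rintegral; try exact: measurable_shiftl.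
have [D [mD D0 hD]] := ae_shift x gg; exists D; split => //.
  rewrite /= /mfrestr /mrestr; apply: (subset_measure0 _ _ _ D0) => //.
    exact: measurableI.
by move=> z /= h; apply: hD => /=; rewrite addrC.
Qed.

Lemma l1norm_jump_avg (v : X -> R) : Rintegrable mu v ->
  Rintegrable mu (A v) /\ (l1norm mu (A v) <= (mass rho)%:E * l1norm mu v)%E.
Proof.
move=> iv; have iS := Rintegrable_sum rho iv; have iA := Rintegrable1 iS.
split => //; have ian := Rintegrable_norm iv; have iSn := Rintegrable_sum rho ian.
rewrite -!Rintegral_l1norm// -EFinM lee_fin -(Rintegral_sum rho ian) -(Rintegral12 iSn) /=.
rewrite -lee_fin (Rintegral_l1norm iA).
have mR := Rintegrable_measurable (Rintegrable1 iSn).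
have -> : (\int[mu]_x \int[rho]_y `|v (x + y)|)%:E = l1norm mu (fun x => \int[rho]_y `|v (x + y)|)%R.
  rewrite -Rintegral_l1norm; last exact: Rintegrable1 iSn.
  by congr (_%:E); apply: eq_Rintegral => x _; rewrite ger0_norm// Rintegral_ge0.
apply: ae_le_l1norm => //; first exact: Rintegrable_measurable iA.
apply: ae_imply (ae_integrable1 iS) => x ix /=.
rewrite [leRHS]ger0_norm; last exact: Rintegral_ge0.
exact: le_normr_Rintegral ix.
Qed.

(** The difference is the integral over the ball of the increments of [v], and Tonelli's theorem
    exchanges this integral with the L^1 norm. The factor [mass rho] replaces a division by the
    volume. *)
Lemma l1norm_jump_avgB (v : X -> R) e : Rintegrable mu v -> 
  (forall z : X, `|z| <= delta -> (l1norm mu (fun x => v (x + z) - v x)%R <= e%:E)%E) ->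
  (l1norm mu (fun x => A v x - mass rho * v x)%R <= (mass rho * e)%:E)%E.
Proof.
move=> iv ve; have mv := Rintegrable_measurable iv.
have iP := RintegrableB (Rintegrable_sum rho iv) (Rintegrable_fst rho iv).
have e0 : 0 <= e.
  have h := ve 0; rewrite normr0 in h.
  by rewrite -lee_fin; apply: le_trans (h (ltW d0)); exact: l1norm_ge0.
have AE : {ae mu, forall x, A v x - mass rho * v x = \int[rho]_z (v (x + z) - v x)}.
  apply: ae_imply (ae_integrable1 (Rintegrable_sum rho iv)) => x ix.
  rewrite RintegralB//; first by rewrite Rintegral_cst_finite.
  exact: Rintegrable_cst_finite.
have mA := Rintegrable_measurable (l1norm_jump_avg iv).1.
have mR := Rintegrable_measurable (Rintegrable1 iP).
rewrite (ae_eq_l1norm _ mR AE); last by apply: measurable_funB => //; exact: measurable_funM.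
have mabs : measurable_fun setT (fun p : X * X => `|v (p.1 + p.2) - v p.1|%:E).
  by apply: measurable_abs_EFin; exact: Rintegrable_measurable iP.
apply: (@le_trans _ _ (\int[mu]_x \int[rho]_z `|v (x + z)%R - v x|%:E)%E).
  apply: ae_ge0_le_integral => //.
  - exact: measurable_abs_EFin.
  - by move=> x _; exact: integral_ge0.
  - exact: (measurable_fun_fubini_tonelli_F _ mabs).
  apply: ae_imply (ae_integrable1 iP) => x ix _.
  rewrite EFin_normr_Rintegral//; apply: le_trans (le_abse_integral _ _ _) _ => //.
  by apply/measurable_EFinP; exact: Rintegrable_measurable ix.
rewrite (fubini_tonelli (fun p : X * X => `|v (p.1 + p.2)%R - v p.1|%:E))//=.
apply: (@le_trans _ _ (\int[rho]_z (e%:E))%E).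
  apply: ae_ge0_le_integral => //.
  - by move=> z _; exact: integral_ge0.
  - exact: (measurable_fun_fubini_tonelli_G _ mabs).
  by apply: ae_imply ae_ball_restr => z zd _; exact: ve.
rewrite integral_cst// EFinM muleC; apply: lee_wpmul2r; rewrite ?lee_fin//.
by rewrite /mass fineK// fin_num_measure.
Qed.

End mollifier.

(** * Iterated steps *)

Section truncation.
Context {R : realType} {N : nat}.
Notation X := 'rV[R]_N.
Notation mu := (@leb R N).

(** Provides a representative bounded at every point, as the pointwise formulas for jump operators
    require; it changes nothing almost everywhere once |w| <= M holds almost everywhere. *)
Definition trunc (M : R) (w : X -> R) (x : X) : R := if `|w x| <= M then w x else 0.

Lemma measurable_trunc M w : measurable_fun setT w -> measurable_fun setT (trunc M w).
Proof.
move=> mw; apply: measurable_fun_ifT => //; apply: measurable_fun_ler => //.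
exact: measurableT_comp.
Qed.

Lemma norm_trunc M w x : 0 <= M -> `|trunc M w x| <= M.
Proof. by rewrite /trunc; case: ifP => //; rewrite normr0. Qed.

Lemma norm_trunc_le M w x : `|trunc M w x| <= `|w x|.
Proof. by rewrite /trunc; case: ifP => //; rewrite normr0. Qed.

Lemma Rintegrable_trunc M w : Rintegrable mu w -> Rintegrable mu (trunc M w).
Proof.
move=> iw; apply: (le_Rintegrable _ iw) => [|x]; last exact: norm_trunc_le.
by apply: measurable_trunc; exact: Rintegrable_measurable iw.
Qed.

Lemma ae_trunc M w : {ae mu, forall x, `|w x| <= M} -> {ae mu, forall x, trunc M w x = w x}.
Proof. by apply: ae_imply => x; rewrite /trunc => ->. Qed.

Variable nu : {finite_measure set X -> \bar R}.

(** As [nu] may be singular, the null set [E] cannot be neglected at a given [x]. But the integral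
    over [x] of the [nu]-measure of E - x is mass times the measure of [E], so for almost every [x]
    the jumps avoid [E] almost surely. *)
Lemma discrete_op_ae (W W' : X -> R) : measurable_fun setT W -> measurable_fun setT W' ->
  {ae mu, forall x, W x = W' x} ->
  {ae mu, forall x, discrete_op nu W x = discrete_op nu W' x}.
Proof.
move=> mW mW' WW.
pose E := [set x : X | W x != W' x].
have mE : measurable E.
  have mb : measurable [set false] by [].
  have := measurable_fun_eqr mW mW' measurableT mb.
  rewrite setTI; congr (measurable _); apply/seteqP; split => x /=.
    by move=> h; rewrite /E /= h.
  by rewrite /E /= => /negPf ->.
have E0 : mu E = 0%E.
  have [D [mD D0 hD]] := WW; apply: (subset_measure0 mE mD _ D0).
  by move=> x /= /eqP ?; apply: hD.
have Eoo : (mu E < +oo)%E by rewrite E0.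
have iE : Rintegrable mu (\1_E : X -> R) by exact: integrable_indic_fin mE Eoo.
have iS := Rintegrable_sum nu iE.
have iJ := Rintegrable1 iS.
have : {ae mu, forall x, \int[nu]_z (\1_E (x + z) : R) = 0}.
  apply: (ae0_of_Rintegral_le0 iJ) => [x|]; first by apply: Rintegral_ge0.
  rewrite (Rintegral12 iS) (Rintegral_sum nu iE).
  rewrite [X in _ * X](_ : _ = 0) ?mulr0//.
  transitivity (fine (mu E)); last by rewrite E0.
  by rewrite /Rintegral integral_indic// setIT.
move=> h; apply: ae_imply2 WW h => x Wx Ex.
have iEx : Rintegrable nu (fun z => \1_E (x + z) : R).
  apply: (Rintegrable_shiftl nu x (C := 1)); first exact: measurable_indic.
  by move=> y; rewrite indicE; case: (_ \in _); rewrite ?normr0 ?normr1.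
have Ez : {ae nu, forall z, \1_E (x + z) = 0 :> R}.
  by apply: (ae0_of_Rintegral_le0 iEx) => //; rewrite Ex.
apply: ae_eq_Rintegral; try (by apply: measurable_funB => //; exact: measurable_shiftl).
apply: ae_imply Ez => z; rewrite indicE Wx => /eqP; rewrite pnatr_eq0 eqb0 => hz.
by congr (_ - _); apply/eqP; apply/negPn/negP => ne; move/negP: hz; apply; rewrite inE.
Qed.

End truncation.

Lemma ball_avg_step {R : realType} {N : nat} (delta tau C : R) (V W d1 d2 b : 'rV[R]_N -> R) :
  let A := jump_avg (@ball_restr R N delta) in
  measurable_fun setT V -> measurable_fun setT W -> measurable_fun setT d1 ->
  measurable_fun setT d2 -> measurable_fun setT b ->
  (forall x, `|W x| <= C) -> (forall x, `|d1 x| <= C) -> (forall x, `|d2 x| <= C) ->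
  (forall x, `|b x| <= C) ->
  {ae leb N, forall x, V x = W x + tau * (d1 x + d2 x) + b x} ->
  forall y, A V y = A W y + tau * (A d1 y + A d2 y) + A b y.
Proof.
move=> A mV mW md1 md2 mb WC d1C d2C bC VE y; rewrite /A.
have mE : measurable_fun setT (fun x => W x + tau * (d1 x + d2 x) + b x).
  apply: measurable_funD => //; apply: measurable_funD => //; apply: measurable_funM => //.
  exact: measurable_funD.
rewrite (jump_avg_ae delta mV mE VE y).
have iW := Rintegrable_shiftl (@ball_restr R N delta) y mW WC.
have i1 := Rintegrable_shiftl (@ball_restr R N delta) y md1 d1C.
have i2 := Rintegrable_shiftl (@ball_restr R N delta) y md2 d2C.
have i3 := Rintegrable_shiftl (@ball_restr R N delta) y mb bC.
have i12 := RintegrableD i1 i2; have iZ := RintegrableZ tau i12.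
rewrite /jump_avg (RintegralD measurableT (RintegrableD iW iZ) i3).
by rewrite (RintegralD measurableT iW iZ) (RintegralZl _ measurableT i12) (RintegralD measurableT i1 i2).
Qed.

Section scheme_estimates.
Context {R : realType} {N : nat}.
Notation X := 'rV[R]_N.
Notation mu := (@leb R N).
Variables (nu1 nu2 : {finite_measure set X -> \bar R}).
Hypothesis nu1N : forall A : set X, measurable A -> nu1 (-%R @^-1` A) = nu1 A.
Hypothesis nu2N : forall A : set X, measurable A -> nu2 (-%R @^-1` A) = nu2 A.
Variables (phi1 phi2 : R -> R).
Hypotheses (hphi1 : {homo phi1 : r s / r <= s}) (hphi2 : {homo phi2 : r s / r <= s}).
Hypothesis cphi1 : continuous phi1.
Variables (J : nat) (tau beta : nat -> R) (b : nat -> X -> R) (M L : R).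
Hypothesis tau0 : forall j, (j < J)%N -> 0 <= tau j.
Hypothesis ib : forall j, (j < J)%N -> Rintegrable mu (b j).
Hypothesis bbeta : forall j, (j < J)%N -> {ae mu, forall x, `|b j x| <= beta j}.
Hypothesis beta0 : forall j, 0 <= beta j.
Hypothesis M0 : 0 <= M.
Hypothesis hL : forall r s, `|r| <= M -> `|s| <= M -> `|phi2 r - phi2 s| <= L * `|r - s|.
Hypothesis cfl : forall j, (j < J)%N -> tau j * L * mass nu2 <= 1.

(** Here [b j] stands for the source integrated over the time step, not averaged, so that its bounds
    add up to a time integral. *)
Definition step_equation (U : nat -> X -> R) : Prop := forall j, (j < J)%N ->
  {ae mu, forall x, U j.+1 x = U j x + tau j *
    (discrete_op nu1 (phi1 \o U j.+1) x + discrete_op nu2 (phi2 \o U j) x) + b j x}.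

Lemma step_equation_ae (U U' : nat -> X -> R) :
  (forall j, (j <= J)%N -> measurable_fun setT (U j)) ->
  (forall j, (j <= J)%N -> measurable_fun setT (U' j)) ->
  (forall j, (j <= J)%N -> {ae mu, forall x, U j x = U' j x}) ->
  forall j, (j < J)%N ->
  {ae mu, forall x, U j.+1 x = U j x + tau j *
    (discrete_op nu1 (phi1 \o U j.+1) x + discrete_op nu2 (phi2 \o U j) x) + b j x} ->
  {ae mu, forall x, U' j.+1 x = U' j x + tau j *
    (discrete_op nu1 (phi1 \o U' j.+1) x + discrete_op nu2 (phi2 \o U' j) x) + b j x}.
Proof.
move=> mU mU' UU' j jJ UE; have jJ' := ltnW jJ.
have e1 : {ae mu, forall x, discrete_op nu1 (phi1 \o U j.+1) x =
    discrete_op nu1 (phi1 \o U' j.+1) x}.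
  apply: discrete_op_ae; try (by apply: measurable_homo_comp => //; [exact: mU|exact: mU']).
  - exact: measurable_homo_comp hphi1 (mU _ jJ).
  - exact: measurable_homo_comp hphi1 (mU' _ jJ).
  by apply: ae_imply (UU' _ jJ) => x /= ->.
have e2 : {ae mu, forall x, discrete_op nu2 (phi2 \o U j) x =
    discrete_op nu2 (phi2 \o U' j) x}.
  apply: discrete_op_ae.
  - exact: measurable_homo_comp hphi2 (mU _ jJ').
  - exact: measurable_homo_comp hphi2 (mU' _ jJ').
  by apply: ae_imply (UU' _ jJ') => x /= ->.
have e12 := ae_imply2 (fun x a c => conj a c) e1 e2.
have e34 := ae_imply2 (fun x a c => conj a c) (UU' _ jJ) (UU' _ jJ').
apply: ae_imply2 (ae_imply2 (fun x a c => conj a c) e12 e34) UE => x /= [[h1 h2] [h3 h4]].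
by rewrite h1 h2 h3 h4.
Qed.

Lemma step_equation_bound (U : nat -> X -> R) m0 :
  (forall j, (j <= J)%N -> Rintegrable mu (U j)) ->
  (forall j, (j <= J)%N -> exists2 C, 0 <= C & {ae mu, forall x, `|U j x| <= C}) ->
  step_equation U -> 0 <= m0 -> {ae mu, forall x, `|U 0%N x| <= m0} ->
  m0 + \sum_(i < J) beta i <= M ->
  forall j, (j <= J)%N -> {ae mu, forall x, `|U j x| <= M}.
Proof.
move=> iU UC UE m00 U0 hM.
have mU j : (j <= J)%N -> measurable_fun setT (U j) by move=> /iU /Rintegrable_measurable.
suff H j : (j <= J)%N -> {ae mu, forall x, `|U j x| <= m0 + \sum_(i < j) beta i}.
  move=> j jJ; apply: ae_imply (H j jJ) => x h; apply: (le_trans h); apply: le_trans hM.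
  rewrite lerD2l -!(big_mkord xpredT beta) (big_cat_nat (n := j) (p := J)) //= lerDl.
  by apply: sumr_ge0 => i _; exact: beta0.
elim: j => [|j IH] jJ; first by apply: ae_imply U0 => x; rewrite big_ord0 addr0.
have jJ' := ltnW jJ; have {}IH := IH jJ'.
set Mj := m0 + \sum_(i < j) beta i in IH.
have Mj0 : 0 <= Mj by rewrite addr_ge0// sumr_ge0// => i _; exact: beta0.
have MjM : Mj <= M.
  apply: le_trans hM.
  rewrite lerD2l -!(big_mkord xpredT beta) (big_cat_nat (n := j) (p := J)) //= lerDl.
  by apply: sumr_ge0 => i _; exact: beta0.
have [C C0 hC] := UC _ jJ.
(* [U j] is cut at the bound just proved, which keeps it in [-M, M] where [L] applies; [U j.+1] is
   cut at its a priori bound [C], which the implicit estimate then improves to Mj + beta j. *)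
pose V k := if k == j then trunc Mj (U j) else if k == j.+1 then trunc C (U j.+1) else U k.
have Vj : V j = trunc Mj (U j) by rewrite /V eqxx.
have VSj : V j.+1 = trunc C (U j.+1) by rewrite /V eqxx gtn_eqF.
have VU k : (k <= J)%N -> {ae mu, forall x, U k x = V k x}.
  move=> kJ; rewrite /V; case: eqP => [->|_]; last case: eqP => [->|_].
  - by apply: ae_imply (ae_trunc IH) => x ->.
  - by apply: ae_imply (ae_trunc hC) => x ->.
  - exact: aeW.
have mV k : (k <= J)%N -> measurable_fun setT (V k).
  move=> kJ; rewrite /V; case: eqP => [_|_]; last case: eqP => [_|_].
  - exact: measurable_trunc (mU _ jJ').
  - exact: measurable_trunc (mU _ jJ).
  - exact: mU.
have := step_equation_ae mU mV VU jJ (UE _ jJ); rewrite Vj VSj => VE.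
pose G x := trunc Mj (U j) x + tau j * discrete_op nu2 (phi2 \o trunc Mj (U j)) x + b j x.
have h : {ae mu, forall x, `|trunc C (U j.+1) x| <= Mj + beta j}.
  apply: (@implicit_step_norm_le _ _ nu1 nu1N phi1 _ G (tau j) _ C hphi1) => //.
  - exact: Rintegrable_trunc (iU _ jJ).
  - by move=> x; exact: norm_trunc.
  - exact: tau0.
  - by rewrite addr_ge0.
  - by apply: ae_imply VE => x e; rewrite {1}e /G; ring.
  - apply: ae_imply (bbeta jJ) => x bx; apply: (le_trans (ler_normD _ _)); apply: lerD => //.
    apply: (@explicit_step_norm_le _ _ nu2 phi2 _ _ L) => //.
    + exact: measurable_trunc (mU _ jJ').
    + by move=> y; exact: norm_trunc.
    + by move=> r s rM sM; apply: hL; exact: le_trans MjM.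
    + exact: tau0.
    + exact: cfl.
rewrite big_ord_recr /= addrA -/Mj.
by apply: ae_imply2 h (ae_trunc hC) => x + e; rewrite e.
Qed.

Section bounded_solution.
Variable U : nat -> X -> R.
Hypothesis iU : forall j, (j <= J)%N -> Rintegrable mu (U j).
Hypothesis UM : forall j x, (j <= J)%N -> `|U j x| <= M.
Hypothesis UE : step_equation U.

Lemma step_equation_translation (xi : X) j : (j <= J)%N ->
  (l1norm mu (fun x => U j (x + xi) - U j x)%R <=
   l1norm mu (fun x => U 0%N (x + xi) - U 0%N x)%R +
   \sum_(i < j) l1norm mu (fun x => b i (x + xi) - b i x)%R)%E.
Proof.
elim: j => [|j IH] jJ; first by rewrite big_ord0 adde0.
have jJ' := ltnW jJ; rewrite big_ord_recr /= addeA.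
apply: (@le_trans _ _ (l1norm mu (fun x => U j (x + xi) - U j x)%R +
   l1norm mu (fun x => b j (x + xi) - b j x)%R)%E); last by apply: leeD => //; exact: IH.
have iUj := iU jJ'; have iUxj : Rintegrable mu (fun x => U j (x + xi)) := integrable_shift xi iUj.
have iUSj := iU jJ; have iUxSj : Rintegrable mu (fun x => U j.+1 (x + xi)) := integrable_shift xi iUSj.
have ibj := ib jJ; have ibxj : Rintegrable mu (fun x => b j (x + xi)) := integrable_shift xi ibj.
have [iG hG] := explicit_step_l1norm hphi2 iUxj iUj (fun x => UM (x + xi) jJ')
  (fun x => UM x jJ') hL (tau0 jJ) (cfl jJ).
have iB := RintegrableB ibxj ibj.
set G := (fun x => _) in iG hG.
apply: (@le_trans _ _ (l1norm mu (fun x => G x + (b j (x + xi) - b j x))%R)).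
  apply: (implicit_step_l1norm nu1N hphi1 cphi1 iUxSj iUSj (RintegrableD iG iB)
     (fun x => UM (x + xi) jJ) (fun x => UM x jJ) (tau0 jJ)).
  have shiftE nu (W : X -> R) x : discrete_op nu W (x + xi) =
      discrete_op nu (fun y => W (y + xi)) x.
    by rewrite /discrete_op; apply: eq_Rintegral => z _; rewrite addrAC.
  apply: ae_imply2 (UE jJ) (ae_shift xi (UE jJ)) => x h1 h2.
  rewrite {1}h2 {1}h1 /G !shiftE; ring.
apply: (le_trans (l1norm_triangle _ (Rintegrable_measurable iG) (Rintegrable_measurable iB))).
exact: leeD.
Qed.

Lemma step_equation_time delta C1 B1 B2 Lam j x : 0 < delta -> 0 <= C1 ->
  (forall (g : X -> R) (C : R) (x z : X), measurable_fun setT g -> (forall x, `|g x| <= C) ->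
    `|jump_avg (@ball_restr R N delta) g (x + z) - jump_avg (@ball_restr R N delta) g x|
      <= C1 * C * Num.min `|z| 1) ->
  (forall r, `|r| <= M -> `|phi1 r| <= B1) -> (forall r, `|r| <= M -> `|phi2 r| <= B2) ->
  \int[nu1]_z Num.min (`|z| ^+ 2) 1 <= Lam -> \int[nu2]_z Num.min (`|z| ^+ 2) 1 <= Lam ->
  (j < J)%N ->
  `|jump_avg (@ball_restr R N delta) (jump_avg (@ball_restr R N delta) (U j.+1)) x -
    jump_avg (@ball_restr R N delta) (jump_avg (@ball_restr R N delta) (U j)) x| <=
    tau j * (C1 ^+ 2 * (B1 + B2) * Lam) + mass (@ball_restr R N delta) ^+ 2 * beta j.
Proof.
move=> d0 C10 hA hB1 hB2 hL1 hL2 jJ; have jJ' := ltnW jJ.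
set rho := (@ball_restr R N delta) in hA *; pose A := jump_avg rho.
have bt := beta0 j.
pose b' := trunc (beta j) (b j).
have mV := Rintegrable_measurable (iU jJ); have mW := Rintegrable_measurable (iU jJ').
have mb' : measurable_fun setT b' := measurable_trunc _ (Rintegrable_measurable (ib jJ)).
have b'C x' : `|b' x'| <= beta j by exact: norm_trunc.
pose g1 := phi1 \o U j.+1; pose g2 := phi2 \o U j.
have mg1 : measurable_fun setT g1 := measurable_homo_comp hphi1 mV.
have mg2 : measurable_fun setT g2 := measurable_homo_comp hphi2 mW.
have g1B y : `|g1 y| <= B1 by apply: hB1; exact: UM.
have g2B y : `|g2 y| <= B2 by apply: hB2; exact: UM.
have B10 : 0 <= B1 := le_trans (normr_ge0 _) (g1B 0).
have B20 : 0 <= B2 := le_trans (normr_ge0 _) (g2B 0).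
have m10 := mass_ge0 nu1; have m20 := mass_ge0 nu2; have r0 := mass_ge0 rho.
have VE : {ae mu, forall x, U j.+1 x = U j x + tau j *
    (discrete_op nu1 g1 x + discrete_op nu2 g2 x) + b' x}.
  by apply: ae_imply2 (UE jJ) (ae_trunc (bbeta jJ)) => y e1 e2; rewrite {1}e1 /b' e2.
(* A crude common bound, for integrability only: the masses in it may grow as h -> 0+ and do not
   reach the conclusion. *)
pose C := M + 2 * mass nu1 * B1 + 2 * mass nu2 * B2 + beta j.
have p1 : 0 <= 2 * mass nu1 * B1 by rewrite !mulr_ge0.
have p2 : 0 <= 2 * mass nu2 * B2 by rewrite !mulr_ge0.
have M0' := M0.
have WC y : `|U j y| <= C by apply: (le_trans (UM y jJ')); rewrite /C; lra.
have d1C y : `|discrete_op nu1 g1 y| <= C.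
  by apply: (le_trans (norm_discrete_op nu1 y mg1 g1B)); rewrite /C; lra.
have d2C y : `|discrete_op nu2 g2 y| <= C.
  by apply: (le_trans (norm_discrete_op nu2 y mg2 g2B)); rewrite /C; lra.
have bC y : `|b' y| <= C by apply: (le_trans (b'C y)); rewrite /C; lra.
have md1 := measurable_discrete_op nu1 mg1 g1B.
have md2 := measurable_discrete_op nu2 mg2 g2B.
have first := ball_avg_step delta mV mW md1 md2 mb' WC d1C d2C bC VE.
have mA1 := measurable_jump_avg rho md1 d1C; have mA2 := measurable_jump_avg rho md2 d2C.
have mAW := measurable_jump_avg rho mW WC; have mAb := measurable_jump_avg rho mb' bC.
have mAV := measurable_jump_avg rho mV (fun x => UM x jJ).
have second := ball_avg_step delta mAV mAW mA1 mA2 mAb (fun y => norm_jump_avg rho y mW WC)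
  (fun y => norm_jump_avg rho y md1 d1C) (fun y => norm_jump_avg rho y md2 d2C)
  (fun y => norm_jump_avg rho y mb' bC) (aeW _ first) x.
have c1 : jump_avg rho (jump_avg rho (discrete_op nu1 g1)) x =
    discrete_op nu1 (jump_avg rho (jump_avg rho g1)) x.
  rewrite (_ : jump_avg rho (discrete_op nu1 g1) = discrete_op nu1 (jump_avg rho g1)); last first.
    by apply/funext => y; exact: (discrete_op_comm delta nu1 y mg1 g1B).
  exact: (discrete_op_comm delta nu1 x (measurable_jump_avg rho mg1 g1B)
    (fun y => norm_jump_avg rho y mg1 g1B)).
have c2 : jump_avg rho (jump_avg rho (discrete_op nu2 g2)) x =
    discrete_op nu2 (jump_avg rho (jump_avg rho g2)) x.
  rewrite (_ : jump_avg rho (discrete_op nu2 g2) = discrete_op nu2 (jump_avg rho g2)); last first.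
    by apply/funext => y; exact: (discrete_op_comm delta nu2 y mg2 g2B).
  exact: (discrete_op_comm delta nu2 x (measurable_jump_avg rho mg2 g2B)
    (fun y => norm_jump_avg rho y mg2 g2B)).
have k1 := norm_discrete_op_levy nu1N x C10 mg1 g1B hA hL1.
have k2 := norm_discrete_op_levy nu2N x C10 mg2 g2B hA hL2.
have k3 := norm_jump_avg rho x mAb (fun y => norm_jump_avg rho y mb' b'C).
rewrite -c1 in k1; rewrite -c2 in k2.
move: second k1 k2 k3; rewrite -/rho -/A.
set a1 := A (A (discrete_op nu1 g1)) x; set a2 := A (A (discrete_op nu2 g2)) x.
set a3 := A (A b') x; set a4 := A (A (U j)) x; set a5 := A (A (U j.+1)) x.
move: a1 a2 a3 a4 a5 => a1 a2 a3 a4 a5 -> k1 k2 k3.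
rewrite (_ : a4 + tau j * (a1 + a2) + a3 - a4 = tau j * (a1 + a2) + a3); last by ring.
apply: (le_trans (ler_normD _ _)); apply: lerD; last by rewrite expr2 -mulrA.
rewrite normrM (ger0_norm (tau0 jJ)); apply: ler_wpM2l; first exact: tau0.
apply: (le_trans (ler_normD _ _)).
rewrite (_ : C1 ^+ 2 * (B1 + B2) * Lam = C1 ^+ 2 * B1 * Lam + C1 ^+ 2 * B2 * Lam); last by ring.
exact: lerD.
Qed.

End bounded_solution.
End scheme_estimates.

(** * The source term *)

Lemma measurable_set_ltr {d} {Y : measurableType d} {R : realType} (f g : Y -> R) :
  measurable_fun setT f -> measurable_fun setT g -> measurable [set y | f y < g y].
Proof.
move=> mf mg; have mb : measurable [set true] by [].
have := measurable_fun_ltr mf mg measurableT mb; rewrite setTI.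
by rewrite (_ : _ @^-1` _ = [set y | f y < g y]).
Qed.

Lemma measurable_set_neqr {d} {Y : measurableType d} {R : realType} (f g : Y -> R) :
  measurable_fun setT f -> measurable_fun setT g -> measurable [set y | f y != g y].
Proof.
move=> mf mg; have mb : measurable [set false] by [].
have := measurable_fun_eqr mf mg measurableT mb; rewrite setTI.
rewrite (_ : _ @^-1` _ = [set y | f y != g y])//.
by apply/seteqP; split => y /=; [move=> ->|move/negPf].
Qed.

Section null_sections.
Context {d1 d2} {T1 : measurableType d1} {T2 : measurableType d2} {R : realType}.
Variables (m1 : {sigma_finite_measure set T1 -> \bar R})
  (m2 : {sigma_finite_measure set T2 -> \bar R}).

Lemma null_of_ysections (A : set (T1 * T2)) : measurable A ->
  {ae m2, forall y, {ae m1, forall x, ~ A (x, y)}} -> (m1 \x m2)%E A = 0%E.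
Proof.
move=> mA hA.
have mi : measurable_fun setT (EFin \o (\1_A : T1 * T2 -> R)) by exact/measurable_EFinP.
have -> : (m1 \x m2)%E A = (\int[(m1 \x m2)%E]_p (EFin \o \1_A) p)%E.
  by rewrite integral_indic// setIT.
rewrite (fubini_tonelli2 _ mi); last by move=> p; rewrite /= lee_fin.
have mG := measurable_fun_fubini_tonelli_G (m1 := m1) (EFin \o \1_A) mi.
transitivity (\int[m2]_y (cst 0%E y))%E; last by rewrite integral0.
apply: ge0_ae_eq_integral => //.
- by apply: mG => p; rewrite /= lee_fin.
- by move=> y _; apply: integral_ge0 => x _; rewrite /= lee_fin.
apply: ae_imply hA => y hy _; rewrite /fubini_G /=.
transitivity (\int[m1]_x (cst 0%E x))%E; last by rewrite integral0.
apply: ge0_ae_eq_integral => //.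
- exact: (measurableT_comp mi (pair2_measurable y)).
by apply: ae_imply hy => x hx _; rewrite /= indicE memNset.
Qed.

Lemma ae_prod_of_ysections (P : T1 * T2 -> Prop) (A : set (T1 * T2)) : measurable A ->
  (forall p, ~ P p -> A p) ->
  {ae m2, forall y, {ae m1, forall x, ~ A (x, y)}} -> {ae (m1 \x m2)%E, forall p, P p}.
Proof.
move=> mA PA hA; exists A; split => //; first exact: null_of_ysections.
Qed.

(** Exchanges the two almost everywhere quantifiers: the norms of the source control it at almost
    every time, while its time averages are taken at a fixed point of space. *)
Lemma ae_xsections_of_ysections (A : set (T1 * T2)) : measurable A ->
  {ae m2, forall y, {ae m1, forall x, ~ A (x, y)}} ->
  {ae m1, forall x, {ae m2, forall y, ~ A (x, y)}}.
Proof.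
move=> mA hA; have A0 := null_of_ysections mA hA.
have mx : measurable_fun setT (fun x => m2 (xsection A x)) by exact: measurable_fun_xsection.
have : (\int[m1]_x `|m2 (xsection A x)| = 0)%E.
  by rewrite -A0; apply: eq_integral => x _; rewrite gee0_abs.
move/(ae_eq_integral_abs m1 measurableT mx).
apply: ae_imply => x /(_ I) /= x0; exists (xsection A x); split => //.
  exact: measurable_xsection.
by move=> y /= h; apply/xsectionP; apply: contrapT.
Qed.

End null_sections.

Section source.
Context {R : realType} {N : nat}.
Notation X := 'rV[R]_N.
Notation mu := (@leb R N).
Notation lam := (@lebesgue_measure R).
Variables (T : R) (f : X -> R -> R).
Hypothesis hf : source_term T f.

Let D : set (X * measurableTypeR R) := [set: X] `*` `]0, T[%classic.
Let mI : measurable (`]0, T[%classic : set (measurableTypeR R)).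
Proof. exact: measurable_itv. Qed.
Let mD : measurable D. Proof. exact: measurableX. Qed.

(** Extension by zero, the values of [f] outside the open time interval being arbitrary. *)
Let f1 : X * measurableTypeR R -> R := (fun p => f p.1 p.2) \_ D.
Let mf1 : measurable_fun setT f1.
Proof. by apply/(measurable_restrictT _ mD); case: hf. Qed.

Let f1E x t : t \in (`]0, T[%classic : set R) -> f1 (x, t) = f x t.
Proof. by move=> ti; rewrite /f1 patchE mem_set//; split => //=; apply: set_mem. Qed.

Let f10 x t : t \notin (`]0, T[%classic : set R) -> f1 (x, t) = 0.
Proof. by move=> ti; rewrite /f1 patchE memNset// => -[_ /= h]; case/negP: ti; apply/mem_set. Qed.

Let n1 (t : measurableTypeR R) : \bar R := ('N[mu]_+oo [EFin \o (fun x => f1 (x, t))])%E.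
Let s1 (t : measurableTypeR R) : \bar R := ('N[mu]_1 [EFin \o (fun x => f1 (x, t))])%E.

Let mf1t t : measurable_fun setT (fun x : X => f1 (x, t)).
Proof. exact: (measurableT_comp mf1 (pair2_measurable t)). Qed.

Let n1E t : n1 t = ess_sup mu (fun x => `|f1 (x, t)|%:E).
Proof. by rewrite /n1 unlock leb_setT_gt0. Qed.

(** The essential supremum exceeds [r] exactly when the section of [E] at [t] has positive measure,
    and the measure of sections depends measurably on [t]. *)
Let mn1 : measurable_fun setT n1.
Proof.
apply: (measurability _ (ErealGenOInfty.measurableE R)) => _ [_ [r ->] <-].
rewrite setTI.
pose E : set (X * measurableTypeR R) := [set p | r < `|f1 p|].
have mE : measurable E.
  exact: measurable_set_ltr (measurable_cst r) (measurableT_comp (@normr_measurable R setT) mf1).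
have mphi := measurable_fun_ysection mu mE.
have := mphi measurableT _ (emeasurable_itv `]0%E, +oo[); rewrite setTI.
rewrite (_ : (_ @^-1` _) = n1 @^-1` `]r%:E, +oo[)//.
apply/seteqP; split => t /=; rewrite !in_itv/= !andbT => h.
  rewrite ltNge n1E; apply/negP => /ess_supP [B [mB B0 hB]].
  suff : mu (ysection E t) = 0%E by move=> e; rewrite e ltxx in h.
  apply: (subset_measure0 _ mB _ B0); first exact: measurable_ysection.
  move=> x /ysectionP /= xE; apply: hB => /=; rewrite lee_fin; apply/negP; rewrite -ltNge.
  exact: xE.
rewrite lt0e measure_ge0 andbT; apply/eqP => E0; move: h; rewrite ltNge => /negP; apply.
rewrite n1E; apply/ess_supP; exists (ysection E t); split => //.
  exact: measurable_ysection.
by move=> x /= /negP; rewrite lee_fin -ltNge => h; apply/ysectionP.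
Qed.

Let ms1 : measurable_fun setT s1.
Proof.
rewrite (_ : s1 = (fun t => \int[mu]_x `|f1 (x, t)|%:E)%E); last first.
  by apply/funext => t; rewrite /s1 Lnorm1.
apply: (measurable_fun_fubini_tonelli_G (fun p => `|f1 p|%:E)) => //.
exact: measurable_abs_EFin.
Qed.

Let sn_oo : (\int[lam]_t (s1 t + n1 t) < +oo)%E.
Proof.
case: hf => _; rewrite integral_mkcond; congr (_ < _)%E.
apply: eq_integral => t _; rewrite patchE; case: ifPn => ti.
  rewrite /s1 /n1; congr (_ + _)%E; apply: eq_Lnorm => x /=; by rewrite f1E.
rewrite /s1 /n1 (_ : EFin \o (fun x => f1 (x, t)) = cst 0%E); last first.
  by apply/funext => x /=; rewrite f10.
by rewrite !Lnorm0// adde0.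
Qed.

Let n1_ge0 t : (0 <= n1 t)%E. Proof. exact: Lnorm_ge0. Qed.
Let s1_ge0 t : (0 <= s1 t)%E. Proof. exact: Lnorm_ge0. Qed.

Let n1_oo : (\int[lam]_t n1 t < +oo)%E.
Proof.
apply: le_lt_trans sn_oo; apply: ge0_le_integral => //.
- exact: emeasurable_funD.
- by move=> t _; rewrite leeDr.
Qed.

Let s1_oo : (\int[lam]_t s1 t < +oo)%E.
Proof.
apply: le_lt_trans sn_oo; apply: ge0_le_integral => //.
- exact: emeasurable_funD.
- by move=> t _; rewrite leeDl.
Qed.

Let g (t : measurableTypeR R) : R := fine (n1 t).
Let mg : measurable_fun setT g.
Proof. exact: (measurableT_comp (fine_measurable measurableT) mn1). Qed.
Let g_ge0 t : 0 <= g t. Proof. exact: fine_ge0. Qed.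

Let n1_fin : {ae lam, forall t, n1 t \is a fin_num}.
Proof.
have : lam.-integrable setT n1.
  apply/integrableP; split => //; apply: le_lt_trans n1_oo.
  by under eq_integral do rewrite gee0_abs//.
by move/(integrable_ae measurableT); apply: ae_imply => t; apply.
Qed.

Let int_g : (\int[lam]_t (g t)%:E = \int[lam]_t n1 t)%E.
Proof.
apply: ae_eq_integral => //; first exact/measurable_EFinP.
by apply: ae_imply n1_fin => t h _; rewrite /g fineK.
Qed.

Let ig : Rintegrable lam g.
Proof.
apply/integrable_l1norm; split => //; rewrite /l1norm.
by under eq_integral do rewrite ger0_norm//; rewrite int_g.
Qed.

(** Where the norm is infinite, [fine] sets [g] to 0 and hence [F] to 0; this concerns a null set of
    times only. *)
Let F (p : X * measurableTypeR R) : R := if `|f1 p| <= g p.2 then f1 p else 0.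

Let mF : measurable_fun setT F.
Proof.
apply: measurable_fun_ifT => //; apply: measurable_fun_ler.
  exact: measurableT_comp.
exact: (measurableT_comp mg measurable_snd).
Qed.

Let F_f1 : {ae lam, forall t, {ae mu, forall x, F (x, t) = f1 (x, t)}}.
Proof.
apply: ae_imply n1_fin => t h.
have := ess_sup_ge mu (fun x => `|f1 (x, t)|%:E); apply: ae_imply => x.
by rewrite -n1E -(fineK h) lee_fin /F /= => ->.
Qed.

(* [F] is dominated by [g t = |f(., t)|_oo] at every point, not only almost everywhere. *)
Lemma source_representative : exists (F : X * measurableTypeR R -> R) (g : measurableTypeR R -> R),
  [/\ [/\ measurable_fun setT F, forall x t, `|F (x, t)| <= g t,
       Rintegrable lam g & Rintegrable (mu \x lam)%E F],
   {ae mu, forall x, {ae lam, forall t, t \in (`]0, T[%classic : set R) -> f x t = F (x, t)}},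
   forall x, measurable_fun (`]0, T[%classic : set (measurableTypeR R)) (f x) &
   (\int[lam]_(t in `]0%R, T[) 'N[mu]_+oo [EFin \o f^~ t] = (\int[lam]_t g t)%R%:E)%E].
Proof.
exists F, g; split; [split => //| | |].
- by move=> x t; rewrite /F /=; case: ifP => //; rewrite normr0.
- apply/integrable21ltyP; first exact/measurable_EFinP.
  apply: le_lt_trans s1_oo; apply: ge0_le_integral => //.
  + by move=> t _; exact: integral_ge0.
  + apply: (measurable_fun_fubini_tonelli_G (fun p => `|F p|%:E)) => //.
    exact: measurable_abs_EFin.
  + move=> t _; rewrite /s1 Lnorm1; apply: ge0_le_integral => //=.
    * apply: measurable_abs_EFin; exact: (measurableT_comp mF (pair2_measurable t)).
    * by apply: measurable_abs_EFin.
    * by move=> x _; rewrite lee_fin /F; case: ifP => //; rewrite normr0.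
- have : {ae mu, forall x, {ae lam, forall t, ~ [set p | F p != f1 p] (x, t)}}.
    apply: ae_xsections_of_ysections.
      exact: measurable_set_neqr.
    by apply: ae_imply F_f1 => t; apply: ae_imply => x /= ->; rewrite eqxx.
  apply: ae_imply => x; apply: ae_imply => t /= /negP; rewrite negbK => /eqP -> ti.
  by rewrite f1E.
- move=> x.
  have := measurableT_comp mf1 (pair1_measurable x).
  move/(measurable_funS measurableT (@subsetT _ (`]0, T[%classic : set (measurableTypeR R)))).
  by apply: eq_measurable_fun => t ti /=; rewrite f1E.
- rewrite /Rintegral fineK; last by exact: (integrable_fin_num _ ig).
  rewrite int_g integral_mkcond; apply: eq_integral => t _; rewrite patchE; case: ifPn => ti.
    by apply: eq_Lnorm => x /=; rewrite f1E.
  rewrite /n1 (_ : EFin \o (fun x => f1 (x, t)) = cst 0%E) ?Lnorm0//.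
  by apply/funext => x /=; rewrite f10.
Qed.

End source.

(** * Integrals over time cells *)

Section time_integral.
Context {R : realType}.
Notation lam := (@lebesgue_measure R).
Notation Y := (measurableTypeR R).
Implicit Types k : Y -> R.

(* Half-open cells make consecutive indicators add up exactly. *)
Definition cell (a b : R) : set Y := `[a, b[%classic.

Lemma measurable_cell a b : measurable (cell a b).
Proof. exact: measurable_itv. Qed.

Definition time_integral k (b : R) : R := \int[lam]_t (k t * \1_(cell 0 b) t).

Lemma indic_cellB (a b : R) (t : Y) : 0 <= a -> a <= b ->
  \1_(cell 0 b) t - \1_(cell 0 a) t = \1_(cell a b) t :> R.
Proof.
move=> a0 ab; rewrite !indicE !mem_setE !in_itv/=.
case: (leP a t) => ta; case: (ltP t b) => tb; case: (leP 0 t) => t0 /=;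
  rewrite ?subrr ?subr0//; exfalso; move: ta tb t0 a0 ab; rewrite /Y/=; lra.
Qed.

Lemma Rintegrable_mul_indic k (A : set Y) : measurable A -> Rintegrable lam k ->
  Rintegrable lam (fun t => k t * \1_A t).
Proof.
move=> mA ik; have mk := Rintegrable_measurable ik.
apply: le_Rintegrable ik _; first by apply: measurable_funM.
by move=> t; rewrite normrM indicE; case: (t \in A); rewrite ?normr1 ?mulr1// normr0 mulr0.
Qed.

Lemma time_integralB k (a b : R) : Rintegrable lam k -> 0 <= a -> a <= b ->
  time_integral k b - time_integral k a = \int[lam]_t (k t * \1_(cell a b) t).
Proof.
move=> ik a0 ab; have i1 c d := Rintegrable_mul_indic (measurable_cell c d) ik.
rewrite /time_integral -(RintegralB measurableT (i1 0 b) (i1 0 a)).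
by apply: eq_Rintegral => t _; rewrite -mulrBr indic_cellB.
Qed.

Lemma time_integral_le k (a b : R) : Rintegrable lam k -> (forall t, 0 <= k t) ->
  0 <= a -> a <= b -> time_integral k a <= time_integral k b.
Proof.
move=> ik k0 a0 ab; rewrite -subr_ge0 time_integralB//.
by apply: Rintegral_ge0 => t _; rewrite mulr_ge0.
Qed.

Lemma time_integral0 k : time_integral k 0 = 0.
Proof.
rewrite /time_integral; under eq_Rintegral.
  move=> t _; rewrite (_ : cell 0 0 = set0); last first.
    by rewrite /cell; apply/seteqP; split => // s /=; rewrite in_itv/= => /andP[]; lra.
  rewrite indic0 mulr0; over.
by rewrite /Rintegral integral0.
Qed.

Lemma time_integral_le_Rintegral k (a : R) : Rintegrable lam k -> (forall t, 0 <= k t) ->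
  time_integral k a <= \int[lam]_t k t.
Proof.
move=> ik k0; apply: (le_Rintegral measurableT) => //.
  exact: Rintegrable_mul_indic (measurable_cell 0 a) ik.
by move=> t _; rewrite ler_piMr// indicE; case: (_ \in _).
Qed.

(** Absolute continuity of the Lebesgue integral. *)
Lemma time_integral_unif_continuous k : Rintegrable lam k -> (forall t, 0 <= k t) ->
  forall e, 0 < e -> exists2 d, 0 < d & forall a b : R, 0 <= a -> a <= b -> b - a < d ->
    time_integral k b - time_integral k a <= e.
Proof.
move=> ik k0 e e0; have [d [d0 hd]] := integral_normr_continuous ik e0.
exists d => // a b a0; rewrite le_eqVlt => /predU1P[-> _|ab abd]; first by rewrite subrr ltW.
have lE : (lam (cell a b) = (b - a)%:E)%E.
  by rewrite /cell; transitivity (lam `[a, b[%classic)%E => //; rewrite lebesgue_measure_itv/= lte_fin ab.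
rewrite (time_integralB ik a0 (ltW ab)).
have ld : (lam (cell a b) < d%:E)%E by rewrite lE lte_fin.
apply: (@le_trans _ _ (\int[lam]_(x in cell a b) `|k x|)); last exact/ltW/(hd _ (measurable_cell a b) ld).
rewrite [leRHS]Rintegral_mkcond le_eqVlt; apply/orP; left; apply/eqP; apply: eq_Rintegral => t _.
rewrite patchE indicE; case: ifPn => h; first by rewrite mulr1 ger0_norm.
by rewrite mulr0.
Qed.

End time_integral.

(** * The source over a time cell and its modulus in space *)

Section source_cells.
Context {R : realType} {N : nat}.
Notation X := 'rV[R]_N.
Notation Y := (measurableTypeR R).
Notation mu := (@leb R N).
Notation lam := (@lebesgue_measure R).
Variables (F : X * Y -> R) (g : Y -> R).
Hypotheses (mF : measurable_fun setT F) (Fg : forall x t, `|F (x, t)| <= g t)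
  (ig : Rintegrable lam g) (iF : Rintegrable (mu \x lam)%E F).

Definition source_cell (a b : R) (x : X) : R := \int[lam]_t (F (x, t) * \1_(cell a b) t).

Definition source_increment (xi : X) (t : Y) : R := \int[mu]_x `|F (x + xi, t) - F (x, t)|.

Let g0 t : 0 <= g t. Proof. exact: le_trans (Fg 0 t). Qed.

Let mFx x : measurable_fun setT (fun t => F (x, t)).
Proof. exact: (measurableT_comp mF (pair1_measurable x)). Qed.

Let mFt t : measurable_fun setT (fun x => F (x, t)).
Proof. exact: (measurableT_comp mF (pair2_measurable t)). Qed.

Let iFx x : Rintegrable lam (fun t => F (x, t)).
Proof. by apply: le_Rintegrable ig _ => // t; rewrite (ger0_norm (g0 t)). Qed.

Let m1 (a b : R) : measurable_fun setT (fun p : X * Y => \1_(cell a b) p.2 : R).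
Proof.
have h : measurable_fun setT (\1_(cell a b) : Y -> R) by apply: measurable_indic; exact: measurable_cell.
exact: measurableT_comp h measurable_snd.
Qed.

Let mul_indic (G : X * Y -> R) (a b : R) : Rintegrable (mu \x lam)%E G ->
  Rintegrable (mu \x lam)%E (fun p => G p * \1_(cell a b) p.2).
Proof.
move=> iG; have mG := Rintegrable_measurable iG.
apply: le_Rintegrable iG _; first exact: measurable_funM.
move=> p; rewrite normrM indicE; case: (p.2 \in _); rewrite ?normr1 ?mulr1//.
by rewrite normr0 mulr0.
Qed.

Lemma Rintegrable_source_cell a b : Rintegrable mu (source_cell a b).
Proof. exact: Rintegrable1 (mul_indic a b iF). Qed.

Lemma norm_source_cell a b x : 0 <= a -> a <= b ->
  `|source_cell a b x| <= time_integral g b - time_integral g a.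
Proof.
move=> a0 ab; rewrite time_integralB//.
have i1 := Rintegrable_mul_indic (measurable_cell a b) (iFx x).
apply: le_trans (le_normr_Rintegral measurableT i1) _.
apply: (le_Rintegral measurableT).
- exact: Rintegrable_norm i1.
- exact: Rintegrable_mul_indic (measurable_cell a b) ig.
- by move=> t _; rewrite normrM indicE normr_nat ler_wpM2r.
Qed.

Let mFs xi : measurable_fun setT (fun p : X * Y => F (p.1 + xi, p.2)).
Proof.
apply: (measurableT_comp mF); apply/measurable_fun_pairP; split.
  exact: (measurableT_comp (measurable_shift xi) measurable_fst).
exact: measurable_snd.
Qed.

Let iFs xi : Rintegrable (mu \x lam)%E (fun p => F (p.1 + xi, p.2)).
Proof.
apply/integrable21ltyP; first exact/measurable_EFinP.
have mFE : measurable_fun setT (EFin \o F) by exact/measurable_EFinP.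
have := (integrable21ltyP mu lam mFE).1 iF.
apply: le_lt_trans; rewrite le_eqVlt; apply/orP; left; apply/eqP.
apply: eq_integral => t _.
apply: (ge0_integral_shift xi (f := fun x => `|F (x, t)|%:E)) => //.
exact: measurable_abs_EFin.
Qed.

Let iFd xi : Rintegrable (mu \x lam)%E (fun p => `|F (p.1 + xi, p.2) - F p|).
Proof. by apply: Rintegrable_norm; exact: RintegrableB (iFs xi) iF. Qed.

Lemma source_increment_ge0 xi t : 0 <= source_increment xi t.
Proof. by apply: Rintegral_ge0. Qed.

Lemma Rintegrable_source_increment xi : Rintegrable lam (source_increment xi).
Proof. exact: Rintegrable2 (iFd xi). Qed.

Lemma l1norm_source_cell a b xi : 0 <= a -> a <= b ->
  (l1norm mu (fun x => source_cell a b (x + xi) - source_cell a b x)%R <=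
    (time_integral (source_increment xi) b - time_integral (source_increment xi) a)%:E)%E.
Proof.
move=> a0 ab; rewrite (time_integralB (Rintegrable_source_increment xi) a0 ab).
pose G (p : X * Y) : R := `|F (p.1 + xi, p.2) - F p|.
have iG : Rintegrable (mu \x lam)%E (fun p => G p * \1_(cell a b) p.2).
  exact: mul_indic (iFd xi).
have -> : \int[lam]_t (source_increment xi t * \1_(cell a b) t) =
    \int[mu]_x \int[lam]_t (G (x, t) * \1_(cell a b) t).
  rewrite (Rfubini iG) /=; apply: eq_Rintegral => t _.
  rewrite indicE; case: (t \in _); first by rewrite mulr1; apply: eq_Rintegral => x _; rewrite mulr1.
  by rewrite mulr0; under eq_Rintegral do rewrite mulr0; rewrite /Rintegral integral0.
have ic := Rintegrable_source_cell a b.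
have ics : Rintegrable mu (fun x => source_cell a b (x + xi)) by exact: integrable_shift xi _ ic.
rewrite -Rintegral_l1norm; last exact: RintegrableB ics ic.
rewrite lee_fin; apply: (le_Rintegral measurableT).
- by apply: Rintegrable_norm; exact: RintegrableB ics ic.
- exact: Rintegrable1 iG.
move=> x _; have i1 := Rintegrable_mul_indic (measurable_cell a b) (iFx (x + xi)).
have i2 := Rintegrable_mul_indic (measurable_cell a b) (iFx x).
rewrite /source_cell -(RintegralB measurableT i1 i2).
apply: le_trans (le_normr_Rintegral measurableT (RintegrableB i1 i2)) _.
apply: (le_Rintegral measurableT).
- exact: Rintegrable_norm (RintegrableB i1 i2).
- apply: Rintegrable_mul_indic (measurable_cell a b) _.
  exact: Rintegrable_norm (RintegrableB (iFx (x + xi)) (iFx x)).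
- by move=> t _; rewrite -mulrBl normrM indicE normr_nat.
Qed.

(** Dominated convergence in time: at almost every [t] the slice of [F] is integrable, so its
    translations are continuous in L^1, and the increment is at most twice the norm of the slice. *)
Lemma source_increment_small e : 0 < e -> exists2 d, 0 < d & forall xi : X, `|xi| < d ->
  \int[lam]_t source_increment xi t <= e.
Proof.
move=> e0; apply: contrapT => h.
have /choice[xi hxi] : forall n, exists xi : X, `|xi| < n.+1%:R^-1 /\
    e < \int[lam]_t source_increment xi t.
  move=> n; apply: contrapT => h1; apply: h; exists n.+1%:R^-1; first by rewrite invr_gt0.
  by move=> xi xn; rewrite leNgt; apply/negP => h2; apply: h1; exists xi.
have iN : Rintegrable (mu \x lam)%E (fun p => `|F p|) by exact: Rintegrable_norm.
have iG := RintegrableZ 2 (Rintegrable2 iN).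
have aeF : {ae lam, forall t, Rintegrable mu (fun x => F (x, t))} by exact: ae_integrable2 iF.
have := @dct_l1norm_near _ _ _ lam (fun n => source_increment (xi n)) (cst 0)
  (fun t => 2 * \int[mu]_x `|F (x, t)|) _ _ _ iG _ e e0.
move=> /(_ _)/wrap[].
  by move=> n; exact: Rintegrable_measurable (Rintegrable_source_increment _).
move=> /(_ _)/wrap[]; first exact: measurable_cst.
move=> /(_ _)/wrap[].
  apply: ae_imply aeF => t it; apply/cvgrPdist_le => r r0.
  have [d d0 hd] := integrable_l1_translation_continuous it r0.
  have := @near_infty_natSinv_lt R (PosNum d0); apply: filterS => n /= nd.
  rewrite sub0r normrN ger0_norm ?source_increment_ge0//.
  have its : Rintegrable mu (fun x => F (x + xi n, t)) by exact: integrable_shift (xi n) _ it.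
  rewrite -lee_fin /source_increment (Rintegral_l1norm (RintegrableB its it)).
  by apply: hd; exact: lt_trans (hxi n).1 nd.
move=> /(_ _)/wrap[].
  apply: ae_imply aeF => t it n; rewrite ger0_norm ?source_increment_ge0//.
  have its : Rintegrable mu (fun x => F (x + xi n, t)) by exact: integrable_shift (xi n) _ it.
  have in1 := Rintegrable_norm it; have in2 := Rintegrable_norm its.
  have -> : 2 * \int[mu]_x `|F (x, t)| = \int[mu]_x (`|F (x + xi n, t)| + `|F (x, t)|).
    rewrite (RintegralD measurableT in2 in1) mulr_natl mulr2n; congr (_ + _).
    apply: EFin_inj; rewrite (Rintegral_l1norm it) (Rintegral_l1norm its).
    by rewrite (l1norm_shift (xi n) (w := fun x => F (x, t))).
  apply: (le_Rintegral measurableT).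
  - exact: Rintegrable_norm (RintegrableB its it).
  - exact: RintegrableD.
  - by move=> x _; exact: ler_normB.
case=> n _ /(_ n (leqnn n)) /=.
have ii := Rintegrable_source_increment (xi n).
rewrite (_ : (fun x => _) = source_increment (xi n)); last by apply/funext => t; rewrite subr0.
rewrite -(Rintegral_l1norm ii) lee_fin leNgt => /negP; apply.
rewrite (_ : Rintegral _ _ _ = \int[lam]_t source_increment (xi n) t); first exact: (hxi n).2.
by apply: eq_Rintegral => t _; rewrite ger0_norm ?source_increment_ge0.
Qed.

End source_cells.

(** * Compactness *)

Lemma fmap_ultra {I Z : Type} (G : set_system I) (a : I -> Z) :
  UltraFilter G -> UltraFilter (a @ G).
Proof.
move=> UG; split=> [|H PH GH]; first exact: fmap_proper_filter.
apply/seteqP; split => // B HB.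
have [//|nB] := in_ultra_setVsetC (a @^-1` B) UG.
have : H (~` B) by exact: GH.
by move=> /(filterI HB); rewrite setICr => /filter_not_empty.
Qed.

(* Arzela-Ascoli along an ultrafilter, where equicontinuity is only asymptotic. *)
Lemma ultra_cauchy_uniform {R : realType} {I : Type} {Z : topologicalType} (G : set_system I)
    (K : set Z) (a : I -> Z -> R) (C : R) : UltraFilter G -> compact K ->
  (\forall i \near G, forall z, K z -> `|a i z| <= C) ->
  (forall z (e : R), K z -> 0 < e -> \forall z' \near z & i \near G, K z' -> `|a i z' - a i z| <= e) ->
  forall e : R, 0 < e ->
  exists2 E, G E & forall i j z, E i -> E j -> K z -> `|a i z - a j z| <= e.
Proof.
move=> UG cK aC ae e e0.
have e4 : 0 < e / 4 by rewrite divr_gt0.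
(* On the compact [-C, C] the image ultrafilter converges, so limits exist at all points
   simultaneously and no subsequence is extracted. *)
have cvga z : K z -> exists l : R, \forall i \near G, `|a i z - l| <= e / 4.
  move=> Kz.
  have : compact (`[- C, C]%classic : set R) by exact: segment_compact.
  rewrite compact_ultra => /(_ (a ^~ z @ G) (fmap_ultra _ UG))/(_ _)/wrap[].
    by apply: filterS aC => i /(_ z Kz); rewrite /= in_itv/= ler_norml.
  case=> l [_ /cvgrPdist_le/(_ _ e4) h].
  by exists l; apply: filterS h => i /=; rewrite distrC.
(* Near each [z] the distance between two members splits into four parts of size e / 4, passing
   through [z] and the limit there; compactness of [K] makes the choice uniform. *)
have near_cauchy : \forall ij \near filter_prod G G, K `<=` (fun z => `|a ij.1 z - a ij.2 z| <= e).
  move/compact_near_coveringP/near_covering_withinP : cK; apply => z Kz.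
  have [l hl] := cvga z Kz.
  have [[V E] /= [Vz GE] hVE] := ae z (e / 4) Kz e4.
  exists (V, (E `&` [set i | `|a i z - l| <= e / 4]) `*` (E `&` [set i | `|a i z - l| <= e / 4])).
    split => //=; exists (E `&` [set i | `|a i z - l| <= e / 4],
      E `&` [set i | `|a i z - l| <= e / 4]) => //=; split; exact: filterI.
  move=> [z' [i j]] /= [Vz' [[Ei il] [Ej jl]]] Kz'.
  have := hVE (z', i) (conj Vz' Ei) Kz'; have := hVE (z', j) (conj Vz' Ej) Kz'.
  move=> /=; move: il jl; rewrite !ler_norml => /andP[? ?] /andP[? ?] /andP[? ?] /andP[? ?].
  by apply/andP; split; lra.
case: near_cauchy => -[E1 E2] /= [G1 G2] h; exists (E1 `&` E2); first exact: filterI.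
by move=> i j z [Ei _] [_ Ej] Kz; exact: (h (i, j)).
Qed.

(** * Recovering L^1 distances from averaged functions *)

Section mollified_control.
Context {R : realType} {N : nat}.
Notation X := 'rV[R]_N.
Notation mu := (@leb R N).
Implicit Types v w : X -> R.

Definition cball (m : R) : set X := [set x | `|x| <= m].

Lemma l1norm_mul_indic_le v (B : set X) : measurable B -> measurable_fun setT v ->
  (l1norm mu (fun x => v x * \1_B x)%R <= l1norm mu v)%E.
Proof.
move=> mB mv; apply: le_l1norm => //; first exact: measurable_funM.
by move=> x; rewrite normrM indicE normr_nat ler_piMr// lern1 leq_b1.
Qed.

Lemma l1norm_mul_indic_bound v (m C : R) : 0 <= m -> measurable_fun setT v -> 0 <= C ->
  (forall x, `|x| <= m -> `|v x| <= C) ->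
  (l1norm mu (fun x => v x * \1_(cball m) x)%R <= (C * (2 * m) ^+ N)%:E)%E.
Proof.
move=> m0 mv C0 vC; have mB : measurable (cball m) by exact: measurable_norm_le.
apply: (@le_trans _ _ (l1norm mu (fun x => C * \1_(cball m) x)%R)).
  apply: le_l1norm => //.
  - exact: measurable_funM.
  - exact: measurable_funM.
  move=> x; rewrite !normrM (ger0_norm C0) indicE.
  case: (boolP (x \in cball m)) => h; last by rewrite normr0 !mulr0.
  by rewrite normr1 !mulr1; apply: vC; move/set_mem: h.
rewrite l1normZ// ger0_norm// l1norm_indic// EFinM.
by rewrite [X in (_ * X <= _)%E](_ : _ = ((2 * m) ^+ N)%:E)//; exact: leb_norm_leE.
Qed.

(** With c the mass and v1 the first average, the error is (A v1 - c v1) + c (v1 - c u). Since [v1]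
    inherits the modulus of [u] up to the factor c, each part costs c^2 eps. *)
Lemma l1norm_mollify (delta eps M : R) u : 0 < delta -> Rintegrable mu u ->
  (forall x, `|u x| <= M) ->
  (forall z : X, (`|z| <= delta)%R -> l1norm mu (fun x => u (x + z) - u x)%R <= eps%:E)%E ->
  exists v : X -> R, [/\ v = jump_avg (ball_restr delta) (jump_avg (ball_restr delta) u),
    measurable_fun setT v & (l1norm mu (fun x => v x - mass (@ball_restr R N delta) ^+ 2 * u x)%R <=
      (2 * mass (@ball_restr R N delta) ^+ 2 * eps)%:E)%E].
Proof.
move=> d0 iu uM hu; set rho := @ball_restr R N delta.
have c0 : 0 < mass rho by exact: mass_ball_restr_gt0.
have mu' := Rintegrable_measurable iu.
have [iv1 _] := l1norm_jump_avg delta iu.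
have h1 := l1norm_jump_avgB d0 iu hu.
have h2 (z : X) : `|z| <= delta ->
    (l1norm mu (fun x => jump_avg rho u (x + z) - jump_avg rho u x)%R <= (mass rho * eps)%:E)%E.
  move=> zd; have iz : Rintegrable mu (fun x => u (x + z) - u x).
    have iuz : Rintegrable mu (fun x => u (x + z)) by exact: integrable_shift z _ iu.
    exact: RintegrableB iuz iu.
  have [_] := l1norm_jump_avg delta iz.
  rewrite (_ : jump_avg _ _ = fun x => jump_avg rho u (x + z) - jump_avg rho u x); last first.
    by apply/funext => x; exact: (jump_avg_increment rho x z mu' uM).
  move=> h; apply: le_trans h _; rewrite EFinM; apply: lee_wpmul2l; last exact: hu.
  by rewrite lee_fin ltW.
move: iv1 h1 h2; rewrite -/rho; move: (jump_avg rho u) => v1 iv1 h1 h2.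
have [iv2 _] := l1norm_jump_avg delta iv1.
have h3 := l1norm_jump_avgB d0 iv1 h2.
move: iv2 h3; rewrite -/rho; move: (jump_avg rho v1) => v2 iv2 h3.
move: h1 c0; move: (mass rho) h3 => c h3 h1 c0.
exists v2; split => //; first exact: Rintegrable_measurable iv2.
have mv1 := Rintegrable_measurable iv1; have mv2 := Rintegrable_measurable iv2.
have m1 : measurable_fun setT (fun x => v1 x - c * u x).
  by apply: measurable_funB => //; exact: measurable_funM.
have m2 : measurable_fun setT (fun x => v2 x - c * v1 x).
  by apply: measurable_funB => //; exact: measurable_funM.
have m3 : measurable_fun setT (fun x => c * (v1 x - c * u x)) by exact: measurable_funM.
rewrite (_ : (fun x => v2 x - _) = (fun x => v2 x - c * v1 x) \+ (fun x => c * (v1 x - c * u x))); last first.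
  by apply/funext => x /=; ring.
apply: le_trans (l1norm_triangle mu m2 m3) _.
rewrite l1normZ// (ger0_norm (ltW c0)).
apply: (@le_trans _ _ ((c * (c * eps))%:E + c%:E * (c * eps)%:E)%E).
  by apply: (leeD h3); apply: lee_wpmul2l => //; rewrite lee_fin ltW.
by rewrite -EFinM -EFinD lee_fin; lra.
Qed.

(** With c the mass, v - w is c^-2 times the difference of the double averages corrected by two
    mollification errors of norm at most 2 c^2 eps each; (2 m)^N is the volume of the ball. *)
Lemma mollified_control (delta eps eta m M : R) v w : 0 < delta -> 0 <= m -> 0 <= eta ->
  Rintegrable mu v -> Rintegrable mu w ->
  (forall x, `|v x| <= M) -> (forall x, `|w x| <= M) ->
  (forall z : X, (`|z| <= delta)%R -> l1norm mu (fun x => v (x + z) - v x)%R <= eps%:E)%E ->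
  (forall z : X, (`|z| <= delta)%R -> l1norm mu (fun x => w (x + z) - w x)%R <= eps%:E)%E ->
  (forall x : X, `|x| <= m ->
    `|jump_avg (ball_restr delta) (jump_avg (ball_restr delta) v) x -
      jump_avg (ball_restr delta) (jump_avg (ball_restr delta) w) x| <= eta) ->
  (l1norm mu (fun x => (v x - w x) * \1_(cball m) x)%R <=
    (4 * eps + (mass (@ball_restr R N delta)) ^- 2 * (eta * (2 * m) ^+ N))%:E)%E.
Proof.
move=> d0 m0 eta0 iv iw vM wM hv hw.
have [v2 [<- mv2 hv2]] := l1norm_mollify d0 iv vM hv.
have [w2 [<- mw2 hw2]] := l1norm_mollify d0 iw wM hw.
have := mass_ball_restr_gt0 (R := R) (N := N) d0.
move: (mass _) hv2 hw2 => c hv2 hw2 c0 vw.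
have mv := Rintegrable_measurable iv; have mw := Rintegrable_measurable iw.
have mB : measurable (cball m) by exact: measurable_norm_le.
have m1 : measurable_fun setT (fun x => v2 x - c ^+ 2 * v x).
  by apply: measurable_funB => //; exact: measurable_funM.
have m2 : measurable_fun setT (fun x => w2 x - c ^+ 2 * w x).
  by apply: measurable_funB => //; exact: measurable_funM.
have mB1 : measurable_fun setT (\1_(cball m) : X -> R) by [].
have m3 : measurable_fun setT (fun x => v2 x - w2 x) by exact: measurable_funB.
have c2 : 0 < c ^+ 2 by rewrite exprn_gt0.
have hB := l1norm_mul_indic_bound m0 m3 eta0 vw.
have h1 := le_trans (l1norm_mul_indic_le mB m1) hv2.
have h2 := le_trans (l1norm_mul_indic_le mB m2) hw2.
have mm (u : X -> R) : measurable_fun setT u -> measurable_fun setT (fun x => u x * \1_(cball m) x).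
  by move=> mu'; exact: measurable_funM.
rewrite (_ : (fun x => _) = (fun x => c ^- 2 * (((v2 x - w2 x) * \1_(cball m) x) +
    (w2 x - c ^+ 2 * w x) * \1_(cball m) x - (v2 x - c ^+ 2 * v x) * \1_(cball m) x))); last first.
  by apply/funext => x; field; rewrite lt0r_neq0.
rewrite l1normZ; last by apply: measurable_funB; [apply: measurable_funD|]; exact: mm.
rewrite ger0_norm ?invr_ge0 ?(ltW c2)//.
apply: (@le_trans _ _ ((c ^- 2)%:E *
    ((eta * (2 * m) ^+ N)%:E + (2 * c ^+ 2 * eps)%:E + (2 * c ^+ 2 * eps)%:E))%E).
  apply: lee_wpmul2l; first by rewrite lee_fin invr_ge0 (ltW c2).
  apply: le_trans (l1norm_triangle mu _ _) _.
  - by apply: measurable_funD; exact: mm.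
  - by apply: measurableT_comp => //; exact: mm.
  apply: leeD; first by apply: le_trans (l1norm_triangle mu (mm _ m3) (mm _ m2)) _; exact: leeD.
  apply: le_trans h1; rewrite le_eqVlt; apply/orP; left; apply/eqP.
  by apply: eq_integral => x _; rewrite normrN.
rewrite -!EFinD -EFinM lee_fin le_eqVlt; apply/orP; left; apply/eqP; field.
by rewrite lt0r_neq0.
Qed.

End mollified_control.

Lemma cvgn_of_summable_increments {R : realType} (a : nat -> R) (m : nat) :
  (\sum_(0 <= n <oo) `|a (n + m)%N - a (n + m).+1|%:E < +oo)%E -> cvgn a.
Proof.
move=> h; pose b n : R := a (n + m)%N.
have : cvgn [normed series (telescope b)].
  apply: nnseries_is_cvg => [n|]; first exact: normr_ge0.
  apply: le_lt_trans h.
  by apply: lee_nneseries => // n _; rewrite /telescope /b /= distrC.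
move=> /normed_cvg; rewrite telescopeK => /cvg_ex[l hl].
have cb : (fun n => b n - b 0%N + b 0%N) @ \oo --> l + b 0%N.
  exact: (cvgD (f := fun n => b n - b 0%N) (g := fun=> b 0%N) hl (cvg_cst _)).
have bE : (fun n => b n - b 0%N + b 0%N) = b by apply/funext => n; rewrite subrK.
rewrite bE in cb.
by apply/cvg_ex; exists (l + b 0%N); rewrite -(cvg_shiftn m).
Qed.

Lemma cvge0_le {R : realType} {I : Type} (F : set_system I) (f : I -> \bar R) : Filter F ->
  (forall i, (0 <= f i)%E) ->
  (forall e : R, 0 < e -> \forall i \near F, (f i <= e%:E)%E) -> f @ F --> 0%E.
Proof.
move=> FF f0 h; have fin (e : R) i : (f i <= e%:E)%E -> f i \is a fin_num.
  by move=> fe; rewrite ge0_fin_numE//; exact: le_lt_trans fe (ltry _).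
apply/fine_cvgP; split; first by apply: filterS (h 1 ltr01) => i; exact: fin.
apply/cvgrPdist_le => e e0; apply: filterS (h e e0) => i fe.
by rewrite sub0r normrN ger0_norm ?fine_ge0// -lee_fin fineK//; exact: fin fe.
Qed.

Lemma invr_exp2n_le {R : realType} (e : R) : 0 < e ->
  \forall n \near \oo, (2 ^ n)%:R^-1 <= e.
Proof.
move=> e0; have h : `|2^-1 : R| < 1 by rewrite ger0_norm ?invr_ge0// invf_lt1// ltr1n.
have /cvgrPdist_le/(_ _ e0) := cvg_geometric 1 h; apply: filterS => n.
by rewrite /geometric /= mul1r sub0r normrN exprVn -natrX ger0_norm ?invr_ge0.
Qed.

Lemma compact_rV_measurable {R : realType} {N : nat} (K : set 'rV[R]_N) :
  compact K -> measurable K.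
Proof.
move=> cK; rewrite -[K]setCK; apply: measurableC; apply: rV_open_measurable.
by apply: closed_openC; apply: compact_closed => //; exact: norm_hausdorff.
Qed.

Lemma L1_dist_le_l1norm {R : realType} {N : nat} (K : set 'rV[R]_N) (r : R) v w :
  measurable K -> K `<=` cball r -> measurable_fun setT v -> measurable_fun setT w ->
  (L1_dist K v w <= l1norm (leb N) (fun x => (v x - w x) * \1_(cball r) x)%R)%E.
Proof.
move=> mK Kr mv mw; have mB : measurable (cball r : set 'rV[R]_N) by exact: measurable_norm_le.
rewrite /L1_dist /l1norm [leLHS]integral_mkcond; apply: ge0_le_integral => //=.
- by move=> x _; rewrite patchE; case: ifP.
- by apply/(measurable_restrictT _ mK); apply: measurable_funS (measurable_abs_EFin (measurable_funB mv mw)).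
- apply: measurable_abs_EFin; apply: measurable_funM; first exact: measurable_funB.
  exact: measurable_indic.
move=> x _; rewrite patchE; case: ifPn => [/set_mem/Kr xr|_]; last by rewrite lee_fin.
by rewrite indicE mem_set// mulr1.
Qed.

(** * Limits of rapidly convergent sequences *)

Section fast_cauchy.
Context {R : realType} {N : nat}.
Notation X := 'rV[R]_N.
Notation Y := (measurableTypeR R).
Notation mu := (@leb R N).
Notation lam := (@lebesgue_measure R).
Variables (T M : R) (w : nat -> R -> X -> R).
Hypothesis T0 : 0 <= T.
Hypothesis mw : forall n, measurable_fun setT (fun p : X * Y => w n p.2 p.1).
Hypothesis wM : forall n t x, `|w n t x| <= M.
Hypothesis fast : forall n k t, (n <= k)%N -> 0 <= t <= T ->
  (l1norm mu (fun x => (w n t x - w k t x) * \1_(cball n%:R) x)%R <= ((2 ^ n)%:R^-1)%:E)%E.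

(** A limit superior is measurable and given by one formula for all [t], so that the same function
    serves the convergence at each time and the one almost everywhere in space-time. *)
Definition fast_limit (t : R) (x : X) : R := limn_sup (fun n => w n t x).

Let M0 : 0 <= M. Proof. exact: le_trans (wM 0 0 0). Qed.

Let mwt n t : measurable_fun setT (w n t).
Proof. exact: (measurableT_comp (mw n) (pair2_measurable t)). Qed.

Let mB m : measurable (cball m : set X).
Proof. exact: measurable_norm_le. Qed.

(* The shift by [m] leaves only the increments that [fast] controls on [cball m]. *)
Let variation (m : nat) (p : X * Y) : \bar R :=
  (\sum_(0 <= n <oo) (`|w (n + m) p.2 p.1 - w (n + m).+1 p.2 p.1| * \1_(cball m%:R) p.1)%:E)%E.

Let mterm n m : measurable_fun setT (fun p : X * Y =>
  `|w (n + m) p.2 p.1 - w (n + m).+1 p.2 p.1| * \1_(cball m%:R) p.1).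
Proof.
apply: measurable_funM; first by apply: measurableT_comp => //; exact: measurable_funB.
have h : measurable_fun setT (\1_(cball m%:R) : X -> R) by apply: measurable_indic; exact: mB.
exact: measurableT_comp h measurable_fst.
Qed.

Let mvariation m : measurable_fun setT (variation m).
Proof.
by apply: ge0_emeasurable_sum => [k p _ _|k _]; [rewrite lee_fin mulr_ge0|exact/measurable_EFinP].
Qed.

Let fast_limit_cvg t x : (forall m, variation m (x, t) < +oo)%E ->
  w n t x @[n --> \oo] --> fast_limit t x.
Proof.
move=> h; have [m xm] : exists m : nat, `|x| <= m%:R.
  by exists (Num.truncn `|x|).+1; exact/ltW/truncnS_gt.
have cw : cvgn (fun n => w n t x).
  apply: (@cvgn_of_summable_increments _ _ m); apply: le_lt_trans (h m).
  apply: lee_nneseries => // n _; rewrite lee_fin /= indicE mem_set// mulr1.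
  exact: lexx.
by rewrite /fast_limit (cvg_limn_inf_sup cw).
Qed.

(** At fixed [t] the integrals of the increments are dominated by a geometric series, so each
    variation is integrable and hence finite almost everywhere. *)
Let variation_ae t : 0 <= t <= T -> {ae mu, forall x, forall m, (variation m (x, t) < +oo)%E}.
Proof.
move=> tT; apply: ae_foralln => m.
have mvt : measurable_fun setT (fun x => variation m (x, t)).
  exact: (measurableT_comp (mvariation m) (pair2_measurable t)).
have v0 x : (0 <= variation m (x, t))%E.
  by apply: nneseries_ge0 => n _ _; rewrite lee_fin mulr_ge0.
have : mu.-integrable setT (fun x => variation m (x, t)).
  apply/integrableP; split => //.
  under eq_integral do rewrite gee0_abs//.
  rewrite /variation integral_nneseries//; last first.
    move=> n; apply/measurable_EFinP.
    exact: (measurableT_comp (mterm n m) (pair2_measurable t)).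
  (* The term 2 / 2^(n + 1) is 2^-n in the form that [epsilon_trick0] sums to at most 2; it
     dominates the 2^-(n + m) supplied by [fast]. *)
  apply: (@le_lt_trans _ _ (\sum_(0 <= n <oo) (2 / (2 ^ n.+1)%:R)%:E)%E); last first.
    by apply: le_lt_trans (epsilon_trick0 _ _) (ltry _).
  apply: lee_nneseries => [n *|n *]; first by apply: integral_ge0 => x _; rewrite lee_fin mulr_ge0.
  apply: (@le_trans _ _ ((2 ^ (n + m))%:R^-1)%:E); last first.
    rewrite lee_fin expnS natrM invfM mulrA divff// mul1r lef_pV2 ?posrE ?ltr0n ?expn_gt0//.
    by rewrite ler_nat leq_exp2l// leq_addr.
  apply: le_trans (fast (leqnSn (n + m)) tT); apply: ge0_le_integral => //=.
  - apply/measurable_EFinP; exact: (measurableT_comp (mterm n m) (pair2_measurable t)).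
  - apply: measurable_abs_EFin; apply: measurable_funM; first exact: measurable_funB.
    by apply: measurable_indic; exact: mB.
  move=> x _; rewrite lee_fin normrM ler_wpM2l// indicE; case: (boolP (x \in _)) => xm; last exact: normr_ge0.
  rewrite indicE mem_set ?normr1// /cball /=.
  by move/set_mem: xm => /= /le_trans; apply; rewrite ler_nat leq_addl.
move/(integrable_ae measurableT); apply: ae_imply => x /(_ I).
by rewrite ge0_fin_numE.
Qed.

Lemma measurable_fast_limit t : measurable_fun setT (fast_limit t).
Proof.
apply: measurable_fun_limn_sup => // x _.
- by exists M => _ [n _ <-]; exact: le_trans (ler_norm _) (wM n t x).
- by exists (- M) => _ [n _ <-]; have := wM n t x; rewrite ler_norml => /andP[].
Qed.

Lemma fast_limit_ae t : 0 <= t <= T ->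
  {ae mu, forall x, w n t x @[n --> \oo] --> fast_limit t x}.
Proof. by move=> tT; apply: ae_imply (variation_ae tT) => x; exact: fast_limit_cvg. Qed.

Lemma norm_fast_limit_ae t : 0 <= t <= T -> {ae mu, forall x, `|fast_limit t x| <= M}.
Proof.
move=> tT; apply: ae_imply (fast_limit_ae tT) => x h; rewrite ler_norml; apply/andP; split.
  apply: (cvgr_to_ge h); apply: nearW => n.
  by have := wM n t x; rewrite ler_norml => /andP[].
by apply: (cvgr_to_le h); apply: nearW => n; exact: le_trans (ler_norm _) (wM n t x).
Qed.

(** Passage to the limit in the second index of [fast], dominated by [M] on the ball. *)
Lemma fast_limit_dist n t : 0 <= t <= T ->
  (l1norm mu (fun x => (w n t x - fast_limit t x) * \1_(cball n%:R) x)%R <= ((2 ^ n)%:R^-1)%:E)%E.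
Proof.
move=> tT; apply/lee_addgt0Pr => e e0.
have mB1 : measurable_fun setT (\1_(cball n%:R) : X -> R) by apply: measurable_indic; exact: mB.
have ml := measurable_fast_limit t.
have iB : Rintegrable mu (fun x => M * \1_(cball n%:R) x).
  by apply: RintegrableZ; apply: integrable_indic_fin; [exact: mB|exact: leb_norm_le].
have [||||k _ hk] := dct_l1norm_near (mu := mu)
  (f_ := fun k x => w k t x * \1_(cball n%:R) x)
  (f := fun x => fast_limit t x * \1_(cball n%:R) x) _ _ _ iB _ e0.
- by move=> k; exact: measurable_funM.
- exact: measurable_funM.
- apply: ae_imply (fast_limit_ae tT) => x h; apply: cvgMl; exact: h.
- apply: aeW => x k; rewrite normrM indicE normr_nat; exact: ler_wpM2r.
have {}hk := hk _ (leq_maxl k n).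
have mu1 (a b : X -> R) : measurable_fun setT a -> measurable_fun setT b ->
    measurable_fun setT (fun x => (a x - b x) * \1_(cball n%:R) x).
  by move=> ma mb; apply: measurable_funM => //; exact: measurable_funB.
rewrite (_ : (fun x => _) = (fun x => (w n t x - w (maxn k n) t x) * \1_(cball n%:R) x) \+
   (fun x => (w (maxn k n) t x - fast_limit t x) * \1_(cball n%:R) x)); last first.
  by apply/funext => x /=; rewrite -mulrDl; congr (_ * _); rewrite addrA subrK.
apply: le_trans (l1norm_triangle mu (mu1 _ _ _ _) (mu1 _ _ _ _)) _ => //.
apply: leeD; first exact: fast (leq_maxr k n) tT.
apply: le_trans hk; rewrite le_eqVlt; apply/orP; left; apply/eqP; congr l1norm.
by apply/funext => x; rewrite mulrBl.
Qed.

(** The variations are jointly measurable in (x, t), hence so is the set where one of them is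
    infinite; its time slices are null, and so it is null in the product. *)
Lemma fast_limit_cvg_ae_QT : cvg_ae_QT T w fast_limit.
Proof.
pose A : set (X * Y) := [set p | (p.2 : R) \in `]0, T[] `&` \bigcup_m [set p | variation m p = +oo%E].
apply: (@ae_prod_of_ysections _ _ _ _ _ _ _ _ A).
- apply: measurableI.
    have : measurable ((snd : X * Y -> Y) @^-1` (`]0, T[%classic : set Y)).
      by rewrite -[X in measurable X]setTI; apply: measurable_snd => //; exact: measurable_itv.
    by congr (measurable _).
  apply: bigcup_measurable => m _.
  have := mvariation m measurableT (emeasurable_set1 +oo%E); rewrite setTI.
  by congr (measurable _).
- move=> [x t] /= h; split => /=; first by apply: contrapT => h1; apply: h => /h1.
  apply: contrapT => nv; apply: h => _; apply: fast_limit_cvg => m.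
  by rewrite ltey; apply/eqP => e; apply: nv; exists m.
- apply: aeW => t; have [tT|tT] := boolP ((t : R) \in `]0, T[); last first.
    by apply: aeW => x [] /= h; rewrite h in tT.
  have tT' : 0 <= t <= T by move: tT; rewrite in_itv/= => /andP[/ltW -> /ltW ->].
  apply: ae_imply (variation_ae tT') => x h [_ [m _ /= e]].
  by have := h m; rewrite e.
Qed.

Lemma fast_limit_cvg_C_L1loc : cvg_C_L1loc T w fast_limit.
Proof.
move=> K cK; have mK := compact_rV_measurable cK.
have [m Km] := compact_sub_norm_le cK.
apply: cvge0_le => [n|e e0].
  apply: ereal_sup_ge; exists (L1_dist K (w n 0) (fast_limit 0)).
    by exists 0 => //; rewrite /= in_itv/= lexx T0.
  by apply: integral_ge0.
have [n1 _ hn1] := invr_exp2n_le e0; exists (maxn m n1) => // n /=.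
rewrite geq_max => /andP[mn n1n]; apply: ge_ereal_sup => _ [t /= tT <-].
apply: le_trans (_ : _ <= ((2 ^ n)%:R^-1)%:E)%E _; last by rewrite lee_fin hn1.
have tT' : 0 <= t <= T by move: tT; rewrite in_itv.
apply: le_trans (fast_limit_dist n tT').
apply: L1_dist_le_l1norm => //; last exact: measurable_fast_limit.
by move=> x /Km /= /le_trans; apply; rewrite ler_nat.
Qed.

Hypothesis equi : forall (m : nat) (e : R), 0 < e -> exists2 d, 0 < d &
  \forall n \near \oo, forall s t, 0 <= s <= T -> 0 <= t <= T -> `|t - s| < d ->
    (l1norm mu (fun x => (w n t x - w n s x) * \1_(cball m%:R) x)%R <= e%:E)%E.

Lemma fast_limit_equicontinuous (m : nat) (e : R) : 0 < e -> exists2 d, 0 < d &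
  forall s t, 0 <= s <= T -> 0 <= t <= T -> `|t - s| < d ->
    (l1norm mu (fun x => (fast_limit t x - fast_limit s x) * \1_(cball m%:R) x)%R <= e%:E)%E.
Proof.
move=> e0; have e3 : 0 < e / 3 by rewrite divr_gt0.
have [d d0 [n0 _ hd]] := equi m e3.
have [n1 _ hn1] := invr_exp2n_le e3.
(* Large enough for three purposes: the ball of radius m lies in that of radius n, [w n] satisfies
   [equi], and 2^-n <= e / 3. *)
pose n := maxn m (maxn n0 n1).
have mn : (m <= n)%N by exact: leq_maxl.
have {}hd := hd n (leq_trans (leq_maxl n0 n1) (leq_maxr m _)).
have {}hn1 : (2 ^ n)%:R^-1 <= e / 3 := hn1 n (leq_trans (leq_maxr n0 n1) (leq_maxr m _)).
exists d => // s t sT tT ts.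
have mB1 : measurable_fun setT (\1_(cball m%:R) : X -> R) by apply: measurable_indic; exact: mB.
have small r : 0 <= r <= T ->
    (l1norm mu (fun x => (w n r x - fast_limit r x) * \1_(cball m%:R) x)%R <= (e / 3)%:E)%E.
  move=> rT; apply: (@le_trans _ _ ((2 ^ n)%:R^-1)%:E); last by rewrite lee_fin.
  apply: le_trans (fast_limit_dist n rT).
  have mr := measurable_fast_limit r.
  have mm k : measurable_fun setT (fun x => (w n r x - fast_limit r x) * \1_(cball k) x).
    apply: measurable_funM; first exact: measurable_funB.
    by apply: measurable_indic; exact: mB.
  apply: le_l1norm => // x; rewrite !normrM ler_wpM2l// !indicE !normr_nat ler_nat.
  case: (boolP (x \in cball m%:R)) => // /set_mem xm.
  by rewrite mem_set// /cball /=; apply: le_trans xm _; rewrite ler_nat.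
have h1 := small t tT; have h2 := small s sT; have h3 := hd s t sT tT ts.
have mt := measurable_fast_limit t; have ms := measurable_fast_limit s.
have mm (a b : X -> R) : measurable_fun setT a -> measurable_fun setT b ->
    measurable_fun setT (fun x => (a x - b x) * \1_(cball m%:R) x).
  by move=> ma mb; apply: measurable_funM => //; exact: measurable_funB.
have h1' : (l1norm mu (fun x => (fast_limit t x - w n t x) * \1_(cball m%:R) x)%R <= (e / 3)%:E)%E.
  apply: le_trans h1; rewrite le_eqVlt; apply/orP; left; apply/eqP.
  by apply: eq_integral => x _; rewrite !normrM distrC.
rewrite (_ : (fun x => _) = ((fun x => (fast_limit t x - w n t x) * \1_(cball m%:R) x) \+
   (fun x => (w n t x - w n s x) * \1_(cball m%:R) x)) \+
   (fun x => (w n s x - fast_limit s x) * \1_(cball m%:R) x)); last first.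
  by apply/funext => x /=; ring.
have m1 := mm _ _ mt (mwt n t); have m2 := mm _ _ (mwt n t) (mwt n s).
have m3 := mm _ _ (mwt n s) ms.
apply: le_trans (l1norm_triangle mu (measurable_funD m1 m2) m3) _.
apply: (@le_trans _ _ ((e / 3)%:E + (e / 3)%:E + (e / 3)%:E)%E).
  by apply: leeD => //; apply: le_trans (l1norm_triangle mu m1 m2) _; exact: leeD.
by rewrite -!EFinD lee_fin; lra.
Qed.

Lemma fast_limit_C_L1loc : C_L1loc T fast_limit.
Proof.
move=> K cK; have mK := compact_rV_measurable cK.
have [m Km] := compact_sub_norm_le cK.
have mu_K : (mu K < +oo)%E.
  apply: le_lt_trans (leb_norm_le m%:R); apply: le_measure => //; rewrite ?inE//.
  exact: measurable_norm_le.
split=> [t|s sT].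
  rewrite in_itv/= => tT; have ml := measurable_fast_limit t.
  have iM : mu.-integrable K (EFin \o cst M).
    by apply: measurable_bounded_integrable => //; exists M; split; [exact: num_real|] => x Mx y; rewrite /= ger0_norm// ltW.
  have mlK := measurable_funS measurableT (@subsetT _ K) ml.
  apply/integrableP; split; first exact/measurable_EFinP.
  have /integrableP[_] := iM; apply: le_lt_trans.
  apply: ae_ge0_le_integral => //.
  - by apply/measurableT_comp => //; exact/measurable_EFinP.
  - exact: (measurable_cst (`|M|%:E : \bar R)).
  - by apply: ae_imply (norm_fast_limit_ae tT) => x h _; rewrite /= lee_fin (ger0_norm M0).
apply: cvge0_le => [t|e e0]; first by apply: integral_ge0.
have [d d0 hd] := fast_limit_equicontinuous m e0.
rewrite near_withinE; have := nbhsx_ballx s d d0; apply: filterS => t /= st tT.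
apply: le_trans (hd s t _ _ _); last 3 first.
- by move: sT; rewrite in_itv/=.
- by move: tT; rewrite /= in_itv/=.
- by rewrite distrC.
by apply: L1_dist_le_l1norm => //; exact: measurable_fast_limit.
Qed.

End fast_cauchy.

(** * Extraction of a convergent sequence *)

Section compactness.
Context {R : realType} {N : nat}.
Notation X := 'rV[R]_N.
Notation Y := (measurableTypeR R).
Notation mu := (@leb R N).
Notation rho delta := (@ball_restr R N delta).
Notation AA delta g := (jump_avg (rho delta) (jump_avg (rho delta) g)).
Variables (T M : R) (W : R -> R -> X -> R).
Hypothesis T0 : 0 <= T.
Hypothesis iW : forall h t, 0 < h -> 0 <= t <= T -> Rintegrable mu (W h t).
Hypothesis WM : forall h t x, 0 < h -> `|W h t x| <= M.
Hypothesis mW : forall h, 0 < h -> measurable_fun setT (fun p : X * Y => W h p.2 p.1).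
Hypothesis space_modulus : forall e : R, 0 < e -> exists2 d, 0 < d & forall h t (xi : X), 0 < h ->
  0 <= t <= T -> `|xi| <= d ->
  (l1norm mu (fun x => W h t (x + xi) - W h t x)%R <= e%:E)%E.
Hypothesis time_modulus : forall delta e : R, 0 < delta -> 0 < e -> exists2 d, 0 < d &
  \forall h \near 0^'+, forall s t, 0 <= s <= T -> 0 <= t <= T -> `|t - s| < d ->
  forall x, `|AA delta (W h t) x - AA delta (W h s) x| <= e.

Let mass_gt0 delta : 0 < delta -> 0 < mass (rho delta).
Proof. exact: mass_ball_restr_gt0. Qed.

Let mWt h t : 0 < h -> measurable_fun setT (W h t).
Proof. by move=> h0; exact: (measurableT_comp (mW h0) (pair2_measurable t)). Qed.

Let M0 : 0 <= M. Proof. exact: le_trans (WM 0 0 ltr01). Qed.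

(** The radius [delta] comes from the common modulus in space, so neither it nor [eta] depends on
    the parameters of the family. *)
Lemma averages_control (m : nat) (e : R) : 0 < e -> exists delta eta : R, [/\ 0 < delta, 0 < eta &
  forall h h' s t, 0 < h -> 0 < h' -> 0 <= s <= T -> 0 <= t <= T ->
  (forall x : X, `|x| <= m%:R -> `|AA delta (W h t) x - AA delta (W h' s) x| <= eta) ->
  (l1norm mu (fun x => (W h t x - W h' s x) * \1_(cball m%:R) x)%R <= e%:E)%E].
Proof.
move=> e0; have e8 : 0 < e / 8 by rewrite divr_gt0.
have [delta d0 hd] := space_modulus e8.
have c0 := mass_gt0 d0; have c2 : 0 < mass (rho delta) ^+ 2 by rewrite exprn_gt0.
have V0 : 0 <= (2 * m%:R) ^+ N :> R by rewrite exprn_ge0// mulr_ge0.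
have V1 : 0 < (2 * m%:R) ^+ N + 1 :> R by lra.
(* The summand 1 keeps the denominator positive when [m = 0]. The other half of [e] pays for the
   mollification errors, 4 (e / 8). *)
pose eta := e / 2 * mass (rho delta) ^+ 2 / ((2 * m%:R) ^+ N + 1).
have eta0 : 0 < eta by rewrite divr_gt0// mulr_gt0// divr_gt0.
exists delta, eta; split=> // h h' s t h0 h'0 sT tT hx.
apply: le_trans (mollified_control d0 (ler0n R m) (ltW eta0) (iW h0 tT) (iW h'0 sT)
  (fun x => WM t x h0) (fun x => WM s x h'0) (fun z zd => hd h t z h0 tT zd)
  (fun z zd => hd h' s z h'0 sT zd) hx) _.
rewrite lee_fin.
suff : mass (rho delta) ^- 2 * (eta * (2 * m%:R) ^+ N) <= e / 2 by lra.
rewrite /eta; move: (mass _ ^+ 2) c2 => c c2.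
have -> : c^-1 * (e / 2 * c / ((2 * m%:R) ^+ N + 1) * (2 * m%:R) ^+ N) =
    e / 2 * ((2 * m%:R) ^+ N / ((2 * m%:R) ^+ N + 1)) by field; rewrite !lt0r_neq0.
rewrite ler_piMr ?ler_pdivrMr ?mul1r; lra.
Qed.

Let norm_avg delta h t x : 0 < h -> `|jump_avg (rho delta) (W h t) x| <= mass (rho delta) * M.
Proof. by move=> h0; apply: norm_jump_avg; [exact: mWt|move=> y; exact: WM]. Qed.

Let measurable_avg delta h t : 0 < h -> measurable_fun setT (jump_avg (rho delta) (W h t)).
Proof. by move=> h0; apply: (measurable_jump_avg _ (C := M)); [exact: mWt|move=> x; exact: WM]. Qed.

Lemma ultra_cauchy_L1loc (G : set_system R) : UltraFilter G -> (0 : R)^'+ `<=` G ->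
  forall (m : nat) (e : R), 0 < e -> exists2 E, G E & forall h h' t, E h -> E h' ->
    0 < h -> 0 < h' -> 0 <= t <= T ->
    (l1norm mu (fun x => (W h t x - W h' t x) * \1_(cball m%:R) x)%R <= e%:E)%E.
Proof.
move=> UG G0 m e e0; have [delta [eta [d0 eta0 hde]]] := averages_control m e0.
(* Space and time are joined in one compact set, which makes the convergence uniform in both. *)
pose a h (p : X * R) := AA delta (W h p.2) p.1.
have G0' : G [set h | 0 < h] by apply: G0; exact: nbhs_right_gt.
have [C1 C10 hC1] := jump_avg_ball_lipschitz (R := R) (N := N) d0.
have := @ultra_cauchy_uniform R R (X * R)%type G (cball m%:R `*` `[0, T]%classic) a
  (mass (rho delta) * (mass (rho delta) * M)) UG _ _ _ eta eta0.
case.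
- apply: compact_setX; first exact: compact_norm_le.
  exact: segment_compact.
- apply: filterS G0' => h h0 p _; apply: norm_jump_avg; first exact: measurable_avg.
  by move=> x; exact: norm_avg.
- move=> [x t] r [/= xm tT] r0; have r2 : 0 < r / 2 by rewrite divr_gt0.
  have [d dd hd] := time_modulus d0 r2.
  (* The Lipschitz constant in space, increased by 1 to be positive. *)
  pose C2 := C1 * (mass (rho delta) * M) + 1.
  have C20 : 0 < C2.
    by rewrite /C2 ltr_wpDl// mulr_ge0// mulr_ge0// ltW// mass_gt0.
  have x0 : 0 < r / 2 / C2 by rewrite divr_gt0.
  exists (ball x (r / 2 / C2) `*` ball t d, [set h | 0 < h] `&` [set h | forall s t, 0 <= s <= T -> 0 <= t <= T -> `|t - s| < d ->
  forall x, `|AA delta (W h t) x - AA delta (W h s) x| <= r / 2]).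
    split => /=.
      exists (ball x (r / 2 / C2), ball t d) => //=; split; exact: nbhsx_ballx.
    by apply: filterI => //; exact: G0.
  move=> [[x' t'] h] /= [[xx' tt'] [h0 hh]] [_ t'T].
  have tT' : 0 <= t <= T by move: tT; rewrite in_itv.
  have t'T' : 0 <= t' <= T by move: t'T; rewrite /= in_itv.
  have tt : `|t' - t| < d by rewrite distrC; exact: tt'.
  have h1 := hh t t' tT' t'T' tt x'.
  have xE : x + (x' - x) = x' by rewrite addrC subrK.
  have h2 := hC1 _ _ x (x' - x) (measurable_avg delta t h0) (fun y => norm_avg delta t y h0).
  rewrite xE in h2.
  have h3 : C1 * (mass (rho delta) * M) * Num.min `|x' - x| 1 <= r / 2.
    have P0 : 0 <= C1 * (mass (rho delta) * M) by rewrite mulr_ge0// mulr_ge0// ltW// mass_gt0.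
    have xd : `|x' - x| <= r / 2 / C2 by move: xx'; rewrite -ball_normE/= distrC => /ltW.
    apply: (@le_trans _ _ (C1 * (mass (rho delta) * M) * (r / 2 / C2))).
      by apply: ler_wpM2l => //; rewrite ge_min xd.
    by rewrite mulrA ler_pdivrMr// mulrC; apply: ler_wpM2l; rewrite ?(ltW r2)// /C2 lerDl.
  rewrite /a /=; move: h1 (le_trans h2 h3).
  move: (jump_avg _ _ x') (jump_avg _ _ x') (jump_avg _ _ x) => B1 B2 B3.
  rewrite !ler_norml => /andP[? ?] /andP[? ?]; apply/andP; split; lra.
- move=> E GE hE; exists E => // h h' t Eh Eh' h0 h'0 tT; apply: hde => // x xm.
  exact: (hE h h' (x, t)).
Qed.

Theorem L1loc_compactness : exists (h : nat -> R) (u : R -> X -> R),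
  [/\ (forall n, 0 < h n) /\ h n @[n --> \oo] --> (0 : R), C_L1loc T u,
      cvg_C_L1loc T (fun n => W (h n)) u & cvg_ae_QT T (fun n => W (h n)) u].
Proof.
have [G [UG G0]] := ultraFilterLemma (at_right_proper_filter (0 : R)).
have /choice[E hE] : forall n : nat, exists E, G E /\ forall h h' t, E h -> E h' ->
    0 < h -> 0 < h' -> 0 <= t <= T ->
    (l1norm mu (fun x => (W h t x - W h' t x) * \1_(cball n%:R) x)%R <= ((2 ^ n)%:R^-1)%:E)%E.
  move=> n; have e0 : 0 < (2 ^ n)%:R^-1 :> R by rewrite invr_gt0 ltr0n expn_gt0.
  by have [E GE hE] := ultra_cauchy_L1loc UG G0 n e0; exists E.
(* Nested sets: for n <= k both [h n] and [h k] lie in [E n], which compares them at precision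
   2^-n. *)
pose D n : set R := \bigcap_(k in `I_n.+1) E k.
have GD n : G (D n).
  elim: n => [|n IH]; first by apply: filterS (hE 0%N).1 => h Eh k /=; rewrite ltnS leqn0 => /eqP ->.
  apply: filterS (filterI IH (hE n.+1).1) => h [Dh Eh] k /=; rewrite ltnS leq_eqVlt.
  by move=> /predU1P[->//|kn]; exact: Dh.
(* Every member of an ultrafilter finer than 0+ meets each interval []0, 1/(n+1)[]; this is how an
   ordinary sequence tending to 0 is recovered. *)
have /choice[h hh] : forall n : nat, exists h, [/\ D n h, 0 < h & h < n.+1%:R^-1].
  move=> n; have [h [Dh [h0 hn]]] : D n `&` ([set h | 0 < h] `&` [set h | h < n.+1%:R^-1]) !=set0.
    apply: (@filter_ex _ G); apply: filterI; first exact: GD.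
    apply: G0; apply: filterI; first exact: nbhs_right_gt.
    by apply: nbhs_right_lt; rewrite invr_gt0.
  by exists h.
have h0 n : 0 < h n by case: (hh n).
have cvgh : h n @[n --> \oo] --> (0 : R).
  apply/cvgrPdist_lt => e e0; have := @near_infty_natSinv_lt R (PosNum e0).
  apply: filterS => n /= ne; rewrite sub0r normrN ger0_norm ?ltW//.
  by apply: lt_trans ne; case: (hh n).
have mw n : measurable_fun setT (fun p : X * Y => W (h n) p.2 p.1) by exact: mW.
have wM n t x : `|W (h n) t x| <= M by exact: WM.
have fast n k t : (n <= k)%N -> 0 <= t <= T ->
    (l1norm mu (fun x => (W (h n) t x - W (h k) t x) * \1_(cball n%:R) x)%R <= ((2 ^ n)%:R^-1)%:E)%E.
  move=> nk tT; apply: (hE n).2 => //.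
  - by case: (hh n) => + _ _; apply => /=.
  - by case: (hh k) => + _ _; apply => /=; rewrite ltnS.
exists h, (fast_limit (fun n => W (h n))); split => //.
- apply: (fast_limit_C_L1loc mw wM fast) => m e e0.
  have [delta [eta [d0 eta0 hde]]] := averages_control m e0.
  have [d dd hd] := time_modulus d0 eta0.
  exists d => //.
  have : \forall n \near \oo, forall s t, 0 <= s <= T -> 0 <= t <= T -> `|t - s| < d ->
      forall x, `|AA delta (W (h n) t) x - AA delta (W (h n) s) x| <= eta.
    case: hd => r /= r0 hr; have /cvgrPdist_lt/(_ _ r0) := cvgh.
    by apply: filterS => n hn; exact: hr.
  apply: filterS => n hn s t sT tT st; apply: hde => // x _; exact: hn.
- exact: fast_limit_cvg_C_L1loc T0 mw wM fast.
- exact: fast_limit_cvg_ae_QT mw fast.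
Qed.

End compactness.

(** * Estimates for the interpolants *)

(** Turns the finiteness hypothesis of admissibility into the bundled structure that the estimates
    on jump measures are stated for. *)
Lemma finite_measure_of {d} {T : measurableType d} {R : realType}
    (nu : {measure set T -> \bar R}) : (nu setT < +oo)%E ->
  exists nu' : {finite_measure set T -> \bar R}, forall A, nu' A = nu A.
Proof.
move=> nuoo; exists (mfrestr measurableT nuoo) => A.
by rewrite /= /mfrestr /mrestr setIT.
Qed.

(** * Lipschitz constants on segments *)

Section lipschitz.
Context {R : realType}.
Implicit Types phi : R -> R.

(** Compactness of the square of pairs (r, s): on the diagonal a local constant works, off it the
    distance is bounded below while [phi] is bounded. *)
Lemma locally_lipschitz_segment phi M : {homo phi : r s / r <= s} ->
  locally_lipschitz phi -> exists2 k, 0 <= k & k.-lipschitz_(`[- M, M]) phi.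
Proof.
move=> hphi lphi; have [B B0 hB] := homo_bounded M hphi.
have : \forall k \near +oo, (`[- M, M] `*` `[- M, M])%classic `<=`
    (fun p : R * R => `[- M, M]%classic p.1 -> `[- M, M]%classic p.2 ->
      `|phi p.1 - phi p.2| <= k * `|p.1 - p.2|).
  have : compact (`[- M, M] `*` `[- M, M] : set (R * R)).
    by apply: compact_setX; exact: segment_compact.
  move/compact_near_coveringP; apply => -[r s] [/= rM sM].
  have [<-|rs] := eqVneq r s.
    have [e e0 le] := lphi r.
    exists (ball r e `*` ball r e, [set k | k.-lipschitz_(ball r e) phi]).
      split => //=; exists (ball r e, ball r e) => //=; split; exact: nbhsx_ballx.
    by move=> [[r' s'] k] /= [[rr ss] lk] _ _; exact: (lk (r', s')).
  have d0 : 0 < `|r - s| / 4 by rewrite divr_gt0// normr_gt0 subr_eq0.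
  (* On these balls |r' - s'| >= |r - s| / 2, so the oscillation bound 2 B gives a bound on the
     quotient. *)
  exists (ball r (`|r - s| / 4) `*` ball s (`|r - s| / 4), [set k | 2 * B / (`|r - s| / 2) <= k]).
    split => /=.
      by exists (ball r (`|r - s| / 4), ball s (`|r - s| / 4)) => //=; split; exact: nbhsx_ballx.
    by apply: nbhs_pinfty_ge; exact: num_real.
  move=> [[r' s'] k] /= [[rr ss] lk]; rewrite !in_itv/= -!ler_norml => r'M s'M.
  have h1 := hB _ r'M; have h2 := hB _ s'M.
  have h3 : `|r - s| / 2 <= `|r' - s'|.
    move: rr ss; rewrite /ball/= => rr ss.
    have -> : r - s = (r - r') + (r' - s') + (s' - s) by ring.
    have := le_trans (ler_normD (r - r' + (r' - s')) (s' - s)) (lerD (ler_normD _ _) (lexx _)).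
    rewrite (distrC s'); move: rr ss.
    have -> : r - r' + (r' - s') + (s' - s) = r - s by ring.
    move: `|r - s| `|r - r'| `|r' - s'| `|s - s'| => a1 a2 a3 a4; lra.
  have d1 : 0 < `|r - s| / 2 by rewrite divr_gt0// normr_gt0 subr_eq0.
  have kk : 0 <= k by apply: le_trans lk; rewrite divr_ge0 ?mulr_ge0// ltW.
  apply: (@le_trans _ _ (2 * B)).
    by apply: le_trans (ler_normB _ _) _; rewrite mulr_natl mulr2n lerD.
  move: lk; rewrite ler_pdivrMr// => lk; apply: le_trans lk _; exact: ler_wpM2l.
case=> k0 [_ hk].
exists (Num.max 0 (k0 + 1)); first by rewrite le_max lexx.
move=> [r s] [/= rM sM]; apply: (hk _ _ (r, s)) => //.
by rewrite lt_max ltrDl ltr01 orbT.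
Qed.

(** The infimum of the Lipschitz constants is itself one. Nonemptiness of their set is what keeps
    [inf] from being the default value 0. *)
Lemma lipschitz_constantP phi (M r s : R) : {homo phi : r s / r <= s} ->
  locally_lipschitz phi -> `|r| <= M -> `|s| <= M ->
  `|phi r - phi s| <= lipschitz_constant `[- M, M] phi * `|r - s|.
Proof.
move=> hphi lphi rM sM; have [k k0 lk] := locally_lipschitz_segment M hphi lphi.
have [->|rs] := eqVneq r s; first by rewrite !subrr normr0 mulr0.
have rs0 : 0 < `|r - s| by rewrite normr_gt0 subr_eq0.
rewrite -ler_pdivrMr//; apply: lb_le_inf; first by exists k.
move=> c [c0 lc]; rewrite ler_pdivrMr//.
by apply: (lc (r, s)); split; rewrite /= in_itv/= -ler_norml.
Qed.

Lemma lipschitz_constant_ge0 phi (A : set R) : 0 <= lipschitz_constant A phi.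
Proof.
rewrite /lipschitz_constant; set B := [set _ | _].
have [->|/set0P B0] := eqVneq B set0; first by rewrite inf0.
by apply: lb_le_inf => // k [].
Qed.

End lipschitz.

Section levy.
Context {R : realType} {N : nat}.
Notation X := 'rV[R]_N.

Lemma norm_le_enorm (z : X) : `|z| <= enorm z.
Proof.
rewrite [leLHS]/Num.norm/= mx_normrE; apply/bigmax_leP; split; first exact: sqrtr_ge0.
move=> [i j] _ /=; rewrite ord1 -sqrtr_sqr; apply: ler_wsqrtr.
by rewrite (bigD1 j)//= lerDl sumr_ge0// => k _; exact: sqr_ge0.
Qed.

Lemma measurable_enorm : measurable_fun setT (@enorm R N).
Proof.
have msq : measurable_fun setT (@Num.sqrt R) by apply: continuous_measurable_fun; exact: sqrt_continuous.
apply: (measurableT_comp msq); apply: measurable_sum => i.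
by apply: measurable_funX; exact: measurable_coord.
Qed.

(** Passes from the Euclidean norm of the hypothesis to the smaller sup norm of the estimates; the
    integrand vanishes at the origin, which may thus be added to the domain. *)
Lemma Rintegral_levy_le (nu : {measure set X -> \bar R}) (Lam : R) :
  (\int[nu]_(z in [set z | (0 < enorm z)%R]) (Num.min (enorm z ^+ 2) 1)%:E <= Lam%:E)%E ->
  \int[nu]_z Num.min (`|z| ^+ 2) 1 <= Lam.
Proof.
move=> h; have mE := measurable_enorm.
have mD : measurable [set z : X | 0 < enorm z].
  exact: (measurable_set_ltr (f := fun=> 0) (measurable_cst _) mE).
have ge0 (r : R) : 0 <= Num.min (r ^+ 2) 1 by rewrite le_min sqr_ge0 ler01.
have mmin (g : X -> R) : measurable_fun setT g ->
    measurable_fun setT (fun z => (Num.min (g z ^+ 2) 1)%:E).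
  move=> mg; apply/measurable_EFinP; apply: measurable_minr => //.
  exact: measurable_funX.
have hle : (\int[nu]_z (Num.min (`|z| ^+ 2) 1)%:E <= Lam%:E)%E.
  apply: le_trans h; rewrite [leRHS]integral_mkcond; apply: ge0_le_integral => //.
  - apply: mmin; exact: measurable_rV_norm.
  - apply/(measurable_restrictT _ mD); exact: measurable_funS (mmin _ mE).
  move=> z _; rewrite patchE; case: ifPn => [_|/negP hz].
    rewrite lee_fin le_min !ge_min lexx orbT andbT lerXn2r ?nnegrE ?sqrtr_ge0 ?norm_le_enorm//.
  have z0 : `|z| <= 0.
    apply: le_trans (norm_le_enorm z) _; rewrite leNgt; apply/negP => z0.
    by apply: hz; exact/mem_set.
  by move: z0; rewrite normr_le0 => /eqP ->; rewrite normr0 expr0n/= lee_fin ge_min lexx.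
rewrite -lee_fin /Rintegral fineK// ge0_fin_numE; first exact: le_lt_trans hle (ltry _).
by apply: integral_ge0 => z _; rewrite lee_fin.
Qed.

End levy.

(** * Interpolation on the time grid *)

Section interpolation.
Context {R : realType} {N : nat}.
Notation X := 'rV[R]_N.
Variables (S : scheme R N) (T : R).
Hypotheses (T0 : 0 < T) (grid : time_grid S T).

Let J := steps S.

Lemma node_le i j : (i <= j <= J)%N -> node S i <= node S j.
Proof.
case: grid => _ _ h /andP[]; elim: j => [|j IH]; first by rewrite leqn0 => /eqP ->.
rewrite leq_eqVlt => /predU1P[-> //|ij] jJ.
exact: le_trans (IH ij (ltnW jJ)) (ltW (h j jJ)).
Qed.

Lemma node_bounds j : (j <= J)%N -> 0 <= node S j <= T.
Proof.
move=> jJ; case: grid => h0 hT _; rewrite -{1}h0 -hT.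
by rewrite !node_le ?jJ ?leqnn ?leq0n.
Qed.

Lemma dt_gt0 j : (j < J)%N -> 0 < dt S j.
Proof. by case: grid => _ _ h /h; rewrite /dt subr_gt0. Qed.

Lemma dt_le_mesh j : (j < J)%N -> dt S j <= mesh S.
Proof. by move=> jJ; exact: (le_bigmax _ (fun i : 'I_J => dt S i) (Ordinal jJ)). Qed.

(** Lets the uniform bound on interpolants hold at every real [t]. *)
Lemma interpolant_eq0_out (V : nat -> X -> R) t x : ~~ (0 <= t <= T) -> interpolant S V t x = 0.
Proof.
move=> tT; rewrite /interpolant; case: eqP => [t0|_]; first by rewrite t0 lexx ltW in tT.
apply: big1 => j /andP[jt tj]; exfalso; case/negP: tT.
have /andP[j0 _] := node_bounds (ltnW (ltn_ord j)).
have /andP[_ jT] := node_bounds (ltn_ord j).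
by rewrite (le_trans j0 (ltW jt)) (le_trans tj jT).
Qed.

(** The cell and the weight depend on [t] alone, not on [V] or [x], so translations and averages may
    be applied to the formula. *)
Lemma interpolant_convex t : 0 <= t <= T -> exists (j : nat) (th : R),
  [/\ (j < J)%N, 0 <= th <= 1, node S j <= t <= node S j.+1 &
      forall V x, interpolant S V t x = V j x + th * (V j.+1 x - V j x)].
Proof.
move=> /andP[t0 tT]; case: (grid) => h0 hT hlt.
have J0 : (0 < J)%N by rewrite lt0n; apply/eqP => J0; move: hT T0; rewrite -/J J0 h0 => ->; rewrite ltxx.
have [tz|tnz] := eqVneq t 0.
  (* [interpolant] treats t = 0 apart; the first cell with weight 0 agrees with it. *)
  exists 0%N, 0; split => //.
  - by rewrite lexx ler01.
  - by rewrite tz h0 lexx /= -h0 node_le.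
  - by move=> V x; rewrite /interpolant tz eqxx mul0r addr0.
have ex : exists k, (k <= J)%N && (t <= node S k) by exists J; rewrite leqnn hT.
(* Minimality of the index puts the preceding node strictly before [t], which selects the half-open
   cell. *)
case: (ex_minnP ex) => k /andP[kJ tk] kmin.
have k0 : (0 < k)%N.
  rewrite lt0n; apply/eqP => k0; move: tk; rewrite k0 h0 => tk.
  by move/eqP: tnz; apply; apply/eqP; rewrite eq_le tk t0.
case: k k0 kJ tk kmin => // j _ jJ tj jmin.
have jt : node S j < t.
  rewrite ltNge; apply/negP => tj'; have := jmin j; rewrite (ltnW jJ) tj' => /(_ isT).
  by rewrite ltnn.
have d0 : 0 < node S j.+1 - node S j by exact: dt_gt0 jJ.
exists j, ((t - node S j) / (node S j.+1 - node S j)); split => //.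
- apply/andP; split; first by rewrite divr_ge0 ?(ltW d0)// subr_ge0 (ltW jt).
  by rewrite ler_pdivrMr// mul1r lerB.
- by rewrite (ltW jt).
move=> V x; rewrite /interpolant (negbTE tnz) (big_pred1 (Ordinal jJ))//.
move=> i /=; apply/idP/eqP => [/andP[it ti]|->]; last by rewrite jt.
apply/val_inj => /=; apply/eqP; rewrite eqn_leq; apply/andP; split.
  rewrite leqNgt; apply/negP => ji; have := node_le (i := j.+1) (j := i).
  by rewrite ji (ltnW (ltn_ord i)) => /(_ isT) /(le_trans tj); rewrite leNgt it.
rewrite leqNgt; apply/negP => ij; have := node_le (i := i.+1) (j := j).
by rewrite ij (ltnW jJ) => /(_ isT) /(le_trans ti); rewrite leNgt jt.
Qed.

Lemma measurable_interpolant (V : nat -> X -> R) :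
  (forall j, (j <= J)%N -> measurable_fun setT (V j)) ->
  measurable_fun setT (fun p : X * measurableTypeR R => interpolant S V p.2 p.1).
Proof.
move=> mV; have mVp j : (j <= J)%N -> measurable_fun setT (fun p : X * measurableTypeR R => V j p.1).
  by move=> jJ; exact: measurableT_comp (mV j jJ) measurable_fst.
have mt : measurable_fun setT (fun p : X * measurableTypeR R => p.2 : R) by exact: measurable_snd.
rewrite /interpolant; apply: measurable_fun_ifT.
- by apply: measurable_fun_eqr => //; exact: measurable_cst.
- exact: mVp.
under eq_fun do rewrite big_mkcond/=.
apply: measurable_sum => j; apply: measurable_fun_ifT.
- apply: measurable_and; first by apply: measurable_fun_ltr => //; exact: measurable_cst.
  by apply: measurable_fun_ler => //; exact: measurable_cst.
- have mj := mVp _ (ltnW (ltn_ord j)); have mj1 := mVp _ (ltn_ord j).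
  apply: measurable_funD => //; apply: measurable_funM; last exact: measurable_funB.
  apply: measurable_funM; last exact: measurable_cst.
  by apply: measurable_funB => //; exact: measurable_cst.
- exact: measurable_cst.
Qed.

End interpolation.

Section L1_Loo.
Context {R : realType} {N : nat}.
Notation X := 'rV[R]_N.
Notation mu := (@leb R N).

Lemma L1_Loo_bounded (w : X -> R) : L1_Loo w -> Rintegrable mu w /\
  exists2 m : R, (m%:E = 'N[mu]_+oo [EFin \o w])%E & 0 <= m /\ {ae mu, forall x, `|w x| <= m}.
Proof.
move=> [w1 woo]; split; first exact/Lfun1_integrable.
have n0 : (0 <= 'N[mu]_+oo [EFin \o w])%E by exact: Lnorm_ge0.
have fin : ('N[mu]_+oo [EFin \o w])%E \is a fin_num.
  by rewrite ge0_fin_numE//; move: woo; rewrite inE => /andP[_]; rewrite inE.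
exists (fine ('N[mu]_+oo [EFin \o w])%E); first by rewrite fineK.
split; first exact: fine_ge0.
have := ess_sup_ge mu (fun x => `|w x|%:E); apply: ae_imply => x.
rewrite -lee_fin fineK//; move=> h; apply: le_trans h _.
by rewrite unlock /= leb_setT_gt0.
Qed.

End L1_Loo.

Section source_average.
Context {R : realType} {N : nat}.
Notation X := 'rV[R]_N.
Notation Y := (measurableTypeR R).
Notation mu := (@leb R N).
Notation lam := (@lebesgue_measure R).

Lemma average_source_cell (T : R) (f : X -> R -> R) (F : X * Y -> R) (g : Y -> R) (a b : R) :
  measurable_fun setT F -> (forall x t, `|F (x, t)| <= g t) -> Rintegrable lam g ->
  (forall x, measurable_fun (`]0, T[%classic : set Y) (f x)) ->
  {ae mu, forall x, {ae lam, forall t, t \in (`]0, T[%classic : set R) -> f x t = F (x, t)}} ->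
  0 <= a -> a < b -> b <= T ->
  {ae mu, forall x, \int[lam]_(t in `]a, b[) f x t = source_cell F a b x}.
Proof.
move=> mF Fg ig mf fF a0 ab bT; apply: ae_imply fF => x fx.
have g0 t : 0 <= g t by exact: le_trans (Fg x t).
have mFx : measurable_fun setT (fun t => F (x, t)) by exact: (measurableT_comp mF (pair1_measurable x)).
have iFx : Rintegrable lam (fun t => F (x, t)).
  by apply: le_Rintegrable ig _ => // t; rewrite (ger0_norm (g0 t)).
have mI : measurable (`]a, b[%classic : set Y) by exact: measurable_itv.
have sub : `]a, b[%classic `<=` (`]0, T[%classic : set R).
  move=> t /=; rewrite !in_itv/= => /andP[at_ tb].
  by rewrite (le_lt_trans a0 at_) (lt_le_trans tb bT).
transitivity (\int[lam]_(t in `]a, b[) F (x, t)).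
  congr fine; apply: ae_eq_integral => //.
  - by apply/measurable_EFinP; apply: measurable_funS (mf x) => //; exact: measurable_itv.
  - by apply/measurable_EFinP; exact: measurable_funS mFx.
  - by apply: ae_imply fx => t h tI; rewrite h//; apply/mem_set/sub.
(* Adding the left endpoint, a null set, turns the open interval of [average] into the half-open
   [cell]. *)
rewrite Rintegral_itv_obnd_cbnd; last exact: integrableS iFx.
rewrite Rintegral_mkcond; apply: eq_Rintegral => t _.
by rewrite patchE indicE /cell; case: ifP => _; rewrite ?mulr1 ?mulr0.
Qed.

End source_average.

(** * Uniform estimates at the nodes *)

Section scheme_values.
Context {R : realType} {N : nat}.
Notation X := 'rV[R]_N.
Notation Y := (measurableTypeR R).
Notation mu := (@leb R N).
Notation lam := (@lebesgue_measure R).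
Notation rho delta := (@ball_restr R N delta).
Notation AA delta g := (jump_avg (rho delta) (jump_avg (rho delta) g)).
Variables (T m0 : R) (u0 : X -> R) (f : X -> R -> R) (F : X * Y -> R) (g : Y -> R).
Hypotheses (T0 : 0 < T) (iu0 : Rintegrable mu u0) (m00 : 0 <= m0)
  (u0m0 : {ae mu, forall x, `|u0 x| <= m0})
  (mF : measurable_fun setT F) (Fg : forall x t, `|F (x, t)| <= g t)
  (ig : Rintegrable lam g) (iF : Rintegrable (mu \x lam)%E F)
  (mf : forall x, measurable_fun (`]0, T[%classic : set Y) (f x))
  (fF : {ae mu, forall x, {ae lam, forall t, t \in (`]0, T[%classic : set R) -> f x t = F (x, t)}}).
Let M : R := m0 + \int[lam]_t g t.
Hypothesis ME : sup_bound u0 f T = M.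

Let g0 t : 0 <= g t. Proof. exact: le_trans (Fg 0 t). Qed.
Let M0 : 0 <= M. Proof. by rewrite addr_ge0// Rintegral_ge0. Qed.

Variables (S : scheme R N) (U : nat -> X -> R).
Hypotheses (grid : time_grid S T) (adm : admissible u0 f T S) (sol : scheme_solution u0 f S U).
Let J := steps S.

Definition source_step j := source_cell F (node S j) (node S j.+1).
(* Set to 0 beyond the last step so as to be nonnegative for all [j]. *)
Definition source_bound j : R :=
  if (j < J)%N then time_integral g (node S j.+1) - time_integral g (node S j) else 0.

Lemma source_bound_ge0 j : 0 <= source_bound j.
Proof.
rewrite /source_bound; case: ifP => // jJ; rewrite subr_ge0.
have /andP[n0 _] := node_bounds grid (ltnW jJ).
by apply: time_integral_le => //; apply: (node_le grid); rewrite leqnSn.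
Qed.

Let node0 : node S 0 = 0. Proof. by case: grid. Qed.

Lemma sum_cells (k : Y -> R) j : (j <= J)%N ->
  \sum_(i < j) (time_integral k (node S i.+1) - time_integral k (node S i)) = time_integral k (node S j).
Proof.
move=> jJ; rewrite -(big_mkord xpredT (fun i => time_integral k (node S i.+1) - time_integral k (node S i))).
by rewrite (telescope_sumr (fun i => time_integral k (node S i)))// node0 time_integral0 subr0.
Qed.

Lemma sum_source_bound : m0 + \sum_(i < J) source_bound i <= M.
Proof.
rewrite lerD2l (eq_bigr (fun i : 'I_J => time_integral g (node S i.+1) - time_integral g (node S i))).
  by rewrite sum_cells//; exact: time_integral_le_Rintegral.
by move=> i _; rewrite /source_bound ltn_ord.
Qed.

Let V j := trunc M (U j).

(** Everything that compactness asks of the scheme at the nodes, for representatives bounded at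
    every point. Both terms of the last bound are increments of functions of time, so that they
    telescope over successive steps. *)
Lemma scheme_values :
  [/\ forall j, (j <= J)%N -> Rintegrable mu (V j),
      forall j x, `|V j x| <= M,
      forall j, (j <= J)%N -> {ae mu, forall x, V j x = U j x},
      forall (xi : X) j, (j <= J)%N ->
        (l1norm mu (fun x => V j (x + xi) - V j x)%R <=
         l1norm mu (fun x => u0 (x + xi) - u0 x)%R + (\int[lam]_t source_increment F xi t)%R%:E)%E &
      forall (delta C1 B1 B2 Lam : R) j x, 0 < delta -> 0 <= C1 ->
        (forall (w : X -> R) (C : R) (x z : X), measurable_fun setT w -> (forall x, `|w x| <= C) ->
          `|jump_avg (rho delta) w (x + z) - jump_avg (rho delta) w x| <= C1 * C * Num.min `|z| 1) ->
        (forall r, `|r| <= M -> `|phi1 S r| <= B1) ->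
        (forall r, `|r| <= M -> `|phi2 S r| <= B2) ->
        \int[nu1 S]_z Num.min (`|z| ^+ 2) 1 <= Lam ->
        \int[nu2 S]_z Num.min (`|z| ^+ 2) 1 <= Lam -> (j < J)%N ->
        `|AA delta (V j.+1) x - AA delta (V j) x| <=
          dt S j * (C1 ^+ 2 * (B1 + B2) * Lam) + mass (rho delta) ^+ 2 *
          (time_integral g (node S j.+1) - time_integral g (node S j))].
Proof.
case: adm => -[[[_ _ nu1N] nu1oo] [[_ _ nu2N] nu2oo]] [hphi1 cphi1] [hphi2 lphi2].
rewrite ME => cfl; case: sol => UL U0 UE.
have [n1 n1E] := finite_measure_of nu1oo; have [n2 n2E] := finite_measure_of nu2oo.
have n1N (A : set X) : measurable A -> n1 (-%R @^-1` A) = n1 A by move=> mA; rewrite !n1E nu1N.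
have n2N (A : set X) : measurable A -> n2 (-%R @^-1` A) = n2 A by move=> mA; rewrite !n2E nu2N.
have Rint_eq (nu : {measure set X -> \bar R}) (n : {finite_measure set X -> \bar R}) (w : X -> R) :
    (forall A, n A = nu A) -> \int[n]_z w z = \int[nu]_z w z.
  by move=> nE; congr fine; apply: eq_measure_integral => A _ _; exact: nE.
have iU j : (j <= J)%N -> Rintegrable mu (U j) by move=> /UL /L1_Loo_bounded[].
have bU j : (j <= J)%N -> exists2 C, 0 <= C & {ae mu, forall x, `|U j x| <= C}.
  by move=> /UL /L1_Loo_bounded[_ [C _ [C0 UC]]]; exists C.
have L0 := lipschitz_constant_ge0 (phi2 S) `[- M, M].
have hL r s : `|r| <= M -> `|s| <= M ->
    `|phi2 S r - phi2 S s| <= lipschitz_constant `[- M, M] (phi2 S) * `|r - s|.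
  exact: lipschitz_constantP.
have tau0 j : (j < J)%N -> 0 <= dt S j by move=> jJ; exact/ltW/(dt_gt0 grid).
have cflj j : (j < J)%N -> dt S j * lipschitz_constant `[- M, M] (phi2 S) * mass n2 <= 1.
  move=> jJ; apply: (@le_trans _ _ (mesh S * lipschitz_constant `[- M, M] (phi2 S) * mass n2)).
    by apply: ler_wpM2r; [exact: mass_ge0|apply: ler_wpM2r => //; exact: dt_le_mesh].
  rewrite -lee_fin EFinM /mass fineK ?n2E//.
  by rewrite ge0_fin_numE.
have ib j : (j < J)%N -> Rintegrable mu (source_step j) by move=> _; exact: Rintegrable_source_cell.
have cellE j : (j < J)%N -> [/\ 0 <= node S j, node S j < node S j.+1 & node S j.+1 <= T].
  move=> jJ; have /andP[? _] := node_bounds grid (ltnW jJ); have /andP[_ ?] := node_bounds grid jJ.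
  by split => //; have := dt_gt0 grid jJ; rewrite /dt subr_gt0.
have bbeta j : (j < J)%N -> {ae mu, forall x, `|source_step j x| <= source_bound j}.
  move=> jJ; apply: aeW => x; rewrite /source_bound jJ; have [? /ltW ? _] := cellE j jJ.
  exact: norm_source_cell.
have USE : step_equation n1 n2 (phi1 S) (phi2 S) J (dt S) source_step U.
  move=> j jJ; have [a0 ab bT] := cellE j jJ.
  apply: ae_imply2 (UE j jJ) (average_source_cell mF Fg ig mf fF a0 ab bT) => x -> e.
  rewrite /discrete_op (Rint_eq _ _ _ n1E) (Rint_eq _ _ _ n2E) /average e.
  by rewrite mulrDr mulVKf ?addrA// gt_eqF// (dt_gt0 grid).
have U0m : {ae mu, forall x, `|U 0%N x| <= m0} by apply: ae_imply2 U0 u0m0 => x ->.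
have UM j : (j <= J)%N -> {ae mu, forall x, `|U j x| <= M}.
  exact: (step_equation_bound n1N hphi1 hphi2 tau0 bbeta source_bound_ge0 hL cflj iU bU USE m00 U0m sum_source_bound).
have VU j : (j <= J)%N -> {ae mu, forall x, V j x = U j x} by move=> jJ; exact/ae_trunc/UM.
have iV j : (j <= J)%N -> Rintegrable mu (V j) by move=> jJ; exact/Rintegrable_trunc/iU.
have VM j x : `|V j x| <= M by exact: norm_trunc.
have VE : step_equation n1 n2 (phi1 S) (phi2 S) J (dt S) source_step V.
  move=> j jJ; apply: (step_equation_ae hphi1 hphi2 _ _ _ jJ (USE j jJ)).
  - by move=> i iJ; exact: Rintegrable_measurable (iU i iJ).
  - by move=> i iJ; exact: Rintegrable_measurable (iV i iJ).
  - by move=> i iJ; apply: ae_imply (VU i iJ).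
split => //.
- move=> xi j jJ.
  apply: le_trans (step_equation_translation n1N hphi1 hphi2 cphi1 tau0 ib hL cflj iV (fun j x _ => VM j x) VE xi jJ) _.
  have iVu : {ae mu, forall x, V 0%N x = u0 x} by apply: ae_imply2 (VU 0%N (leq0n _)) U0 => x -> ->.
  have mV := Rintegrable_measurable (iV 0%N (leq0n _)); have mu0 := Rintegrable_measurable iu0.
  apply: leeD.
    rewrite le_eqVlt; apply/orP; left; apply/eqP; apply: ae_eq_l1norm.
    - by apply: measurable_funB => //; exact: measurable_fun_shift.
    - by apply: measurable_funB => //; exact: measurable_fun_shift.
    - by apply: ae_imply2 iVu (ae_shift xi iVu) => x -> ->.
  (* The translation errors of the source over the cells telescope to a time integral, bounded by
     the one over all times. *)
  apply: (@le_trans _ _ (\sum_(i < j) (time_integral (source_increment F xi) (node S i.+1) -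
      time_integral (source_increment F xi) (node S i))%:E)%E).
    apply: lee_sum => i _; have [a0 /ltW ab _] := cellE i (leq_trans (ltn_ord i) jJ).
    exact: l1norm_source_cell.
  rewrite sumEFin lee_fin sum_cells//; apply: time_integral_le_Rintegral.
    exact: Rintegrable_source_increment.
  by move=> t; exact: source_increment_ge0.
- move=> delta C1 B1 B2 Lam j x d0 C10 hC1 hB1 hB2 hl1 hl2 jJ.
  rewrite -(Rint_eq _ _ _ n1E) in hl1; rewrite -(Rint_eq _ _ _ n2E) in hl2.
  have := step_equation_time n1N n2N hphi1 hphi2 tau0 ib bbeta source_bound_ge0 M0 iV
     (fun j x _ => VM j x) VE x d0 C10 hC1 hB1 hB2 hl1 hl2 jJ.
  by rewrite /source_bound jJ.
Qed.

End scheme_values.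

Lemma convex_dist_le {R : realFieldType} (a b c B th : R) : 0 <= th <= 1 ->
  `|a - c| <= B -> `|b - c| <= B -> `|a + th * (b - a) - c| <= B.
Proof.
move=> /andP[t0 t1]; rewrite !ler_norml => /andP[a1 a2] /andP[b1 b2].
by apply/andP; split; nra.
Qed.

Lemma l1norm_convex_le {d} {Y : measurableType d} {R : realType} (m : {measure set Y -> \bar R})
    (u v : Y -> R) (e th : R) : measurable_fun setT u -> measurable_fun setT v -> 0 <= th <= 1 ->
  (l1norm m u <= e%:E)%E -> (l1norm m v <= e%:E)%E ->
  (l1norm m (fun x => u x + th * (v x - u x))%R <= e%:E)%E.
Proof.
move=> mu' mv /andP[t0 t1] hu hv.
have m1 : measurable_fun setT (fun x => (1 - th) * u x) by exact: measurable_funM.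
have m2 : measurable_fun setT (fun x => th * v x) by exact: measurable_funM.
rewrite (_ : (fun x => _) = (fun x => (1 - th) * u x) \+ (fun x => th * v x)); last first.
  by apply/funext => x /=; ring.
apply: le_trans (l1norm_triangle m m1 m2) _; rewrite !l1normZ// !ger0_norm ?subr_ge0//.
apply: (@le_trans _ _ ((1 - th)%:E * e%:E + th%:E * e%:E)%E).
  by apply: leeD; apply: lee_wpmul2l => //; rewrite lee_fin ?subr_ge0.
by rewrite -!EFinM -EFinD lee_fin -mulrDl subrK mul1r.
Qed.

Lemma jump_avg_convex {R : realType} {N : nat} (nu : {finite_measure set 'rV[R]_N -> \bar R})
    (v w : 'rV[R]_N -> R) (C th : R) x : measurable_fun setT v -> measurable_fun setT w ->
  (forall x, `|v x| <= C) -> (forall x, `|w x| <= C) ->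
  jump_avg nu (fun y => v y + th * (w y - v y)) x =
    jump_avg nu v x + th * (jump_avg nu w x - jump_avg nu v x).
Proof.
move=> mv mw vC wC.
have iv := Rintegrable_shiftl nu x mv vC; have iw := Rintegrable_shiftl nu x mw wC.
have iB := RintegrableB iw iv.
rewrite /jump_avg -(RintegralB measurableT iw iv) -(RintegralZl _ measurableT iB).
by rewrite -(RintegralD measurableT iv (RintegrableZ th iB)).
Qed.

Lemma ae_fst {d1 d2} {T1 : measurableType d1} {T2 : measurableType d2} {R : realType}
    (m1 : {sigma_finite_measure set T1 -> \bar R}) (m2 : {sigma_finite_measure set T2 -> \bar R})
    (P : T1 -> Prop) : {ae m1, forall x, P x} -> {ae (m1 \x m2)%E, forall p, P p.1}.
Proof.
move=> aeP; have [A [mA A0 PA]] := aeP.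
apply: (@ae_prod_of_ysections _ _ _ _ _ _ _ _ (fst @^-1` A)).
- by rewrite -[X in measurable X]setTI; exact: measurable_fst.
- by move=> p np; exact: PA.
- by apply: aeW => y; exists A; split => // x /= nA; apply: contrapT.
Qed.

Section interpolant_estimates.
Context {R : realType} {N : nat}.
Notation X := 'rV[R]_N.
Notation mu := (@leb R N).
Variables (S : scheme R N) (T M : R) (V : nat -> X -> R).
Hypotheses (T0 : 0 < T) (grid : time_grid S T).
Let J := steps S.
Hypotheses (iV : forall j, (j <= J)%N -> Rintegrable mu (V j)) (VM : forall j x, `|V j x| <= M).
Let W := interpolant S V.

Let mV j : (j <= J)%N -> measurable_fun setT (V j).
Proof. by move=> jJ; exact: Rintegrable_measurable (iV jJ). Qed.

Let M0 : 0 <= M. Proof. exact: le_trans (VM 0 0). Qed.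

Lemma norm_interpolant t x : `|W t x| <= M.
Proof.
have [tT|tT] := boolP (0 <= t <= T); last by rewrite /W (interpolant_eq0_out T0 grid)// normr0.
have [j [th [_ th01 _ WE]]] := interpolant_convex T0 grid tT.
have := convex_dist_le (a := V j x) (b := V j.+1 x) (c := 0) (B := M) th01.
by rewrite !subr0 /W WE; apply.
Qed.

Lemma Rintegrable_interpolant t : 0 <= t <= T -> Rintegrable mu (W t).
Proof.
move=> tT; have [j [th [jJ _ _ WE]]] := interpolant_convex T0 grid tT.
rewrite (_ : W t = fun x => V j x + th * (V j.+1 x - V j x)); last by apply/funext => x; exact: WE.
apply: RintegrableD; first exact/iV/ltnW.
by apply: RintegrableZ; apply: RintegrableB; [exact: iV|exact/iV/ltnW].
Qed.

Lemma l1norm_interpolant_translation t (xi : X) (e : R) : 0 <= t <= T ->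
  (forall j, (j <= J)%N -> l1norm mu (fun x => V j (x + xi) - V j x)%R <= e%:E)%E ->
  (l1norm mu (fun x => W t (x + xi) - W t x)%R <= e%:E)%E.
Proof.
move=> tT hV; have [j [th [jJ th01 _ WE]]] := interpolant_convex T0 grid tT.
have mS i : (i <= J)%N -> measurable_fun setT (fun x : X => V i (x + xi) - V i x).
  by move=> iJ; apply: measurable_funB; [apply: measurable_fun_shift|]; exact: mV.
have := l1norm_convex_le (mS j (ltnW jJ)) (mS j.+1 jJ) th01 (hV j (ltnW jJ)) (hV j.+1 jJ).
congr (l1norm mu _ <= _)%E; apply/funext => x; rewrite /W !WE; ring.
Qed.

(** The times s and t are enlarged to the enclosing nodes [a] and [b], which costs at most two
    cells, hence 2 mesh. Any [D] whose increments dominate those of the averages at consecutive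
    nodes will do. *)
Lemma interpolant_time_increment (delta : R) (D : R -> R) s t x : 0 < delta ->
  (forall j, (j < J)%N ->
    `|jump_avg (ball_restr delta) (jump_avg (ball_restr delta) (V j.+1)) x -
      jump_avg (ball_restr delta) (jump_avg (ball_restr delta) (V j)) x| <=
    D (node S j.+1) - D (node S j)) ->
  0 <= s <= T -> 0 <= t <= T -> s < t ->
  exists a b : R, [/\ 0 <= a, a <= b, b - a <= t - s + 2 * mesh S &
    `|jump_avg (ball_restr delta) (jump_avg (ball_restr delta) (W t)) x -
      jump_avg (ball_restr delta) (jump_avg (ball_restr delta) (W s)) x| <= D b - D a].
Proof.
move=> d0 hD sT tT st; set rho := ball_restr delta in hD *.
have AAW r : 0 <= r <= T -> exists (j : nat) (th : R), [/\ (j < J)%N, 0 <= th <= 1,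
    node S j <= r <= node S j.+1 & jump_avg rho (jump_avg rho (W r)) x =
      jump_avg rho (jump_avg rho (V j)) x + th * (jump_avg rho (jump_avg rho (V j.+1)) x -
        jump_avg rho (jump_avg rho (V j)) x)].
  move=> rT; have [j [th [jJ th01 jr WE]]] := interpolant_convex T0 grid rT.
  exists j, th; split=> //.
  have -> : W r = fun y => V j y + th * (V j.+1 y - V j y) by apply/funext => y; exact: WE.
  have A1 i : (i <= J)%N -> measurable_fun setT (jump_avg rho (V i)).
    by move=> iJ; exact: (measurable_jump_avg rho (mV iJ) (VM i)).
  have A2 i y : (i <= J)%N -> `|jump_avg rho (V i) y| <= mass rho * M.
    by move=> iJ; exact: (norm_jump_avg rho y (mV iJ) (VM i)).
  have -> : jump_avg rho (fun y => V j y + th * (V j.+1 y - V j y)) =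
      fun y => jump_avg rho (V j) y + th * (jump_avg rho (V j.+1) y - jump_avg rho (V j) y).
    by apply/funext => y; exact: (jump_avg_convex rho th y (mV (ltnW jJ)) (mV jJ) (VM j) (VM j.+1)).
  exact: (jump_avg_convex rho th x (A1 j (ltnW jJ)) (A1 j.+1 jJ) (fun y => A2 j y (ltnW jJ)) (fun y => A2 j.+1 y jJ)).
have [j [th [jJ th01 /andP[js sj] ->]]] := AAW s sT.
have [k [th' [kJ th'01 /andP[kt tk] ->]]] := AAW t tT.
pose A i := jump_avg rho (jump_avg rho (V i)) x.
have {}hD i : (i < J)%N -> `|A i.+1 - A i| <= D (node S i.+1) - D (node S i) := hD i.
rewrite -/(A j) -/(A j.+1) -/(A k) -/(A k.+1); clearbody A.
have AD i i' : (i <= i' <= J)%N -> `|A i' - A i| <= D (node S i') - D (node S i).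
  move=> /andP[]; elim: i' => [|i' IH]; first by rewrite leqn0 => /eqP -> _; rewrite !subrr normr0.
  rewrite leq_eqVlt => /predU1P[<- _|ii' i'J]; first by rewrite !subrr normr0.
  have := le_trans (ler_normD (A i'.+1 - A i') (A i' - A i)) (lerD (hD i' i'J) (IH ii' (ltnW i'J))).
  by rewrite !addrA !subrK.
have jk : (j <= k)%N.
  rewrite leqNgt; apply/negP => kj; have := node_le grid (i := k.+1) (j := j).
  rewrite kj (ltnW jJ) => /(_ isT) h.
  by have := le_lt_trans (le_trans (le_trans tk h) js) st; rewrite ltxx.
have /andP[nj0 _] := node_bounds grid (ltnW jJ).
exists (node S j), (node S k.+1); split=> //.
- by apply: (node_le grid); rewrite kJ (leqW jk).
- have := dt_le_mesh jJ; have := dt_le_mesh kJ; rewrite /dt.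
  by move: kt sj; lra.
(* [D] is nondecreasing along the nodes, its increments dominating moduli, so every intermediate
   pair obeys the bound of the extreme pair. *)
have B1 i i' : (j <= i <= k.+1)%N -> (j <= i' <= k.+1)%N ->
    `|A i' - A i| <= D (node S k.+1) - D (node S j).
  have Dmono p q : (p <= q <= J)%N -> D (node S p) <= D (node S q).
    by move=> pq; rewrite -subr_ge0; exact: le_trans (normr_ge0 _) (AD _ _ pq).
  wlog ii' : i i' / (i <= i')%N.
    move=> H hi hi'; have /orP[h|h] := leq_total i i'; first exact: H.
    by rewrite distrC; exact: H.
  move=> /andP[ji ik] /andP[ji' i'k].
  have i'J := leq_trans i'k kJ.
  have h1 : D (node S j) <= D (node S i) by apply: Dmono; rewrite ji (leq_trans ii' i'J).
  have h2 : D (node S i') <= D (node S k.+1) by apply: Dmono; rewrite i'k.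
  apply: le_trans (AD i i' _) _; first by rewrite ii'.
  exact: lerB.
have in1 : (j <= j <= k.+1)%N by rewrite leqnn leqW.
have in2 : (j <= j.+1 <= k.+1)%N by rewrite leqnSn.
have in3 : (j <= k <= k.+1)%N by rewrite jk leqnSn.
have in4 : (j <= k.+1 <= k.+1)%N by rewrite leqnn leqW.
apply: (convex_dist_le th'01); rewrite distrC; apply: (convex_dist_le th01);
  exact: B1.
Qed.

End interpolant_estimates.

Section main_estimates.
Context {R : realType} {N : nat}.
Notation X := 'rV[R]_N.

Lemma uniform_levy_bound (S : R -> scheme R N) : uniform_levy S -> exists Lam : R,
  forall h, 0 < h -> h < 1 -> \int[nu1 (S h)]_z Num.min (`|z| ^+ 2) 1 <= Lam /\
    \int[nu2 (S h)]_z Num.min (`|z| ^+ 2) 1 <= Lam.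
Proof.
rewrite /uniform_levy; set A := (X in ereal_sup X) => Aoo.
have [Lam hLam] : exists Lam : R, (ereal_sup A <= Lam%:E)%E.
  by case: (ereal_sup A) Aoo => [r| |] // _; [exists r|exists 0; exact: leNye].
exists Lam => h h0 h1; have hI : h \in `]0, 1[ by rewrite in_itv/= h0 h1.
split; apply: Rintegral_levy_le; apply: le_trans hLam; apply: ereal_sup_ubound.
  by left; exists h.
by right; exists h.
Qed.

(** Uniform convergence on [-M, M] puts [p h] eventually within distance 1 of [q], which is bounded
    there; hence B + 1. *)
Lemma family_compact_bound (p : R -> R -> R) (q : R -> R) (M : R) : {homo q : r s / r <= s} ->
  {family compact, p @ 0^'+ --> q} -> exists B : R, \forall h \near 0^'+, forall r, `|r| <= M -> `|p h r| <= B.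
Proof.
move=> hq /fam_cvgP/(_ `[- M, M]%classic (@segment_compact _ _ _)) cpq.
have [B B0 hB] := homo_bounded M hq; exists (B + 1).
have : nbhs (q : {uniform` `[- M, M]%classic -> R}) [set w | forall r, `[- M, M]%classic r -> ball (q r) 1 (w r)].
  apply/uniform_nbhs; exists [set xy | ball xy.1 1 xy.2]; split => //; exact: (entourage_ball _ (PosNum (@ltr01 R))).
move=> /cpq h1.
have {h1}h2 : \forall h \near (0 : R)^'+, forall r, `[- M, M]%classic r -> ball (q r) 1 (p h r) := h1.
apply: filterS h2 => h hh r rM.
have := hh r; rewrite /= in_itv/= -ler_norml => /(_ rM) => /ltW; rewrite /ball/= => qp.
have := hB r rM; move: qp; have := ler_normB (q r) (q r - p h r).
by rewrite opprB addrC subrK; lra.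
Qed.

End main_estimates.

Section transfer.
Context {R : realType} {N : nat}.
Notation X := 'rV[R]_N.
Notation mu := (@leb R N).

Lemma eq_L1_dist_ae (K : set X) (v v' u : X -> R) : measurable K -> measurable_fun setT v ->
  measurable_fun setT v' -> measurable_fun K u -> {ae mu, forall x, v x = v' x} ->
  (L1_dist K v u = L1_dist K v' u)%E.
Proof.
move=> mK mv mv' mu' vv; apply: ae_eq_integral => //.
- apply/measurable_EFinP; apply: measurableT_comp => //; apply: measurable_funB => //.
  exact: measurable_funS mv.
- apply/measurable_EFinP; apply: measurableT_comp => //; apply: measurable_funB => //.
  exact: measurable_funS mv'.
- by apply: ae_imply vv => x -> _.
Qed.

(** Only the node values matter, so one null set serves all times. *)
Lemma ae_eq_interpolant (S : scheme R N) (V U : nat -> X -> R) :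
  (forall j, (j <= steps S)%N -> {ae mu, forall x, V j x = U j x}) ->
  {ae mu, forall x, forall t, interpolant S V t x = interpolant S U t x}.
Proof.
move=> VU.
have : {ae mu, forall x, forall j, (j <= steps S)%N -> V j x = U j x}.
  apply: ae_foralln => j; case: (boolP (j <= steps S)%N) => jJ; last by apply: aeW.
  by apply: ae_imply (VU j jJ) => x ->.
apply: ae_imply => x h t; rewrite /interpolant h//; case: ifP => // _.
by apply: eq_bigr => j _; rewrite !h// ltnW.
Qed.

End transfer.

Theorem theorem4p7 (R : realType) (N : nat) (hN : (0 < N)%N)
    (T : R) (hT : 0 < T)
    (P : nat) (sigma : 'M[R]_(N, P)) (mu : {measure set 'rV[R]_N -> \bar R})
    (phi : R -> R)
    (u0 : 'rV[R]_N -> R) (f : 'rV[R]_N -> R -> R)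
    (S : R -> scheme R N) (U : R -> nat -> 'rV[R]_N -> R)
    (hmu : levy_measure mu)
    (hphi_mono : {homo phi : r s / r <= s}) (hphi_cont : continuous phi)
    (hu0 : L1_Loo u0) (hf : source_term T f)
    (hgrid : forall h : R, 0 < h -> time_grid (S h) T)
    (hmesh : mesh (S h) @[h --> 0^'+] --> (0 : R))
    (hcons : consistent sigma mu phi S)
    (hadm : forall h : R, 0 < h -> admissible u0 f T (S h))
    (hlevy : uniform_levy S)
    (hU : forall h : R, 0 < h -> scheme_solution u0 f (S h) (U h)) :
  exists (h : nat -> R) (u : R -> 'rV[R]_N -> R),
    [/\ (forall n, 0 < h n) /\ h n @[n --> \oo] --> (0 : R),
        C_L1loc T u,
        cvg_C_L1loc T (fun n => interpolant (S (h n)) (U (h n))) u &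
        cvg_ae_QT T (fun n => interpolant (S (h n)) (U (h n))) u].
Proof.
have [iu0 [m0 m0E [m00 u0m0]]] := L1_Loo_bounded hu0.
have [F [g [[mF Fg ig iF] fF mf gE]]] := source_representative hf.
(* [M] has to be the constant of the CFL condition, which involves the Lipschitz constant of [phi2]
   on [-M, M]. *)
pose M : R := m0 + \int[lebesgue_measure]_t g t.
have ME : sup_bound u0 f T = M by rewrite /sup_bound -m0E gE -EFinD.
have g0 t : 0 <= g t by exact: le_trans (Fg 0 t).
pose V h j := trunc M (U h j).
have values (h : R) (h0 : 0 < h) := scheme_values iu0 m00 u0m0 mF Fg ig iF mf fF ME
  (hgrid h h0) (hadm h h0) (hU h h0).
pose W h := interpolant (S h) (V h).
have iV (h : R) : 0 < h -> forall j, (j <= steps (S h))%N -> Rintegrable (leb N) (V h j).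
  by move=> h0; have [] := values h h0.
have VM (h : R) : 0 < h -> forall j x, `|V h j x| <= M.
  by move=> h0; have [] := values h h0.
have VU (h : R) : 0 < h -> forall j, (j <= steps (S h))%N -> {ae leb N, forall x, V h j x = U h j x}.
  by move=> h0; have [] := values h h0.
have mW (h : R) : 0 < h -> measurable_fun setT (fun p : 'rV[R]_N * measurableTypeR R => W h p.2 p.1).
  move=> h0; apply: measurable_interpolant => j jJ; exact: Rintegrable_measurable (iV h h0 j jJ).
have mU (h t : R) : 0 < h -> measurable_fun setT (interpolant (S h) (U h) t).
  move=> h0; have mUp : measurable_fun setT
      (fun p : 'rV[R]_N * measurableTypeR R => interpolant (S h) (U h) p.2 p.1).
    apply: measurable_interpolant => j jJ; have [UL _ _] := hU h h0.
    by have [iU _] := L1_Loo_bounded (UL j jJ); exact: Rintegrable_measurable iU.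
  exact: (measurableT_comp mUp (pair2_measurable t)).
have WU (h : R) : 0 < h -> {ae leb N, forall x, forall t, W h t x = interpolant (S h) (U h) t x}.
  by move=> h0; exact: ae_eq_interpolant (VU h h0).
have [|||||h [u [[h0 hcvg] Cu cvgu aeu]]] := @L1loc_compactness R N T M W (ltW hT).
- by move=> h t h0 tT; exact: (Rintegrable_interpolant hT (hgrid h h0) (iV h h0)).
- by move=> h t x h0; exact: (norm_interpolant hT (hgrid h h0) (VM h h0)).
- exact: mW.
- move=> e e0; have e2 : 0 < e / 2 by rewrite divr_gt0.
  have [d1 d10 hd1] := integrable_l1_translation_continuous iu0 e2.
  have [d2 d20 hd2] := source_increment_small mF iF e2.
  have m0' : 0 < Num.min d1 d2 by rewrite lt_min d10 d20.
  (* Halved because the modulus is required for |xi| <= d, while [d1] and [d2] ask for strict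
     inequalities. *)
  exists (Num.min d1 d2 / 2); first by rewrite divr_gt0.
  move=> h t xi h0 tT xid; have {xid} : `|xi| < Num.min d1 d2 by lra.
  rewrite lt_min => /andP[x1 x2].
  apply: (l1norm_interpolant_translation hT (hgrid h h0) (iV h h0)) => // j jJ.
  have [_ _ _ hj _] := values h h0.
  apply: le_trans (hj xi j jJ) _; rewrite [e in leRHS](splitr e) EFinD.
  by apply: leeD; [exact: hd1|rewrite lee_fin; exact: hd2].
- move=> delta e d0 e0.
  have [C1 C10 hC1] := jump_avg_ball_lipschitz (R := R) (N := N) d0.
  have [g1 [g2 [_ [_ [_ [_ [_ [_ [[hg1 _ hg2 _] _ _ _ [cg1 cg2]]]]]]]]]] := hcons.
  have [B1 hB1] := family_compact_bound M hg1 cg1.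
  have [B2 hB2] := family_compact_bound M hg2 cg2.
  have [Lam hLam] := uniform_levy_bound hlevy.
  pose K := C1 ^+ 2 * (B1 + B2) * Lam.
  pose c := mass (@ball_restr R N delta) ^+ 2.
  have c0 : 0 < c by rewrite exprn_gt0// mass_ball_restr_gt0.
  have e2c : 0 < e / 2 / c by rewrite !divr_gt0.
  have [d1 d10 hG] := time_integral_unif_continuous ig g0 e2c.
  have K1 : 0 < `|K| + 1 by rewrite ltr_wpDl.
  have d20 : 0 < e / 2 / (`|K| + 1) by rewrite !divr_gt0.
  set d2 := e / 2 / (`|K| + 1) in d20.
  have d120 : 0 < Num.min d1 d2 / 3 by rewrite divr_gt0// lt_min d10 d20.
  (* Both t - s and the mesh stay below a third, so that t - s + 2 mesh stays below min(d1, d2). *)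
  exists (Num.min d1 d2 / 3) => //.
  have hm : \forall h \near (0 : R)^'+, mesh (S h) < Num.min d1 d2 / 3.
    have /cvgrPdist_lt/(_ _ d120) := hmesh; apply: filterS => h.
    by rewrite sub0r normrN => /(le_lt_trans (ler_norm _)).
  have hh0 : \forall h \near (0 : R)^'+, 0 < h by exact: nbhs_right_gt.
  have hh1 : \forall h \near (0 : R)^'+, h < 1 by exact: nbhs_right_lt.
  apply: filterS (filterI (filterI (filterI hB1 hB2) hm) (filterI hh0 hh1)).
  move=> h [[[b1 b2] hmd] [h0 h1]].
  (* A linear part due to the jump operators and an integral part due to the source; the increment
     of each receives e / 2. *)
  pose D (t : R) := t * K + c * time_integral g t.
  have [l1 l2] := hLam h h0 h1.
  have hD x j : (j < steps (S h))%N ->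
      `|jump_avg (ball_restr delta) (jump_avg (ball_restr delta) (V h j.+1)) x -
        jump_avg (ball_restr delta) (jump_avg (ball_restr delta) (V h j)) x| <=
      D (node (S h) j.+1) - D (node (S h) j).
    move=> jJ; have [_ _ _ _ ht] := values h h0.
    have := ht delta C1 B1 B2 Lam j x d0 C10 hC1 b1 b2 l1 l2 jJ.
    rewrite -/c -/K /dt; congr (_ <= _); rewrite /D; ring.
  have main s t x : 0 <= s <= T -> 0 <= t <= T -> s < t -> t - s < Num.min d1 d2 / 3 ->
      `|jump_avg (ball_restr delta) (jump_avg (ball_restr delta) (W h t)) x -
        jump_avg (ball_restr delta) (jump_avg (ball_restr delta) (W h s)) x| <= e.
    move=> sT tT st tsd.
    have [a [b [a0 ab abm hab]]] := interpolant_time_increment hT (hgrid h h0) (iV h h0)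
      (VM h h0) d0 (hD x) sT tT st.
    apply: le_trans hab _.
    have : b - a < Num.min d1 d2 by move: abm tsd hmd; lra.
    rewrite lt_min => /andP[ba1 ba2].
    have hGab := hG a b a0 ab ba1.
    have h3 : c * (time_integral g b - time_integral g a) <= e / 2.
      by rewrite mulrC -ler_pdivlMr.
    have h4 : (b - a) * K <= e / 2.
      apply: (@le_trans _ _ ((b - a) * (`|K| + 1))).
        apply: ler_wpM2l; first by rewrite subr_ge0.
        by apply: le_trans (ler_norm K) _; rewrite lerDl.
      by rewrite -ler_pdivlMr// ltW.
    by move: h3 h4; rewrite /D; lra.
  move=> s t sT tT std x; case: (ltgtP s t) => [st|ts|<-].
  + by apply: main => //; exact: le_lt_trans (ler_norm _) std.
  + rewrite distrC; apply: main => //; apply: le_lt_trans std; rewrite distrC; exact: ler_norm.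
  + by rewrite subrr normr0 ltW.
exists h, u; split => //.
(* Back from the truncations to [U]: at each time the two interpolants agree almost everywhere, so
   the L^1 distances coincide. *)
- move=> K cK; have mK := compact_rV_measurable cK.
  have [iuK _] := Cu K cK; have := cvgu K cK.
  rewrite (_ : (fun n => ereal_sup _) = (fun n => ereal_sup
    [set L1_dist K (interpolant (S (h n)) (U (h n)) t) (u t) | t in `[0, T]])%classic)//.
  apply/funext => n; congr ereal_sup; apply: eq_imagel => t tT.
  apply: eq_L1_dist_ae => //.
  + exact: (measurableT_comp (mW _ (h0 n)) (pair2_measurable t)).
  + exact: mU.
  + by have /integrableP[/measurable_EFinP] := iuK t tT.
  + by apply: ae_imply (WU _ (h0 n)) => x.
(* One null set of points in space serves all n and all t, and its cylinder is null in the
   product. *)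
- have WUn : {ae leb N, forall x, forall n t, W (h n) t x = interpolant (S (h n)) (U (h n)) t x}.
    by apply: ae_foralln => n; exact: WU.
  have := ae_fst (@lebesgue_measure R) WUn.
  apply: ae_imply2 aeu => p hp e pT; move: (hp pT).
  by under eq_fun do rewrite e.
Qed.
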